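(* Let $\kappa\in(0,1]$ be fixed. For each $\nu>0$ let $N\sim\mathrm{FP}(\nu,\kappa)$ be a fractional Poisson random variable, and let $\{W_n\}_{n\in\mathbb{N}}$ be a sequence of i.i.d. real random variables, independent of $N$, with $E(W_1)=0$ and $\mathrm{Var}(W_1)=1$. Then: (i) As $\nu\to\infty$, $$\widetilde S_\nu\equiv\frac{1}{\sqrt{\nu}}\sum_{i=1}^{N}W_i\ \xrightarrow{d}\ Y,$$ where $Y$ is a random variable with characteristic function $$\varphi_Y(s)=\mathcal{E}_\kappa\!\left(-\frac{s^2}{2}\right),\qquad s\in\mathbb{R}.$$ (ii) The limit random variable $Y$ admits the stochastic representation $Y\overset{d}{=}\sqrt{U}\,Z$, where $Z\sim N(0,1)$ and $U\sim \mathrm{ML}(\kappa)$ are independent.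
   Context: The Mittag-Leffler function is $\mathcal{E}_\kappa(z)=\sum_{m=0}^\infty \frac{z^m}{\Gamma(\kappa m+1)}$, $z\in\mathbb{R}$. Fractional Poisson distribution: for $\nu>0$ and $\kappa\in(0,1]$, let $\{\Delta_k\}_{k\ge1}$ be i.i.d. waiting times with $P(\Delta_k\le t)=1-\mathcal{E}_\kappa(-\nu t^\kappa)$ for $t>0$, let $T_0=0$, $T_n=\Delta_1+\cdots+\Delta_n$, and $N_{\nu,\kappa}(t)=\sup\{n\ge0:T_n\le t\}$. $N\sim\mathrm{FP}(\nu,\kappa)$ means that $N$ has the distribution of $N_{\nu,\kappa}(1)$. Its probability generating function is $E(s^N)=\mathcal{E}_\kappa(\nu(s-1))$. An empty sum ($N=0$) equals $0$. (Type 2) Mittag-Leffler distribution: for $\kappa\in(0,1)$, $U\sim\mathrm{ML}(\kappa)$ means that $U$ is a positive random variable with density $$f_\kappa(u)=\frac{1}{\pi\kappa}\sum_{j=1}^\infty\frac{(-1)^{j-1}}{j!}\sin(\pi\kappa j)\,\Gamma(\kappa j+1)\,u^{j-1},\quad u>0,$$ and its moment generating function is $E(e^{sU})=\mathcal{E}_\kappa(s)$, $s\in\mathbb{R}$. For $\kappa=1$, $\mathrm{ML}(1)$ denotes the point mass at $1$ (consistent with $\mathcal{E}_1(s)=e^s$). $\overset{d}{=}$ denotes equality in distribution and $\xrightarrow{d}$ convergence in distribution. *)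

(* Defs.v *)
From HB Require Import structures.
From mathcomp Require Import all_boot all_order all_algebra.
From mathcomp Require Import finmap.
From mathcomp Require Import all_classical all_reals all_analysis.
From mathcomp Require Import measurable_realfun.
From mathcomp Require Import complex.

Set Implicit Arguments.
Unset Strict Implicit.
Unset Printing Implicit Defensive.

Import Order.TTheory GRing.Theory Num.Theory.
Import numFieldNormedType.Exports.

Local Open Scope classical_set_scope.
Local Open Scope ring_scope.

(* Only used at x > 0, where the integral converges. *)
Definition Gamma {R : realType} (x : R) : R :=
  Rintegral lebesgue_measure `]0, +oo[%classic
    (fun t : R => t `^ (x - 1) * expR (- t)).

Definition mittag_leffler {R : realType} (kappa z : R) : R :=
  limn (fun n => \sum_(0 <= m < n) z ^+ m / Gamma (kappa * m%:R + 1)).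

Definition ML_density {R : realType} (kappa u : R) : R :=
  (pi * kappa)^-1 *
  limn (fun n => \sum_(1 <= j < n)
    (-1) ^+ j.-1 / j`!%:R * sin (pi * kappa * j%:R) *
    Gamma (kappa * j%:R + 1) * u ^+ j.-1).

(* The density lives on the positive half-line, so a variable with this law is
   positive almost surely; the case kappa = 1 is the point mass at 1. *)
Definition ML_law {R : realType} (kappa : R) (A : set R) : \bar R :=
  if kappa == 1 then \d_(1 : R) A
  else (\int[lebesgue_measure]_(u in A `&` `]0%R, +oo[) (ML_density kappa u)%:E)%E.

(* Laws are compared on measurable sets only: set functions such as [ML_law]
   are also defined, but meaningless, on the other sets. *)
Definition has_law {R : realType} d d' (T : measurableType d)
    (T' : measurableType d') (P : probability T R) (X : T -> T')
    (mu : set T' -> \bar R) : Prop :=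
  forall A, measurable A -> P (X @^-1` A) = mu A.

Definition eq_dist {R : realType} d1 d2 d' (T1 : measurableType d1)
    (T2 : measurableType d2) (T' : measurableType d')
    (P1 : probability T1 R) (X1 : T1 -> T')
    (P2 : probability T2 R) (X2 : T2 -> T') : Prop :=
  forall A, measurable A -> P1 (X1 @^-1` A) = P2 (X2 @^-1` A).

Definition sigma_rv d d' (T : measurableType d) (T' : measurableType d')
    (X : T -> T') : set (set T) := preimage_set_system setT X measurable.

Definition sigma_rv_seq d d' (T : measurableType d) (T' : measurableType d')
    (X : nat -> T -> T') : set (set T) :=
  <<s \bigcup_i sigma_rv (X i) >>.

Definition indep {R : realType} d (T : measurableType d) (P : probability T R)
    (F G : set (set T)) : Prop :=
  forall A B, F A -> G B -> P (A `&` B) = (P A * P B)%E.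

Definition mutually_indep {R : realType} d d' (T : measurableType d)
    (T' : measurableType d') (P : probability T R) (X : nat -> T -> T') : Prop :=
  forall (J : {fset nat}) (E : nat -> set T),
    (forall i, i \in J -> sigma_rv (X i) (E i)) ->
    P (\bigcap_(i in [set` J]) E i) = (\prod_(i <- J) P (E i))%E.

Definition iid {R : realType} d d' (T : measurableType d)
    (T' : measurableType d') (P : probability T R) (X : nat -> T -> T') : Prop :=
  mutually_indep P X /\ forall i, eq_dist P (X i) P (X 0%N).

(* [Delta k] is the (k+1)-st waiting time.  The supremum is taken in the
   extended reals, since it may be infinite on a null event. *)
Definition renewal_count {R : realType} (T : Type) (Delta : nat -> T -> R)
    (t : R) (w : T) : \bar R :=
  ereal_sup [set n%:R%:E | n in [set n : nat | \sum_(k < n) Delta k w <= t]].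

Definition frac_poisson {R : realType} (nu kappa : R) d (T : measurableType d)
    (P : probability T R) (N : T -> nat) : Prop :=
  exists (d' : measure_display) (T' : measurableType d')
    (P' : probability T' R) (Delta : nat -> {RV P' >-> R}),
    [/\ iid P' Delta,
        forall k t, 0 < t ->
          P' [set w | Delta k w <= t] =
          (1 - mittag_leffler kappa (- nu * t `^ kappa))%:E
      & eq_dist P (fun w => (N w)%:R%:E : \bar R) P' (renewal_count Delta 1)].

(* E(exp(i s X)), with real and imaginary parts integrated separately. *)
Definition charfun {R : realType} d (T : measurableType d)
    (P : probability T R) (X : T -> R) (s : R) : R[i] :=
  Complex (fine 'E_P[fun w => cos (s * X w)])
          (fine 'E_P[fun w => sin (s * X w)]).

Definition cvg_dist {R : realType} d d' (T : measurableType d)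
    (T' : measurableType d') (P : probability T R) (S : R -> T -> R)
    (Q : probability T' R) (Y : T' -> R) : Prop :=
  forall f : R -> R, continuous f -> (exists M, forall x, `|f x| <= M) ->
    ('E_P[f \o S nu] @[nu --> +oo%R] --> 'E_Q[f \o Y])%E.

Definition random_sum {R : realType} (T : Type) (W : nat -> T -> R)
    (N : T -> nat) (w : T) : R := \sum_(i < N w) W i w.

(* Main.v *)
(* Let phi be the characteristic function of W_1 at s / sqrt nu, and put
   psi = 1 - s^2 / (2 nu).  The generating function of N gives
   E psi^N = E_kappa(- s^2 / 2) exactly, while |phi^n - psi^n| <=
   |phi - psi| / (1 - psi) uniformly in n, and this bound tends to 0 because
   phi - psi = o(1 / nu) and 1 - psi is of order 1 / nu.  Conditioning on N, the
   characteristic functions of the normalised sums converge, and Levy's theorem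
   (by Gaussian smoothing) gives (i).

   Generating function of N: the geometric mixture with weights (1 - y) y^(n - 1)
   of the laws of the arrival times T_n has the Laplace transform of a waiting
   time of rate (1 - y) nu; the indicator of an interval is approximated by
   polynomials in e^(-t), so E y^N is the probability that such a waiting time
   exceeds 1.

   The Mittag-Leffler law: a renewal process with Sibuya waiting times, whose
   jump counts by time k have explicit weights [renw], satisfies a local limit
   theorem at scale k^kappa with limit [ML_density].  Hence the density is
   nonnegative, its moments are m! / Gamma (kappa m + 1) and its Laplace transform
   is E_kappa(- s).  Then sqrt U Z has characteristic function
   E exp(- U s^2 / 2) = E_kappa(- s^2 / 2), and (ii) is the uniqueness theorem for
   characteristic functions. *)

Require Import Defs.
From HB Require Import structures.
From mathcomp Require Import all_boot all_order all_algebra.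
From mathcomp Require Import finmap.
From mathcomp Require Import all_classical all_reals all_analysis.
From mathcomp Require Import measurable_realfun.
From mathcomp Require Import complex.
From mathcomp Require Import ring lra.

Set Implicit Arguments.
Unset Strict Implicit.
Unset Printing Implicit Defensive.

Import Order.TTheory GRing.Theory Num.Theory.
Import numFieldNormedType.Exports.

Local Open Scope classical_set_scope.
Local Open Scope ring_scope.

(** * The Gamma function *)

Section real_analysis_tools.
Context {R : realType}.
Local Notation mu := (@lebesgue_measure R).

(** The density is an alternating power series: neither its sign nor its integrals over the
    half-line can be read off, since single terms are not integrable there. Both come from the
    renewal weights, which are probabilities with exact rising moments. The limit of these weights
    involves 1 / Gamma at negative arguments, where the integral [Gamma] has no meaning; the
    reflection formula turns it into the sine of [ML_density], and is derived from Wendel's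
    inequality and Euler's product. The transform of a waiting time is a geometric series in nu /
    s^kappa, summed only for s^kappa > nu. The inversion must then use large rates only, which is
    why the cutoffs are polynomials in exponentials whose rate grows with k. The waiting time of
    rate (1 - y) nu is supplied by the hypothesis on fractional Poisson variables at that rate. With
    only two moments of W_1, the estimate phi - psi = o(1 / nu) has no explicit remainder: it is
    dominated convergence with a multiple of W_1^2 as bound. Complex numbers occur only in the
    statement; the proof treats the means of cosine and sine as a pair. *)

Lemma ftc_itv (f F : R -> R) (a b : R) : a < b ->
  (forall x, a <= x <= b -> is_derive x 1 F (f x)) ->
  (forall x, a <= x <= b -> {for x, continuous f}) ->
  (\int[mu]_(x in `[a, b]) (f x)%:E = (F b - F a)%:E)%E.
Proof.
move=> ab dF cf.
have cF x : a <= x <= b -> {for x, continuous F}.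
  move=> xab; apply/differentiable_continuous/derivable1_diffP.
  by have := dF _ xab => h; exact: ex_derive.
rewrite (@continuous_FTC2 _ f F)// ?EFinB//.
- apply/subspace_continuousP => x /=; rewrite in_itv/= => xab.
  by apply: cvg_within_filter; exact: cf.
- split.
  + move=> x; rewrite in_itv/= => /andP[ax xb].
    have h : is_derive x 1 F (f x) by apply: dF; rewrite !ltW.
    exact: ex_derive.
  + by apply: cvg_at_right_filter; apply: cF; rewrite lexx ltW.
  + by apply: cvg_at_left_filter; apply: cF; rewrite lexx ltW.
- move=> x; rewrite in_itv/= => /andP[ax xb].
  have h : is_derive x 1 F (f x) by apply: dF; rewrite !ltW.
  by rewrite derive1E derive_val.
Qed.

Lemma continuous_powR_gt0 (p x : R) : 0 < x -> {for x, continuous (fun y : R => y `^ p)}.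
Proof.
move=> x0; apply/differentiable_continuous/derivable1_diffP.
by have h := is_derive1_powR p x0; exact: ex_derive.
Qed.

(** With L = ln r, the bound exp x >= 1 + x at x = - s L and x = (1 - s) L, weighted by 1 - s and s,
    has cancelling linear terms; multiplying by exp(s L) gives the claim. *)
Lemma powR_bernoulli (r s : R) : 0 < r -> 0 <= s <= 1 -> r `^ s <= 1 - s + s * r.
Proof.
move=> r0 /andP[s0 s1].
have -> : r `^ s = expR (s * ln r) by rewrite /powR gt_eqF.
set L := ln r.
have rE : r = expR L by rewrite lnK.
have h1 := expR_ge1Dx (- (s * L)).
have h2 := expR_ge1Dx ((1 - s) * L).
have e0 := expR_gt0 (s * L).
have : 1 <= (1 - s) * expR (- (s * L)) + s * expR ((1 - s) * L).
  have := ler_wpM2l s0 h2.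
  have s1' : 0 <= 1 - s by lra.
  have := ler_wpM2l s1' h1.
  by nra.
rewrite -(ler_pM2r e0) mul1r mulrDl -!mulrA -!expRD addNr expR0 mulr1.
by rewrite (_ : (1 - s) * L + s * L = L); [rewrite -rE|ring].
Qed.

Lemma powR_expR_cvg0 (x : R) : b `^ x * expR (- b) @[b --> +oo] --> (0 : R).
Proof.
(* The exponent is rounded up to an integer m; bounding exp b below by the term of order m + 1 of
   its series leaves a spare factor 1 / b. *)
pose m := (Num.truncn `|x|).+1.
have xm : x <= m%:R by rewrite (le_trans (ler_norm _))// ltW// truncnS_gt.
apply: (@squeeze_cvgr _ _ _ _ (fun=> 0) (fun b => m.+1`!%:R * b^-1)).
- near=> b.
  have b1 : 1 <= b by near: b; exact: nbhs_pinfty_ge.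
  have b0 : 0 < b by lra.
  rewrite mulr_ge0 ?powR_ge0 ?expR_ge0//=.
  have h : b ^+ m.+1 / m.+1`!%:R <= expR b.
    by have := expR_ge1Dxn m (ltW b0); lra.
  have f0 : 0 < m.+1`!%:R :> R by rewrite ltr0n fact_gt0.
  have : b `^ x <= b ^+ m by rewrite -powR_mulrn ?(ltW b0)// ler_powR.
  rewrite expRN ler_pdivrMr ?expR_gt0// => /le_trans; apply.
  rewrite mulrAC ler_pdivlMr// -exprSr mulrC -ler_pdivrMr//.
- exact: cvg_cst.
- rewrite -[X in _ --> X](mulr0 (m.+1`!%:R)); apply: cvgMr.
  by apply/gtr0_cvgV0; [exact: nbhs_pinfty_gt|exact: cvg_id].
Unshelve. all: end_near. Qed.

End real_analysis_tools.

Section gamma_function.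
Context {R : realType}.
Local Notation mu := (@lebesgue_measure R).
Implicit Types x s t : R.

Definition gamma_integrand x t : R := t `^ (x - 1) * expR (- t).
Local Notation gi := gamma_integrand.

(** The value is kept in the extended reals because the recurrence is proved before the integral is
    known to be finite, and finiteness is then deduced from it. *)
Definition gammaE x : \bar R :=
  (\int[mu]_(t in `]0%R, +oo[) (gi x t)%:E)%E.

Lemma GammaE x : Gamma x = fine (gammaE x).
Proof. by []. Qed.

Lemma gamma_integrand_ge0 x t : 0 <= gi x t.
Proof. by rewrite mulr_ge0 ?powR_ge0 ?expR_ge0. Qed.

Lemma measurable_gamma_integrand x : measurable_fun setT (gi x).
Proof.
apply: measurable_funM; first exact: measurable_powR.
by apply: measurableT_comp => //; exact: measurable_oppr.
Qed.

Let measurable_giE D x : measurable_fun D (fun t => (gi x t)%:E).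
Proof.
apply/measurable_EFinP; apply: measurable_funTS.
exact: measurable_gamma_integrand.
Qed.

Lemma gammaE_ge0 x : (0 <= gammaE x)%E.
Proof. by apply: integral_ge0 => t _; rewrite lee_fin gamma_integrand_ge0. Qed.

(** Integration by parts away from 0, where the integrand is singular for x < 1; the boundary terms
    vanish later, in [gammaE_recurrence], because x > 0. *)
Lemma gamma_itv x a b : 0 < a -> a < b ->
  (\int[mu]_(t in `[a, b]) (gi (x + 1) t)%:E =
   (a `^ x * expR (- a) - b `^ x * expR (- b))%:E +
   x%:E * \int[mu]_(t in `[a, b]) (gi x t)%:E)%E.
Proof.
move=> a0 ab.
have p0 t : a <= t <= b -> 0 < t by case/andP => at_ _; exact: lt_le_trans at_.
have cg y t : 0 < t -> {for t, continuous (gi y)}.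
  move=> t0; apply: cvgM; first exact: continuous_powR_gt0.
  by apply: continuous_comp; [exact: continuousN|exact: continuous_expR].
have cgi y : mu.-integrable `[a, b] (EFin \o gi y).
  apply: continuous_compact_integrable; first exact: segment_compact.
  apply/subspace_continuousP => t /=; rewrite in_itv/= => /p0 t0.
  by apply: cvg_within_filter; exact: cg.
have := @ftc_itv _ (fun t => x * gi x t - gi (x + 1) t)
  (fun t => t `^ x * expR (- t)) a b ab.
move=> /(_ _ _)/wrap[].
  move=> t /p0 t0; have h := is_derive1_powR x t0.
  apply: is_derive_eq; rewrite /gi /gamma_integrand addrK.
  by rewrite /GRing.scale/=; ring.
- move=> t /p0 t0; apply: cvgB; last exact: cg.
  by apply: cvgM; [exact: cvg_cst|exact: cg].
under eq_integral do rewrite EFinB EFinM.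
have ix : mu.-integrable `[a, b] (fun t => x%:E * (gi x t)%:E)%E.
  by apply: integrableZl => //; exact: cgi.
rewrite integralB//; last exact: cgi.
rewrite integralZl//; last exact: cgi.
have /fineK <- : (\int[mu]_(t in `[a, b]) (gi (x + 1) t)%:E)%E \is a fin_num.
  exact/integrable_fin_num/cgi.
have /fineK <- : (\int[mu]_(t in `[a, b]) (gi x t)%:E)%E \is a fin_num.
  exact/integrable_fin_num/cgi.
rewrite -EFinM -EFinB => -[e]; rewrite -EFinD; congr EFin; lra.
Qed.

Let I n : set R := `[n.+2%:R^-1, n.+2%:R]%classic.

Let itvI : `]0, +oo[%classic = \bigcup_n I n :> set R.
Proof.
apply/seteqP; split => [t /=|t [n _]]; rewrite /I/= !in_itv/= ?andbT; last first.
  by move=> /andP[+ _]; apply: lt_le_trans; rewrite invr_gt0.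
move=> t0; exists (Num.truncn (Num.max t t^-1)) => //=; rewrite in_itv/=.
have h := truncnS_gt (Num.max t t^-1).
have : Num.max t t^-1 <= (Num.truncn (Num.max t t^-1)).+2%:R.
  by rewrite (le_trans (ltW h))// ler_nat.
rewrite ge_max => /andP[h1 h2]; rewrite h1 andbT.
by rewrite -[leRHS]invrK lef_pV2 ?posrE ?invr_gt0.
Qed.

Let ndI : nondecreasing_seq I.
Proof.
move=> m n mn; apply/subsetPset => t; rewrite /I/= !in_itv/= => /andP[h1 h2].
apply/andP; split.
  by apply: le_trans h1; rewrite lef_pV2 ?posrE// ler_nat.
by apply: (le_trans h2); rewrite ler_nat.
Qed.

Let gamma_cvg x :
  ((\int[mu]_(t in I n) (gi x t)%:E)%E @[n --> \oo] --> gammaE x)%classic.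
Proof.
rewrite /gammaE itvI; apply: ge0_nondecreasing_set_cvg_integral => //.
- by move=> n; rewrite /I.
- move=> n; apply/measurable_EFinP; apply: measurable_funTS.
  exact: measurable_gamma_integrand.
- by move=> n t _; rewrite lee_fin gamma_integrand_ge0.
Qed.

Lemma gammaE_recurrence x : 0 < x -> (gammaE (x + 1) = x%:E * gammaE x)%E.
Proof.
move=> x0.
have lim0 : (n.+2%:R^-1 : R) `^ x * expR (- n.+2%:R^-1) -
    (n.+2%:R : R) `^ x * expR (- n.+2%:R) @[n --> \oo] --> (0 : R).
  have n2 : (n.+2%:R : R) @[n --> \oo] --> +oo.
    by apply/cvgryPge => A; near=> n; rewrite (@le_trans _ _ n%:R) ?ler_nat//
      ?(leq_trans _ (leqnSn _))//; near: n; exact: nbhs_infty_ger.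
  rewrite -[X in _ --> X](subr0 0); apply: cvgB; last first.
    exact: (cvg_comp _ _ n2 (powR_expR_cvg0 x)).
  have h : (n.+2%:R^-1 : R) `^ x @[n --> \oo] --> (0 : R).
    have h0 : (n.+2%:R^-1 : R) @[n --> \oo] --> (0 : R).
      by apply/gtr0_cvgV0 => //; near=> n.
    have := powR_cvg0 x0 => /cvg_at_rightP; apply; split => //.
  apply: (@squeeze_cvgr _ _ _ _ (fun=> 0) (fun n => (n.+2%:R^-1 : R) `^ x)) => //.
    near=> n; rewrite mulr_ge0 ?powR_ge0 ?expR_ge0//=.
    by rewrite ler_piMr ?powR_ge0// expR_le1 oppr_le0 invr_ge0.
  exact: cvg_cst.
have h1 := @gamma_cvg (x + 1).
have h2 : ((\int[mu]_(t in I n) (gi (x + 1) t)%:E)%E @[n --> \oo]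
    --> (0%:E + x%:E * gammaE x)%E)%classic.
  have -> : (fun n => \int[mu]_(t in I n) (gi (x + 1) t)%:E)%E = (fun n =>
     ((n.+2%:R^-1 : R) `^ x * expR (- n.+2%:R^-1) -
    (n.+2%:R : R) `^ x * expR (- n.+2%:R))%:E +
    x%:E * (\int[mu]_(t in I n) (gi x t)%:E))%E.
    apply/funext => n; rewrite gamma_itv//.
    by rewrite (@lt_trans _ _ 1) ?invf_lt1 ?ltr1n.
  apply: cvgeD => //; first by apply: cvg_EFin; [exact: nearW|exact: lim0].
  by apply: cvgeZl => //; exact: gamma_cvg.
by rewrite (cvg_unique _ h1 h2)// add0e.
Unshelve. all: end_near. Qed.

Lemma integral_expRN (a : R) :
  (\int[mu]_(t in `]a, +oo[) (expR (- t))%:E = (expR (- a))%:E)%E.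
Proof.
rewrite integral_itv_obnd_cbnd//; last first.
  apply/measurable_EFinP/measurable_funTS.
  by apply: measurableT_comp => //; exact: measurable_oppr.
have cN : continuous (fun t : R => expR (- t)).
  by move=> t; apply: continuous_comp; [exact: continuousN|exact: continuous_expR].
rewrite (@ge0_continuous_FTC2y _ _ (fun t => - expR (- t)) _ 0)//.
- by rewrite EFinN oppeK add0e.
- by apply: continuous_subspaceT.
- by rewrite -oppr0; apply: cvgN; exact: cvgr_expR.
- by apply: cvgN; apply: cvg_at_right_filter; exact: cN.
- move=> t _; rewrite derive1E derive_val /GRing.scale/=; ring.
Qed.

Lemma gammaE1 : gammaE 1 = 1%E.
Proof.
rewrite /gammaE; under eq_integral do
  rewrite /gamma_integrand subrr powRr0 mul1r.
by rewrite integral_expRN oppr0 expR0.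
Qed.

(** The bound t^s <= 1 + t for s in [0, 1] controls the values on [1, 2] by those at 1 and 2. The
    recurrence carries finiteness upwards and, read backwards, down to (0, 1): an infinite value at
    x would make the value at x + 1 infinite. *)
Lemma gammaE_lty x : 0 < x -> (gammaE x < +oo)%E.
Proof.
have base s : 0 <= s <= 1 -> (gammaE (1 + s) < +oo)%E.
  move=> /andP[s0 s1].
  apply: (@le_lt_trans _ _ (gammaE 1 + gammaE (1 + 1))%E); last first.
    by rewrite gammaE_recurrence// gammaE1 mule1 -EFinD ltry.
  rewrite -ge0_integralD//=; first last.
  - exact: measurable_giE.
  - by move=> t _; rewrite lee_fin gamma_integrand_ge0.
  - exact: measurable_giE.
  - by move=> t _; rewrite lee_fin gamma_integrand_ge0.
  apply: ge0_le_integral => //.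
  - by move=> t _; rewrite lee_fin gamma_integrand_ge0.
  - exact: measurable_giE.
  - by apply: emeasurable_funD; exact: measurable_giE.
  move=> t; rewrite /= in_itv/= andbT => t0.
  rewrite -EFinD lee_fin /gi /gamma_integrand -mulrDl ler_wpM2r ?expR_ge0//.
  rewrite addrAC subrr add0r powRr0 addrK powRr1 ?ltW//.
  have := @powR_bernoulli _ t s t0; rewrite s0 s1 => /(_ isT).
  nra.
have ind n y : 1 <= y <= n%:R + 1 -> (gammaE y < +oo)%E.
  elim: n y => [|n IH] y /andP[y1 yn].
    have -> : y = 1 + 0 :> R by lra.
    by apply: base; rewrite lexx ler01.
  have [y2|y2] := leP y 2.
    by rewrite (_ : y = 1 + (y - 1)); [apply: base|]; lra.
  have -> : y = (y - 1) + 1 by ring.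
  rewrite gammaE_recurrence; last by lra.
  rewrite lte_mul_pinfty// ?lee_fin; first by lra.
  by apply: IH; rewrite -natr1 in yn; lra.
move=> x0.
have [x1|x1] := leP 1 x.
  apply: (ind (Num.truncn x).+1); rewrite x1/=.
  by have := truncnS_gt x; lra.
have := gammaE_recurrence x0.
have : (gammaE (x + 1) < +oo)%E by rewrite addrC; apply: base; lra.
move=> /[swap] ->; case: (gammaE x) => [r _||] //; first exact: ltry.
by rewrite gt0_muley ?lte_fin.
Qed.

Lemma gammaE_fin x : 0 < x -> gammaE x = (Gamma x)%:E.
Proof.
by move=> x0; rewrite GammaE fineK// ge0_fin_numE ?gammaE_lty// gammaE_ge0.
Qed.

Lemma Gamma_recurrence x : 0 < x -> Gamma (x + 1) = x * Gamma x.
Proof.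
move=> x0; apply: EFin_inj; rewrite EFinM -!gammaE_fin// ?gammaE_recurrence//.
by rewrite addr_gt0.
Qed.

Lemma Gamma1 : Gamma (1 : R) = 1.
Proof. by rewrite GammaE gammaE1. Qed.

Lemma Gamma_nat n : Gamma (n.+1%:R : R) = n`!%:R.
Proof.
elim: n => [|n IH]; first exact: Gamma1.
by rewrite -natr1 Gamma_recurrence// IH -natrM factS.
Qed.

Lemma Gamma_ge0 x : 0 <= Gamma x.
Proof. by rewrite GammaE fine_ge0// gammaE_ge0. Qed.

(* Wendel: bound t^s by the tangent of t |-> t^s at t = x. *)
Lemma Gamma_addr_le x s : 0 < x -> 0 <= s <= 1 ->
  Gamma (x + s) <= x `^ s * Gamma x.
Proof.
move=> x0 s01; have /andP[s0 s1] := s01.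
rewrite -lee_fin EFinM -!gammaE_fin//; last by rewrite ltr_wpDr.
have -> : ((x `^ s)%:E * gammaE x =
  (x `^ s * (1 - s))%:E * gammaE x + (x `^ s * (s / x))%:E * gammaE (x + 1))%E.
  rewrite gammaE_recurrence// gammaE_fin// -!EFinM -EFinD; congr EFin.
  by field; rewrite gt_eqF.
have c1 : 0 <= x `^ s * (1 - s) by rewrite mulr_ge0 ?powR_ge0 ?subr_ge0.
have c2 : 0 <= x `^ s * (s / x) by rewrite !mulr_ge0 ?powR_ge0 ?invr_ge0 ?(ltW x0).
rewrite /gammaE -!ge0_integralZl//; last first.
- by move=> t _; rewrite lee_fin gamma_integrand_ge0.
- exact: measurable_giE.
- by move=> t _; rewrite lee_fin gamma_integrand_ge0.
- exact: measurable_giE.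
have mm (D : set R) (c y : R) : measurable_fun D (fun t => c%:E * (gi y t)%:E)%E.
  by apply: emeasurable_funM => //; exact: measurable_giE.
rewrite -ge0_integralD//; last 4 first.
- by move=> t _; apply: mule_ge0; rewrite lee_fin; [exact: c1|exact: gamma_integrand_ge0].
- exact: mm.
- by move=> t _; apply: mule_ge0; rewrite lee_fin; [exact: c2|exact: gamma_integrand_ge0].
- exact: mm.
apply: ge0_le_integral => //.
- by move=> t _; rewrite lee_fin gamma_integrand_ge0.
- exact: measurable_giE.
- by apply: emeasurable_funD; exact: mm.
move=> t; rewrite /= in_itv/= andbT => t0.
rewrite -!EFinM -EFinD lee_fin /gi /gamma_integrand !mulrA -mulrDl.
rewrite ler_wpM2r ?expR_ge0// addrK.
have tx0 : 0 < t / x by rewrite divr_gt0.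
have := powR_bernoulli tx0 s01.
have tE : t `^ (x + s - 1) = t `^ (x - 1) * (x `^ s * (t / x) `^ s).
  rewrite -powRM ?(ltW x0) ?(ltW tx0)// [x * _]mulrC mulfVK ?gt_eqF// -powRD.
    by congr (_ `^ _); ring.
  by rewrite (gt_eqF t0) implybT.
have tE2 : t `^ x = t `^ (x - 1) * t.
  by rewrite -[X in _ * X]powRr1 ?(ltW t0)// -powRD ?subrK// (gt_eqF t0) implybT.
rewrite tE tE2 => h.
have c0 : 0 <= t `^ (x - 1) * x `^ s by rewrite mulr_ge0 ?powR_ge0.
have := ler_wpM2l c0 h.
rewrite [in X in _ -> X]mulrA => /le_trans; apply; rewrite le_eqVlt; apply/orP; left; apply/eqP.
by field; rewrite gt_eqF.
Qed.

(** A zero at x would propagate through [Gamma_addr_le] to the next integer, where the value is a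
    factorial. *)
Lemma Gamma_gt0 x : 0 < x -> 0 < Gamma x.
Proof.
move=> x0; rewrite lt0r Gamma_ge0 andbT; apply/eqP => G0.
set n := Num.truncn x.
have h1 : n%:R <= x by rewrite truncn_le// ltW.
have h2 : x < n.+1%:R := truncnS_gt x.
have s01 : 0 <= n.+1%:R - x <= 1 by rewrite -natr1 in h2 *; lra.
have := Gamma_addr_le x0 s01; rewrite addrC subrK G0 mulr0 Gamma_nat.
by rewrite leNgt ltr0n fact_gt0.
Qed.

End gamma_function.

(** * Binomial coefficients and the Sibuya renewal process *)

Section falling_coefficients.
Context {R : realType}.
Implicit Types (a b : R) (k n m : nat).

(* [bcoef a k] is the coefficient of z^k in (1 - z)^a. *)
Definition bcoef a k : R := \prod_(i < k) ((i%:R - a) / i.+1%:R).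

Lemma bcoef0 a : bcoef a 0 = 1.
Proof. by rewrite /bcoef big_ord0. Qed.

Lemma bcoefS a k : bcoef a k.+1 = bcoef a k * ((k%:R - a) / k.+1%:R).
Proof. by rewrite /bcoef big_ord_recr. Qed.

Lemma bcoefS_mul a k : k.+1%:R * bcoef a k.+1 = (k%:R - a) * bcoef a k.
Proof.
have k0 : k.+1%:R != 0 :> R by rewrite pnatr_eq0.
by rewrite bcoefS mulrCA [_ * bcoef a k]mulrC [_ * (_ / _)]mulrC mulfVK.
Qed.

(** Coefficientwise, this is the derivative of (1 - z)^a. *)
Lemma bcoef_shift a k : bcoef a k.+1 = - a / k.+1%:R * bcoef (a - 1) k.
Proof.
elim: k => [|k IH]; first by rewrite bcoefS !bcoef0 mul1r mulr1 sub0r.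
rewrite bcoefS IH [in RHS]bcoefS.
have k1 : k.+1%:R != 0 :> R by rewrite pnatr_eq0.
have k2 : k.+2%:R != 0 :> R by rewrite pnatr_eq0.
have e : k.+1%:R = k%:R + 1 :> R by rewrite -natr1.
by field; apply/andP; split; [move: k1; rewrite e addrC|move: k2; rewrite -natr1 e -addrA addrC].
Qed.

(** Product of (1 - z)^a and (1 - z)^b. Writing k + 1 as i + (k + 1 - i) lowers one of the two
    factors by [bcoefS_mul], and the resulting coefficients add up to k - (a + b). *)
Lemma bcoef_vandermonde a b k :
  \sum_(i < k.+1) bcoef a i * bcoef b (k - i)%N = bcoef (a + b) k.
Proof.
elim: k => [|k IH]; first by rewrite big_ord1 !bcoef0 mulr1.
have k0 : k.+1%:R != 0 :> R by rewrite pnatr_eq0.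
apply: (mulfI k0); rewrite bcoefS_mul -IH !mulr_sumr.
transitivity (\sum_(i < k.+2) (i%:R * bcoef a i) * bcoef b (k.+1 - i)%N +
              \sum_(i < k.+2) bcoef a i * ((k.+1 - i)%:R * bcoef b (k.+1 - i)%N)).
  rewrite -big_split /=; apply: eq_bigr => i _.
  by rewrite natrB ?leq_ord//; ring.
rewrite big_ord_recl mul0r mul0r add0r.
rewrite [X in _ + X]big_ord_recr /= subnn mul0r mulr0 addr0.
rewrite -big_split /=; apply: eq_bigr => i _.
have ik : (i <= k)%N by rewrite -ltnS.
rewrite /bump leq0n add1n bcoefS_mul subSS subSn// bcoefS_mul natrB//.
by ring.
Qed.

Lemma bcoef_eq0 m k : (m < k)%N -> bcoef m%:R k = 0.
Proof.
move=> mk; rewrite /bcoef (bigD1 (Ordinal mk))//= subrr !mul0r //.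
Qed.

Lemma bcoef_ge0 a k : a <= 0 -> 0 <= bcoef a k.
Proof.
move=> a0; apply: prodr_ge0 => i _; apply: divr_ge0 => //.
by rewrite subr_ge0 (le_trans a0).
Qed.

Lemma bcoef_le0 a k : 0 <= a <= 1 -> bcoef a k.+1 <= 0.
Proof.
move=> /andP[a0 a1]; rewrite bcoef_shift; apply: mulr_le0_ge0.
  by rewrite mulNr oppr_le0 divr_ge0.
by apply: bcoef_ge0; rewrite subr_le0.
Qed.

End falling_coefficients.

(** * Weights of the Sibuya renewal process *)

Section renewal_weights.
Context {R : realType} (kappa : R).
Hypothesis kappa01 : 0 <= kappa <= 1.

(* [renw n k] is the coefficient of z^k in
   (1 - z)^(kappa - 1) * (1 - (1 - z)^kappa)^n: the probability that a Sibuya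
   renewal process has made n jumps by time k. *)
Definition renw (n k : nat) : R :=
  \sum_(j < n.+1) 'C(n, j)%:R * (-1) ^+ j * bcoef (kappa * j.+1%:R - 1) k.

Lemma renw0 k : renw 0 k = bcoef (kappa - 1) k.
Proof. by rewrite /renw big_ord1 bin0 expr0 mulr1 !mul1r mulr1. Qed.

(** Since (1 - z)^kappa is 1 minus the Sibuya generating function, multiplying by it produces the
    difference of two consecutive powers. On coefficients this is Vandermonde followed by Pascal's
    rule. *)
Lemma renw_conv n k :
  \sum_(i < k.+1) bcoef kappa i * renw n (k - i)%N = renw n k - renw n.+1 k.
Proof.
transitivity (\sum_(j < n.+1) 'C(n, j)%:R * (-1) ^+ j *
    bcoef (kappa * j.+2%:R - 1) k).
  under eq_bigr do rewrite /renw mulr_sumr.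
  rewrite exchange_big /=; apply: eq_bigr => j _.
  transitivity ('C(n, j)%:R * (-1) ^+ j * \sum_(i < k.+1) bcoef kappa i *
      bcoef (kappa * j.+1%:R - 1) (k - i)%N).
    by rewrite mulr_sumr; apply: eq_bigr => i _; rewrite mulrCA.
  rewrite bcoef_vandermonde; congr (_ * bcoef _ _).
  by rewrite -[in RHS]natr1; ring.
rewrite /renw [X in _ - X]big_ord_recl bin0 expr0 !mul1r.
under [X in _ - (_ + X)]eq_bigr do
  rewrite lift0 binS natrD mulrDl mulrDl.
rewrite big_split /= [X in _ - (_ + (X + _))]big_ord_recr /= bin_small//.
rewrite !mul0r addr0 [X in X - _]big_ord_recl bin0 expr0 !mul1r.
rewrite opprD addrACA subrr add0r opprD addNKr -sumrN.
by apply: eq_bigr => j _; rewrite exprS; ring.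
Qed.

(** Renewal equation at the first jump, whose law has the weights [- bcoef kappa i.+1]. These are
    nonnegative, so this form shows the sign that the alternating sum in [renw] conceals. *)
Lemma renw_rec n k :
  renw n.+1 k = \sum_(i < k) - bcoef kappa i.+1 * renw n (k - i.+1)%N.
Proof.
have := renw_conv n k; rewrite big_ord_recl bcoef0 mul1r subn0 => /addrI e.
under eq_bigr do rewrite mulNr.
by rewrite sumrN -[LHS]opprK -e.
Qed.

Lemma renw_ge0 n k : 0 <= renw n k.
Proof.
case/andP: (kappa01) => k0 k1.
elim: n k => [|n IH] k; first by rewrite renw0 bcoef_ge0// subr_le0.
rewrite renw_rec sumr_ge0// => i _.
by rewrite mulr_ge0// oppr_ge0 bcoef_le0.
Qed.

Lemma renw_eq0 n k : (k < n)%N -> renw n k = 0.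
Proof.
elim: n k => [//|n IH] k kn.
rewrite renw_rec big1// => i _; rewrite IH ?mulr0//.
have ik := ltn_ord i.
by rewrite ltn_subLR// (leq_trans kn)// addSn ltnS leq_addl.
Qed.

(** The leading coefficient [bcoef a 0] is 1, so the convolution is inverted term by term. *)
Lemma bcoef_conv_inj (u v : nat -> R) a :
  (forall k, \sum_(i < k.+1) bcoef a i * u (k - i)%N =
             \sum_(i < k.+1) bcoef a i * v (k - i)%N) -> u =1 v.
Proof.
move=> uv k; elim/ltn_ind: k => k IH.
have := uv k; rewrite !big_ord_recl bcoef0 !mul1r subn0.
rewrite (eq_bigr (fun i : 'I_k => bcoef a (lift ord0 i) * v (k - lift ord0 i)%N)).
  by move/addIr.
by move=> i _; rewrite IH// lift0 ltn_subrL/= (leq_trans _ (ltn_ord i)).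
Qed.

(** The sum of C(n + m, m) w^n is (1 - w)^(- m - 1); at w = 1 - (1 - z)^kappa, times (1 - z)^(kappa
    - 1), it becomes (1 - z)^(- kappa m - 1). The induction on m multiplies both sides by (1 -
    z)^kappa, which lowers m by summation by parts. Any K > k will do because the weights vanish for
    n > k. *)
Lemma renw_rising_moment m k K : (k < K)%N ->
  \sum_(n < K) 'C(n + m, m)%:R * renw n k = bcoef (- (kappa * m%:R) - 1) k.
Proof.
pose A m k := \sum_(n < k.+1) 'C(n + m, m)%:R * renw n k.
have AK m' k' K' : (k' < K')%N ->
    \sum_(n < K') 'C(n + m', m')%:R * renw n k' = A m' k'.
  move=> kK; rewrite /A.
  rewrite [RHS](big_ord_widen K' (fun n => 'C(n + m', m')%:R * renw n k'))//.
  rewrite [LHS](bigID (fun n : 'I_K' => (n < k'.+1)%N)) /= [X in _ + X]big1 ?addr0//.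
  by move=> i; rewrite -leqNgt => ki; rewrite renw_eq0// mulr0.
have Aconv m' k' : \sum_(i < k'.+1) bcoef kappa i * A m' (k' - i)%N =
    \sum_(n < k'.+1) 'C(n + m', m')%:R * (renw n k' - renw n.+1 k').
  under eq_bigr => i _ do rewrite -(@AK m' (k' - i)%N k'.+1) ?ltnS ?leq_subr// mulr_sumr.
  rewrite exchange_big /=; apply: eq_bigr => n _.
  by rewrite -renw_conv mulr_sumr; apply: eq_bigr => i _; rewrite mulrCA.
move=> kK; rewrite AK// {K kK}; elim: m => [|m IH] in k *.
  apply: (@bcoef_conv_inj _ _ kappa) => {}k.
  rewrite Aconv bcoef_vandermonde mulr0 oppr0 add0r.
  under eq_bigr do rewrite addn0 bin0 mul1r.
  have := telescope_sumr (fun n => renw n k) (leq0n k.+1).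
  rewrite big_mkord => e.
  under eq_bigr do rewrite -opprB.
  by rewrite sumrN e opprB (@renw_eq0 k.+1)// subr0 renw0.
apply: (@bcoef_conv_inj _ _ kappa) => {}k.
rewrite Aconv bcoef_vandermonde.
have -> : kappa + (- (kappa * m.+1%:R) - 1) = - (kappa * m%:R) - 1.
  by rewrite -natr1; ring.
rewrite -(IH k) /A.
under eq_bigr do rewrite mulrBr.
rewrite sumrB.
rewrite [X in X - _]big_ord_recl [X in _ - X]big_ord_recr [RHS]big_ord_recl /=.
rewrite (@renw_eq0 k.+1)// mulr0 addr0 -addrA -sumrB; congr (_ + _).
  by rewrite !add0n !binn.
apply: eq_bigr => i _; rewrite /bump leq0n add1n -mulrBl; congr (_ * _).
by rewrite [in LHS]addSn binS natrD addSnnS addrC addKr.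
Qed.

End renewal_weights.

(** * Euler's reflection formula *)

Section trigonometric_bounds.
Context {R : realType}.
Implicit Types x t : R.

Lemma is_derive_ge0_le (f df : R -> R) (b : R) :
  (forall x, 0 <= x <= b -> is_derive x 1 f (df x)) ->
  (forall x, 0 <= x <= b -> 0 <= df x) -> 0 <= b -> f 0 <= f b.
Proof.
move=> fdf df0 b0; rewrite -subr_ge0.
have [||c] := @MVT_segment _ f df 0 b b0.
- by move=> x; rewrite in_itv/= => /andP[x0 xb]; apply: fdf; rewrite !ltW.
- apply/subspace_continuousP => x /=; rewrite in_itv/= => xb.
  apply: cvg_within_filter; apply/differentiable_continuous/derivable1_diffP.
  by have h := fdf _ xb; exact: ex_derive.
- rewrite in_itv/= => cb ->.
  by rewrite subr0 mulr_ge0// df0.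
Qed.

Lemma sin_le x : 0 <= x -> sin x <= x.
Proof.
move=> x0; have := @is_derive_ge0_le (fun y => y - sin y) (fun y => 1 - cos y) x.
rewrite sin0 subrr subr_ge0; exact.
Qed.

Lemma cos_ge x : 1 - x ^+ 2 / 2 <= cos x.
Proof.
wlog x0 : x / 0 <= x.
  move=> h; have [x0|x0] := leP 0 x; first exact: h.
  by rewrite -cosN -sqrrN; apply: h; rewrite oppr_ge0 ltW.
have := @is_derive_ge0_le (fun y => cos y - (1 - y ^+ 2 / 2)) (fun y => y - sin y) x.
rewrite cos0 expr0n/= mul0r subr0 subrr subr_ge0; apply => //.
- by move=> y _; apply: is_derive_eq; rewrite /GRing.scale/=; field.
- by move=> y /andP[y0 _]; rewrite subr_ge0 sin_le.
Qed.

Lemma sin_ge x : 0 <= x -> x - x ^+ 3 / 6 <= sin x.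
Proof.
move=> x0.
have := @is_derive_ge0_le (fun y => sin y - (y - y ^+ 3 / 6))
  (fun y => cos y - (1 - y ^+ 2 / 2)) x.
rewrite sin0 expr0n/= mul0r subr0 subrr subr_ge0; apply => //.
- by move=> y _; apply: is_derive_eq; rewrite /GRing.scale/=; field.
- by move=> y _; rewrite subr_ge0 cos_ge.
Qed.

Lemma sin_sub_le x : `|sin x - x| <= `|x| ^+ 3 / 6.
Proof.
wlog x0 : x / 0 <= x.
  move=> h; have [x0|x0] := leP 0 x; first exact: h.
  have : 0 <= - x by rewrite oppr_ge0 ltW.
  by move=> /h; rewrite sinN -opprD !normrN.
rewrite ler0_norm ?subr_le0 ?sin_le// (ger0_norm x0) opprB.
by have := sin_ge x0; lra.
Qed.

(** This is t <= tan t; it trades t^2 for sin^2 t in [cosI_ratio_le]. *)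
Lemma mulr_cos_le_sin t : 0 <= t <= pi / 2 -> t * cos t <= sin t.
Proof.
move=> /andP[t0 tpi].
have := @is_derive_ge0_le (fun y => sin y - y * cos y) (fun y => y * sin y) t.
rewrite sin0 mul0r subr0 subr_ge0; apply => // y.
- move=> _; apply: is_derive_eq; rewrite /GRing.scale/=; ring.
- move=> /andP[y0 yt]; rewrite mulr_ge0// sin_ge0_pi// y0/=.
  by rewrite (le_trans yt)// (le_trans tpi)// ler_pdivrMr// ler_peMr ?pi_ge0// ler1n.
Qed.

End trigonometric_bounds.

Section sine_product.
Context {R : realType}.
Local Notation mu := (@lebesgue_measure R).
Implicit Types a b t : R.

(** Wallis integrals with a frequency. The recurrence in n contributes the factors 1 - (a / n)^2 of
    the sine product, while the ratio to the value at a = 0 tends to 1. *)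
Local Definition cosI (n : nat) a : R :=
  \int[mu]_(t in `[0, pi / 2]) (cos t ^+ n * cos (a * t)).

Let pi2_gt0 : 0 < pi / 2 :> R.
Proof. by rewrite divr_gt0 ?pi_gt0. Qed.

Let kc n a := (fun t : R => cos t ^+ n * cos (a * t)).

Let is_derive_cosM a t : is_derive t 1 (fun t : R => cos (a * t)) (- a * sin (a * t)).
Proof.
have h1 : is_derive (a * t) 1 (@cos R) (- sin (a * t)) by exact: is_derive_cos.
have h2 : is_derive t 1 (fun t : R => a * t) a.
  by apply: is_derive_eq; rewrite /GRing.scale/= mulr1.
have h := @is_derive1_comp _ _ _ _ _ _ h1 h2.
by apply: is_derive_eq; ring.
Qed.

Let is_derive_sinM a t : is_derive t 1 (fun t : R => sin (a * t)) (a * cos (a * t)).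
Proof.
have h1 : is_derive (a * t) 1 (@sin R) (cos (a * t)) by exact: is_derive_sin.
have h2 : is_derive t 1 (fun t : R => a * t) a.
  by apply: is_derive_eq; rewrite /GRing.scale/= mulr1.
have h := @is_derive1_comp _ _ _ _ _ _ h1 h2.
by apply: is_derive_eq; ring.
Qed.

Let is_derive_cosX n t :
  is_derive t 1 (fun t : R => cos t ^+ n) (- n%:R * cos t ^+ n.-1 * sin t).
Proof.
have h := is_deriveX n (is_derive_cos t).
rewrite exprfctE in h.
by apply: (is_derive_eq h); rewrite /GRing.scale/=; ring.
Qed.

Let continuous_kc n a : continuous (kc n a).
Proof.
move=> t; apply/differentiable_continuous/derivable1_diffP.
have h1 := is_derive_cosX n t; have h2 := is_derive_cosM a t.
by have h := @is_deriveM _ _ _ _ _ _ _ _ h1 h2; exact: ex_derive.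
Qed.

Let integrable_cont (f : R -> R) : continuous f ->
  mu.-integrable `[0, pi / 2] (EFin \o f).
Proof.
move=> cf; apply: continuous_compact_integrable; first exact: segment_compact.
exact: continuous_subspaceT.
Qed.

Let integrable_kc n a : mu.-integrable `[0, pi / 2] (EFin \o kc n a).
Proof. by apply: integrable_cont; exact: continuous_kc. Qed.

(* With y = cos^(n+2), the function y' cos(a t) + a y sin(a t) vanishes at both
   endpoints. *)
Lemma cosI_recurrence n a :
  n.+2%:R * n.+1%:R * cosI n a = (n.+2%:R ^+ 2 - a ^+ 2) * cosI n.+2 a.
Proof.
set c1 := n.+2%:R * n.+1%:R; set c2 := n.+2%:R ^+ 2 - a ^+ 2.
have := @ftc_itv _ (fun t => c1 * kc n a t - c2 * kc n.+2 a t)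
  (fun t => - n.+2%:R * cos t ^+ n.+1 * sin t * cos (a * t) +
            a * (cos t ^+ n.+2 * sin (a * t))) 0 (pi / 2) pi2_gt0.
move=> /(_ _ _)/wrap[].
- move=> t _.
  have h1 := is_derive_cosX n.+1 t; have h2 := is_derive_cosX n.+2 t.
  have h3 := is_derive_cosM a t; have h4 := is_derive_sinM a t.
  apply: is_derive_eq.
  rewrite /GRing.scale/= /c1 /c2 /kc.
  apply/eqP; rewrite -subr_eq0; apply/eqP.
  transitivity (n.+2%:R * n.+1%:R * (cos t ^+ n * cos (a * t)) *
    (sin t ^+ 2 - (1 - cos t ^+ 2))); last by rewrite sin2cos2 subrr mulr0.
  by rewrite !exprS expr0; ring.
- move=> t _; by apply: cvgB; apply: cvgM;
    [exact: cvg_cst|exact: continuous_kc|exact: cvg_cst|exact: continuous_kc].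
rewrite cos_pihalf (mulr0 a) sin0 ![0 ^+ _]expr0n/= !(mul0r, mulr0, addr0) subrr.
move=> /(congr1 fine) /=.
rewrite -[fine _]/(Rintegral _ _ _) RintegralB//=; last 2 first.
- by apply: integrable_cont => t; apply: cvgM; [exact: cvg_cst|exact: continuous_kc].
- by apply: integrable_cont => t; apply: cvgM; [exact: cvg_cst|exact: continuous_kc].
rewrite (RintegralZl c1 _ (integrable_kc n a))//.
rewrite (RintegralZl c2 _ (integrable_kc n.+2 a))//.
by move=> /eqP; rewrite subr_eq0 => /eqP.
Qed.

Lemma cosI0 a : a != 0 -> cosI 0 a = sin (a * (pi / 2)) / a.
Proof.
move=> a0.
have := @ftc_itv _ (fun t => kc 0 a t) (fun t => a^-1 * sin (a * t)) 0 (pi / 2) pi2_gt0.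
move=> /(_ _ _)/wrap[].
- move=> t _; have h := is_deriveZ a^-1 (is_derive_sinM a t).
  by apply: (is_derive_eq h); rewrite /GRing.scale/= /kc expr0 mul1r mulKf.
- by move=> t _; exact: continuous_kc.
move=> /(congr1 fine)/=; rewrite -[fine _]/(Rintegral _ _ _) mulr0 sin0 mulr0 subr0.
by rewrite [in X in _ -> X]mulrC.
Qed.

Lemma cosI00 : cosI 0 0 = pi / 2.
Proof.
have := @ftc_itv _ (fun t => kc 0 0 t) (fun t => t) 0 (pi / 2) pi2_gt0.
move=> /(_ _ _)/wrap[].
- move=> t _; rewrite /kc expr0 mul0r cos0 mulr1; exact: is_derive_id.
- by move=> t _; exact: continuous_kc.
by move=> /(congr1 fine)/=; rewrite -[fine _]/(Rintegral _ _ _) subr0.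
Qed.

Lemma cosI_even_gt0 m : 0 < cosI m.*2 0.
Proof.
elim: m => [|m IH]; first by rewrite cosI00.
have := cosI_recurrence m.*2 0; rewrite expr0n/= subr0 => h.
rewrite -(pmulr_rgt0 _ (_ : 0 < m.*2.+2%:R ^+ 2)) ?exprn_gt0// -h.
by rewrite pmulr_rgt0// mulr_gt0.
Qed.

(** The bounds 1 - cos(a t) <= a^2 t^2 / 2 and t cos t <= sin t reduce the difference to a^2 / 2
    times the integral of cos^n sin^2 with n = 2 m. That integral is [cosI n 0 - cosI n.+2 0], which
    the recurrence evaluates as [cosI n.+2 0] over n + 1. *)
Lemma cosI_ratio_le m a :
  `|cosI m.+1.*2 a / cosI m.+1.*2 0 - 1| <= a ^+ 2 / 2 / m.*2.+1%:R.
Proof.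
set n := m.*2; rewrite doubleS -/n.
have I0 : 0 < cosI n.+2 0 by have := cosI_even_gt0 m.+1; rewrite doubleS.
have c2 : 0 <= a ^+ 2 / 2 by rewrite divr_ge0 ?sqr_ge0.
have -> : cosI n.+2 a / cosI n.+2 0 - 1 = (cosI n.+2 a - cosI n.+2 0) / cosI n.+2 0.
  by field; rewrite gt_eqF.
rewrite normrM (gtr0_norm (_ : 0 < (cosI n.+2 0)^-1)) ?invr_gt0// ler_pdivrMr//.
have key : cosI n 0 - cosI n.+2 0 = cosI n.+2 0 / n.+1%:R.
  have := cosI_recurrence n 0; rewrite expr0n/= subr0 => h.
  have n1 : n.+1%:R != 0 :> R by rewrite pnatr_eq0.
  have n2 : n.+2%:R != 0 :> R by rewrite pnatr_eq0.
  apply: (mulfI n2); apply: (mulfI n1).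
  rewrite !mulrBr mulrA [n.+1%:R * _]mulrC h expr2.
  have -> : n.+2%:R = n.+1%:R + 1 :> R by rewrite natr1.
  by field; rewrite addrC natr1 pnatr_eq0.
rewrite mulrAC -mulrA -key.
have -> : cosI n 0 - cosI n.+2 0 = \int[mu]_(t in `[0, pi / 2]) (kc n 0 t - kc n.+2 0 t).
  by rewrite (RintegralB _ (integrable_kc n 0) (integrable_kc n.+2 0)).
have icB : mu.-integrable `[0, pi / 2] (EFin \o (fun t => kc n 0 t - kc n.+2 0 t)).
  by apply: integrable_cont => t; apply: cvgB; exact: continuous_kc.
have icA : mu.-integrable `[0, pi / 2] (EFin \o (fun t => kc n.+2 a t - kc n.+2 0 t)).
  by apply: integrable_cont => t; apply: cvgB; exact: continuous_kc.
rewrite -(RintegralZl _ _ icB)//.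
have -> : cosI n.+2 a - cosI n.+2 0 = \int[mu]_(t in `[0, pi / 2]) (kc n.+2 a t - kc n.+2 0 t).
  by rewrite (RintegralB _ (integrable_kc n.+2 a) (integrable_kc n.+2 0)).
apply: (le_trans (le_normr_Rintegral _ icA)) => //.
apply: le_Rintegral => //.
- exact: (integrable_norm icA).
- apply: integrable_cont => t; apply: cvgM; first exact: cvg_cst.
  by apply: cvgB; exact: continuous_kc.
move=> t; rewrite /= in_itv/= => tpi; have /andP[t0 _] := tpi.
rewrite /kc mul0r cos0 !mulr1 -[X in `|_ - X|]mulr1 -mulrBr normrM.
have ct0 : 0 <= cos t.
  apply: cos_ge0_pihalf; case/andP: tpi => _ ->; rewrite andbT.
  by rewrite (le_trans _ t0)// oppr_le0 ltW.
have tpi' : t <= pi.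
  case/andP: tpi => _ /le_trans; apply.
  by rewrite ler_pdivrMr// ler_peMr ?pi_ge0// ler1n.
rewrite ger0_norm ?exprn_ge0//.
have h1 : `|cos (a * t) - 1| <= a ^+ 2 / 2 * t ^+ 2.
  rewrite ler0_norm ?subr_le0 ?cos_le1// opprB.
  by have := cos_ge (a * t); rewrite exprMn; lra.
have h2 : (t * cos t) ^+ 2 <= sin t ^+ 2.
  by rewrite lerXn2r ?nnegrE ?mulr_ge0 ?sin_ge0_pi ?mulr_cos_le_sin// t0.
apply: (le_trans (ler_wpM2l (exprn_ge0 _ ct0) h1)).
rewrite mulrCA ler_wpM2l//.
have -> : cos t ^+ n - cos t ^+ n.+2 = cos t ^+ n * sin t ^+ 2.
  by rewrite sin2cos2 !exprS; ring.
rewrite (_ : cos t ^+ n.+2 * t ^+ 2 = cos t ^+ n * (t * cos t) ^+ 2).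
  by rewrite ler_wpM2l ?exprn_ge0.
by rewrite !exprS; ring.
Qed.

Lemma cosI_ratio_cvg a : (cosI m.*2 a / cosI m.*2 0) @[m --> \oo] --> (1 : R).
Proof.
rewrite -cvg_shiftS /=.
apply/cvgrPdistC_le => /= e e0.
near=> m.
apply: (le_trans (cosI_ratio_le m a)).
rewrite ler_pdivrMr// -ler_pdivrMl//.
rewrite (@le_trans _ _ m%:R)//; last by rewrite ler_nat -addnn -addSn leq_addl.
by near: m; exact: nbhs_infty_ger.
Unshelve. all: end_near. Qed.

(* Euler's product for the sine. *)
Lemma sine_product b : 0 < b < 1 ->
  (b * \prod_(l < m) (1 - b ^+ 2 / l.+1%:R ^+ 2)) @[m --> \oo] --> sin (pi * b) / pi.
Proof.
move=> /andP[b0 b1].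
have b20 : 2 * b != 0 by rewrite mulf_neq0// gt_eqF.
have bn0 : b != 0 by rewrite gt_eqF.
have pin0 : pi != 0 :> R by rewrite gt_eqF ?pi_gt0.
(* The recurrence makes this product independent of m, and its value at m = 0 is explicit. The
   frequency 2 b against the even exponents 2 l gives the factors 1 - b^2 / l^2. *)
have E m : cosI m.*2 (2 * b) / cosI m.*2 0 * (b * \prod_(l < m) (1 - b ^+ 2 / l.+1%:R ^+ 2))
   = sin (pi * b) / pi.
  elim: m => [|m IH].
    rewrite big_ord0 mulr1 cosI00 cosI0//.
    have -> : 2 * b * (pi / 2) = pi * b by move: pi => p; field.
    by move: (sin _) pin0 => v; move: pi => p pn0; field; rewrite pn0 bn0.
  rewrite -IH doubleS.
  have h1 := cosI_recurrence m.*2 (2 * b).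
  have h0 := cosI_recurrence m.*2 0; rewrite expr0n/= subr0 in h0.
  have p1 := cosI_even_gt0 m; have p2 := cosI_even_gt0 m.+1; rewrite doubleS in p2.
  have c0 : m.*2.+2%:R * m.*2.+1%:R != 0 :> R by rewrite mulf_neq0 ?pnatr_eq0.
  have e2 : m.*2.+2%:R = 2 * m.+1%:R :> R by rewrite -doubleS -muln2 natrM mulrC.
  have m0 : m.+1%:R != 0 :> R by rewrite pnatr_eq0.
  rewrite e2 in h1 h0; rewrite e2 in c0.
  have -> : \prod_(i < m.+1) (1 - b ^+ 2 / i.+1%:R ^+ 2) =
     \prod_(i < m) (1 - b ^+ 2 / i.+1%:R ^+ 2) * (1 - b ^+ 2 / m.+1%:R ^+ 2).
    by rewrite big_ord_recr.
  move: (\prod_(i < m) _) => PP.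
  move: (2 * m.+1%:R * m.*2.+1%:R) c0 h1 h0 => C c0 h1 h0.
  move: (m.+1%:R) m0 h1 h0 => M m0 h1 h0.
  move: (cosI m.*2.+2 0) p2 h0 => X0 p2 h0.
  move: (cosI m.*2.+2 (2 * b)) h1 => Xb h1.
  move: (cosI m.*2 0) p1 h0 => Y0 p1 h0.
  move: (cosI m.*2 (2 * b)) h1 => Yb h1.
  have -> : Yb = ((2 * M) ^+ 2 - (2 * b) ^+ 2) / C * Xb.
    by apply: (mulfI c0); rewrite h1; field.
  have -> : Y0 = (2 * M) ^+ 2 / C * X0 by apply: (mulfI c0); rewrite h0; field.
  by field; rewrite m0 c0 gt_eqF.
have rn0 m : cosI m.*2 (2 * b) / cosI m.*2 0 != 0.
  have := E m; apply: contra_eq_neq => ->; rewrite mul0r eq_sym.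
  by rewrite mulf_neq0 ?invr_eq0 ?gt_eqF ?pi_gt0// sin_gt0_pi// mulr_gt0 ?pi_gt0//= gtr_pMr ?pi_gt0.
have -> : (fun m => b * \prod_(l < m) (1 - b ^+ 2 / l.+1%:R ^+ 2)) =
   (fun m => sin (pi * b) / pi * (cosI m.*2 (2 * b) / cosI m.*2 0)^-1).
  by apply/funext => m; rewrite -(E m) mulrAC mulfV// mul1r.
have h : (cosI m.*2 (2 * b) / cosI m.*2 0)^-1 @[m --> \oo] --> (1 : R).
  by rewrite -[X in _ --> X]invr1; apply: cvgV; [exact: oner_neq0|exact: cosI_ratio_cvg].
by rewrite -[X in _ --> X]mulr1; apply: cvgM => //; exact: cvg_cst.
Qed.

End sine_product.

Section reflection.
Context {R : realType}.
Implicit Types (b : R) (k : nat).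

Lemma bcoefN_Gamma b k : 0 < b -> bcoef (- b) k = Gamma (k%:R + b) / (Gamma b * k`!%:R).
Proof.
move=> b0; have G0 := Gamma_gt0 b0.
elim: k => [|k IH].
  by rewrite bcoef0 add0r mulr1 mulfV// gt_eqF.
have kb : 0 < k%:R + b by rewrite ltr_wpDl.
rewrite bcoefS IH opprK -natr1 addrAC Gamma_recurrence// factS natrM natr1.
have k1 : k.+1%:R != 0 :> R by rewrite pnatr_eq0.
have kf : k`!%:R != 0 :> R by rewrite pnatr_eq0 -lt0n fact_gt0.
move: (Gamma (k%:R + b)) (k`!%:R) kf (k.+1%:R) k1 => g f f0 c c0.
by field; rewrite f0 c0 gt_eqF.
Qed.

Lemma bcoefN_le b k : 0 < b <= 1 -> (0 < k)%N ->
  bcoef (- b) k <= k%:R `^ (b - 1) / Gamma b.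
Proof.
move=> /andP[b0 b1] k0; rewrite bcoefN_Gamma// invfM mulrA ler_pdivrMr ?ltr0n ?fact_gt0//.
rewrite mulrAC ler_wpM2r ?invr_ge0 ?Gamma_ge0//.
have kR : 0 < k%:R :> R by rewrite ltr0n.
have b01 : 0 <= b <= 1 by rewrite (ltW b0).
apply: (le_trans (Gamma_addr_le kR b01)).
case: k k0 kR => // k _ kR; rewrite Gamma_nat factS natrM mulrA ler_wpM2r//.
rewrite -[X in _ <= _ * X]powRr1// -powRD ?subrK//.
by rewrite (gt_eqF kR) implybT.
Qed.

(** Gauss's limit for 1 / Gamma. For b in (0, 1], Wendel's inequality from k to k + b and from k + b
    to k + 1 squeezes the product; larger b are lowered by the recurrence. *)
Lemma bcoefN_cvg b : 0 < b ->
  (bcoef (- b) k * k%:R `^ (1 - b)) @[k --> \oo] --> (Gamma b)^-1.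
Proof.
have base (c : R) : 0 < c <= 1 ->
    (bcoef (- c) k * k%:R `^ (1 - c)) @[k --> \oo] --> (Gamma c)^-1.
  move=> c01; have /andP[c0 c1] := c01.
  have G0 := Gamma_gt0 c0.
  apply: (@squeeze_cvgr _ _ _ _ (fun k : nat => (Gamma c)^-1 * (k%:R / (k%:R + c)))
     (fun=> (Gamma c)^-1)); last exact: cvg_cst.
    near=> k.
    have k0 : (0 < k)%N by near: k; exact: nbhs_infty_gt.
    have kR : 0 < k%:R :> R by rewrite ltr0n.
    have kc : 0 < k%:R + c by rewrite addr_gt0.
    have pp : k%:R `^ (c - 1) * k%:R `^ (1 - c) = 1.
      rewrite -powRD ?(gt_eqF kR) ?implybT//.
      by rewrite -opprB addNr powRr0.
    apply/andP; split; last first.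
      have := bcoefN_le c01 k0.
      move=> /(ler_wpM2r (powR_ge0 k%:R (1 - c)))/le_trans; apply.
      by rewrite mulrAC pp mul1r.
    have s01 : 0 <= 1 - c <= 1 by lra.
    have := Gamma_addr_le kc s01.
    rewrite -addrA [c + _]addrC subrK natr1 Gamma_nat => h.
    rewrite bcoefN_Gamma// invfM.
    have f0 : 0 < k`!%:R :> R by rewrite ltr0n fact_gt0.
    have {h} h : k`!%:R * (k%:R + c) `^ (c - 1) <= Gamma (k%:R + c).
      have q0 : 0 < (k%:R + c) `^ (1 - c) by rewrite powR_gt0.
      rewrite -(ler_pM2l q0); apply: le_trans h.
      rewrite mulrCA -powRD ?(gt_eqF kc) ?implybT//.
      by rewrite -(opprB c 1) addNr powRr0 mulr1.
    apply: (@le_trans _ _ (k`!%:R * (k%:R + c) `^ (c - 1) * ((Gamma c)^-1 / k`!%:R) * k%:R `^ (1 - c))).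
      have -> : k`!%:R * (k%:R + c) `^ (c - 1) * ((Gamma c)^-1 / k`!%:R) * k%:R `^ (1 - c)
        = (Gamma c)^-1 * ((k%:R + c) `^ (c - 1) * k%:R `^ (1 - c)).
        move: ((_ + c) `^ _) (_ `^ (1 - c)) (k`!%:R) f0 => u v w w0.
        by field; rewrite (gt_eqF G0) (gt_eqF w0).
      rewrite ler_wpM2l ?invr_ge0 ?(ltW G0)//.
      have -> : (k%:R + c) `^ (c - 1) * k%:R `^ (1 - c) = (k%:R / (k%:R + c)) `^ (1 - c).
        by rewrite powRM ?invr_ge0 ?(ltW kc)// mulrC -(opprB c 1) -powR_inv1 ?(ltW kc)// -powRrM mulN1r opprK.
      apply: ger1_powR; last by lra.
      rewrite divr_gt0//= ler_pdivrMr// mul1r lerDl ltW//.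
    rewrite ler_wpM2r ?powR_ge0// ler_wpM2r// mulr_ge0// invr_ge0 ltW//.
  rewrite -[X in _ --> X]mulr1; apply: cvgMr.
  apply/cvgrPdistC_le => /= e e0; near=> k.
  have kc : 0 < k%:R + c by rewrite ltr_wpDl.
  have -> : k%:R / (k%:R + c) - 1 = - (c / (k%:R + c)) by field; rewrite gt_eqF.
  rewrite normrN gtr0_norm ?divr_gt0// ler_pdivrMr// -ler_pdivrMl//.
  apply: (@le_trans _ _ k%:R); last by rewrite lerDl ltW.
  by near: k; exact: nbhs_infty_ger.
have ind n (c : R) : 0 < c <= n.+1%:R ->
    (bcoef (- c) k * k%:R `^ (1 - c)) @[k --> \oo] --> (Gamma c)^-1.
  elim: n c => [|n IH] c /andP[c0 cn]; first by apply: base; rewrite c0.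
  have [c1|c1] := leP c 1; first by apply: base; rewrite c0.
  have cc0 : 0 < c - 1 by rewrite subr_gt0.
  have {}IH := IH (c - 1) _.
  have h : (bcoef (- (c - 1)) k * k%:R `^ (1 - (c - 1))) @[k --> \oo] --> (Gamma (c - 1))^-1.
    by apply: IH; rewrite cc0/= lerBlDr natr1.
  have -> : (Gamma c)^-1 = (Gamma (c - 1))^-1 * ((c - 1)^-1 * (1 + 0)).
    by rewrite -{1}(subrK 1 c) Gamma_recurrence// addr0 mulr1 invfM mulrC.
  have E k : (0 < k)%N -> bcoef (- c) k * k%:R `^ (1 - c) =
     (bcoef (- (c - 1)) k * k%:R `^ (1 - (c - 1))) * ((c - 1)^-1 * (1 + (c - 1) / k%:R)).
    move=> k0; have kR : 0 < k%:R :> R by rewrite ltr0n.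
    have -> : k%:R `^ (1 - (c - 1)) = k%:R `^ (1 - c) * k%:R.
      rewrite -[X in _ * X]powRr1 ?(ltW kR)// -powRD ?(gt_eqF kR) ?implybT//.
      by congr (_ `^ _); ring.
    rewrite !bcoefN_Gamma//.
    have -> : k%:R + c = k%:R + (c - 1) + 1 by ring.
    rewrite Gamma_recurrence ?(addr_gt0 kR cc0)//.
    have -> : Gamma c = (c - 1) * Gamma (c - 1) by have := Gamma_recurrence cc0; rewrite subrK.
    have f0 : k`!%:R != 0 :> R by rewrite pnatr_eq0 -lt0n fact_gt0.
    have g0 := Gamma_gt0 cc0.
    move: (Gamma (k%:R + (c - 1))) (k%:R `^ (1 - c)) (k`!%:R) f0 (Gamma (c - 1)) g0 => u v w w0 g g0.
    move: (k%:R) kR => K K0.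
    by field; rewrite w0 !gt_eqF.
  apply: (@cvg_trans _ ((bcoef (- (c - 1)) k * k%:R `^ (1 - (c - 1))) *
       ((c - 1)^-1 * (1 + (c - 1) / k%:R)) @[k --> \oo])).
    apply: near_eq_cvg; near=> k; rewrite E//.
    by near: k; exact: nbhs_infty_gt.
  apply: cvgM => //; apply: cvgMr; apply: cvgD; first exact: cvg_cst.
  rewrite -[X in _ --> X](mulr0 (c - 1)); apply: cvgMr.
  apply/gtr0_cvgV0; last exact: cvgr_idn.
  by near=> k; rewrite ltr0n; near: k; exact: nbhs_infty_gt.
move=> b0; apply: (ind (Num.truncn b)); rewrite b0/=.
by apply: ltW; exact: truncnS_gt.
Unshelve. all: end_near. Qed.

(** Multiply the limits of [bcoefN_cvg] at b and 1 - b: up to the factor k + b, the product of the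
    two coefficients is exactly the k-th partial product for the sine. *)
Lemma Gamma_reflection b : 0 < b < 1 ->
  (Gamma b)^-1 = sin (pi * b) * Gamma (1 - b) / pi.
Proof.
move=> b01; have /andP[b0 b1] := b01.
have c0 : 0 < 1 - b by rewrite subr_gt0.
have h1 := bcoefN_cvg b0.
have h2 := bcoefN_cvg c0.
have h3 := sine_product b01.
have E k : bcoef (- b) k * bcoef (- (1 - b)) k * (k%:R + b) =
    b * \prod_(l < k) (1 - b ^+ 2 / l.+1%:R ^+ 2).
  elim: k => [|k IH]; first by rewrite !bcoef0 big_ord0 add0r mulr1 !mul1r mulr1.
  rewrite big_ord_recr/= mulrA -IH !bcoefS -natr1.
  have k1 : k%:R + 1 != 0 :> R by rewrite natr1 pnatr_eq0.
  move: (bcoef _ _) (bcoef _ _) => u v.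
  move: (k%:R) k1 => K K0.
  by field.
have h4 : (bcoef (- b) k * k%:R `^ (1 - b)) * (bcoef (- (1 - b)) k * k%:R `^ (1 - (1 - b)))
    @[k --> \oo] --> sin (pi * b) / pi * 1.
  apply: (@cvg_trans _ ((b * \prod_(l < k) (1 - b ^+ 2 / l.+1%:R ^+ 2)) * (k%:R / (k%:R + b)) @[k --> \oo])).
    apply: near_eq_cvg; near=> k.
    have k0 : 0 < k%:R :> R by rewrite ltr0n; near: k; exact: nbhs_infty_gt.
    rewrite -E [in RHS]mulrACA -powRD ?(gt_eqF k0) ?implybT//.
    have -> : 1 - b + (1 - (1 - b)) = 1 by ring.
    rewrite powRr1 ?(ltW k0)// -!mulrA; congr (_ * (_ * _)).
    by rewrite mulrCA mulfV ?mulr1// gt_eqF// addr_gt0.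
  apply: cvgM => //.
  apply/cvgrPdistC_le => /= e e0; near=> k.
  have kc : 0 < k%:R + b by rewrite ltr_wpDl.
  have -> : k%:R / (k%:R + b) - 1 = - (b / (k%:R + b)) by field; rewrite gt_eqF.
  rewrite normrN gtr0_norm ?divr_gt0// ler_pdivrMr// -ler_pdivrMl//.
  apply: (@le_trans _ _ k%:R); last by rewrite lerDl ltW.
  by near: k; exact: nbhs_infty_ger.
have := cvg_unique _ h4 (cvgM h1 h2); rewrite mulr1 => /(_ _) e.
have g0 := Gamma_gt0 c0.
by rewrite mulrAC e// mulfVK// gt_eqF.
Unshelve. all: end_near. Qed.

End reflection.

(** * The Mittag-Leffler density *)

Section series_tools.
Context {R : realType}.

Lemma cvg_series_half (a : nat -> R) : (forall j, 0 <= a j) ->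
  (\forall j \near \oo, a j.+1 <= 2^-1 * a j) -> cvgn (series a).
Proof.
move=> a0 [N _ aN].
(* The bound a j <= C 2^(- j) holds for j <= N because a j 2^j is one term of C; beyond N the ratio
   propagates it. *)
pose C := \sum_(i < N.+1) a i * 2 ^+ i.
have C0 i : 0 <= a i * 2 ^+ i by rewrite mulr_ge0 ?exprn_ge0.
have aC j : a j <= C * 2^-1 ^+ j.
  elim: j => [|j IH].
    rewrite expr0 mulr1 /C big_ord_recl expr0 mulr1 lerDl.
    by apply: sumr_ge0.
  have [Nj|jN] := leqP N j.
    apply: (le_trans (aN j Nj)); rewrite exprS mulrCA.
    by rewrite ler_wpM2l ?invr_ge0.
  rewrite -ler_pdivrMr ?exprn_gt0 ?invr_gt0// -exprVn invrK.
  rewrite /C (bigD1 (Ordinal (_ : j.+1 < N.+1)%N))//= lerDl.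
  by apply: sumr_ge0.
apply: (@series_le_cvg _ a (fun j => C * 2^-1 ^+ j)) => //.
- by move=> n; apply: le_trans (aC n).
- apply: (@is_cvg_geometric_series _ C 2^-1).
  by rewrite ger0_norm ?invr_ge0// invf_lt1// ltr1n.
Qed.

Lemma nbhs_infty_powR_ge (p C : R) : 0 < p -> \forall n \near \oo, C <= n%:R `^ p.
Proof.
move=> p0; near=> n.
have [C0|C0] := leP C 0; first by rewrite (le_trans C0)// powR_ge0.
have : C `^ p^-1 <= n%:R by near: n; exact: nbhs_infty_ger.
move=> h; have := ge0_ler_powR (ltW p0) (powR_ge0 C p^-1) (ler0n R n) h.
by rewrite -powRrM mulVf ?gt_eqF// powRr1// ltW.
Unshelve. all: end_near. Qed.

(** Tannery's theorem: after cutting at a fixed M, both remainders are bounded by the tail of b. The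
    length [J k] varies because the sums in [renw_sum] grow with k. *)
Lemma tannery (t : nat -> nat -> R) (a b : nat -> R) (J : nat -> nat) :
  (forall j, t k j @[k --> \oo] --> a j) ->
  (\forall k \near \oo, forall j, `|t k j| <= b j) ->
  cvgn (series b) -> (forall k, k <= J k)%N ->
  (\sum_(j < J k) t k j) @[k --> \oo] --> limn (series a).
Proof.
move=> ta tb cb kJ.
have ab j : `|a j| <= b j.
  have h : `|t k j| @[k --> \oo] --> `|a j| by apply: cvg_norm; exact: ta.
  apply: (cvgr_to_le h); near=> k.
  by near: k; apply: filterS tb => k; exact.
have b0 j : 0 <= b j by apply: le_trans (ab j).
have cna : cvgn [normed series a].
  by apply: series_le_cvg cb => //= j.
have ca : cvgn (series a) by exact: normed_cvg.
have tailb n m : \sum_(n <= j < m) b j <= limn (series b) - series b n.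
  have [nm|mn] := leqP n m; last first.
    rewrite big_geq ?(ltnW mn)// subr_ge0.
    by apply: nondecreasing_cvgn_le => //; apply: nondecreasing_series.
  rewrite -(sub_series_geq b nm) lerD2r.
  by apply: nondecreasing_cvgn_le => //; apply: nondecreasing_series.
apply/cvgrPdist_le => e e0.
have e4 : 0 < e / 4 by rewrite divr_gt0.
have [N _ Nb] : \forall n \near \oo, `|limn (series b) - series b n| <= e / 4.
  by move/cvgrPdist_le : cb; exact.
have [N' _ Na] : \forall n \near \oo, `|limn (series a) - series a n| <= e / 4.
  by move/cvgrPdist_le : ca; exact.
set M := maxn N N'.
have sumc m : (\sum_(j < m) t k j) @[k --> \oo] --> \sum_(j < m) a j.
  elim: m => [|m IH].
    by rewrite big_ord0; under eq_fun do rewrite big_ord0; exact: cvg_cst.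
  rewrite big_ord_recr; under eq_fun do rewrite big_ord_recr/=.
  by apply: cvgD => //; exact: ta.
near=> k.
have Mk : (M <= J k)%N.
  by apply: leq_trans (kJ k); near: k; exact: nbhs_infty_ge.
have tk : forall j, `|t k j| <= b j by near: k.
have h1 : `|\sum_(j < M) a j - \sum_(j < M) t k j| <= e / 4.
  by near: k; move/cvgrPdist_le : (sumc M); exact.
have h2 : `|\sum_(M <= j < J k) t k j| <= e / 4.
  apply: (le_trans (ler_norm_sum _ _ _)).
  apply: (le_trans (ler_sum _ (fun j _ => tk j))).
  apply: (le_trans (tailb _ _)); apply: le_trans (ler_norm _) _.
  by apply: Nb; rewrite /= leq_maxl.
have h3 : `|limn (series a) - series a M| <= e / 4.
  by apply: Na; rewrite /= leq_maxr.
have sa : series a M = \sum_(j < M) a j by rewrite /series/= big_mkord.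
have st : \sum_(j < J k) t k j = \sum_(j < M) t k j + \sum_(M <= j < J k) t k j.
  by rewrite -!(big_mkord xpredT) (big_cat_nat (n:=M)).
rewrite st -sa in h1 *.
have -> : limn (series a) - (\sum_(j < M) t k j + \sum_(M <= j < J k) t k j) =
  (limn (series a) - series a M) + (series a M - \sum_(j < M) t k j)
   - \sum_(M <= j < J k) t k j by ring.
apply: (le_trans (ler_normB _ _)).
apply: (le_trans (lerD (ler_normD _ _) h2)).
apply: (le_trans (lerD (lerD h3 h1) (lexx _))).
lra.
Unshelve. all: end_near. Qed.

End series_tools.

Section bcoef_asymptotics.
Context {R : realType}.
Implicit Types (a : R) (k q : nat).

Lemma cvg_natV : (k%:R^-1 : R) @[k --> \oo] --> (0 : R).
Proof.
apply/gtr0_cvgV0; last exact: cvgr_idn.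
by near=> k; rewrite ltr0n; near: k; exact: nbhs_infty_gt.
Unshelve. all: end_near. Qed.

Lemma sin_piB1 a : sin (pi * (a - 1)) = - sin (pi * a).
Proof. by rewrite mulrBr mulr1 sinB sinpi cospi mulr0 subr0 mulrN1. Qed.

(** The limit is 1 / Gamma(- a), rewritten by reflection so that [Gamma] is evaluated at a positive
    argument. On (-1, 0) this is [bcoefN_cvg]; at 0 the coefficients and the sine both vanish;
    [bcoef_shift] raises a by 1. *)
Lemma bcoef_cvg a : - 1 < a ->
  (bcoef a k * k%:R `^ (a + 1)) @[k --> \oo] -->
  - (sin (pi * a) * Gamma (a + 1) / pi).
Proof.
have ind q (b : R) : - 1 < b <= q%:R -> (bcoef b k * k%:R `^ (b + 1)) @[k --> \oo] -->
    - (sin (pi * b) * Gamma (b + 1) / pi).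
  elim: q b => [|q IH] b /andP[b1 bq].
    have [b0|b0] := eqVneq b 0.
      rewrite b0 mulr0 sin0 !mul0r oppr0; apply: cvg_near_cst; near=> k.
      rewrite (_ : 0 = 0%:R) // bcoef_eq0 ?mul0r//.
      by near: k; exact: nbhs_infty_gt.
    have b01 : 0 < - b < 1 by rewrite oppr_gt0 lt_neqAle b0 bq ltrNl.
    have /andP[bn0 _] := b01.
    have := bcoefN_cvg bn0; rewrite Gamma_reflection// !opprK mulrN sinN.
    by rewrite !mulNr [1 + b]addrC.
  have [bq'|bq'] := leP b q%:R; first by apply: IH; rewrite b1.
  have b0 : 0 < b by apply: le_lt_trans bq'.
  have b1q : - 1 < b - 1 <= q%:R by rewrite ltrBDr addNr b0/= lerBlDr natr1.
  have {}IH := IH _ b1q.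
  rewrite subrK in IH.
  have -> : - (sin (pi * b) * Gamma (b + 1) / pi) =
    (- b) * (- (sin (pi * (b - 1)) * Gamma b / pi)) * 1.
    rewrite sin_piB1 Gamma_recurrence// mulr1.
    by move: (sin (pi * b)) => s; ring.
  rewrite -cvg_shiftS /=.
  have E k : (0 < k)%N -> bcoef b k.+1 * k.+1%:R `^ (b + 1) =
     (- b) * (bcoef (b - 1) k * k%:R `^ b) * (1 + k%:R^-1) `^ b.
    move=> k0; have kR : 0 < k%:R :> R by rewrite ltr0n.
    rewrite bcoef_shift.
    have -> : k.+1%:R `^ (b + 1) = k.+1%:R `^ b * k.+1%:R :> R.
      by rewrite -[X in _ * X]powRr1// -powRD// pnatr_eq0 implybT.
    have -> : k.+1%:R `^ b = k%:R `^ b * (1 + k%:R^-1) `^ b :> R.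
      rewrite -powRM// ?addr_ge0// mulrDr mulr1 mulfV ?natr1//.
      by rewrite gt_eqF.
    have k1 : k.+1%:R != 0 :> R by rewrite pnatr_eq0.
    move: (_ `^ _) (_ `^ _) (bcoef _ _) => u v w.
    move: (k.+1%:R) k1 => K K0.
    by field.
  apply: (@cvg_trans _ ((- b) * (bcoef (b - 1) k * k%:R `^ b) * (1 + k%:R^-1) `^ b @[k --> \oo])).
    apply: near_eq_cvg; near=> k; rewrite E//.
    by near: k; exact: nbhs_infty_gt.
  apply: cvgM; first exact: cvgMr.
  have h1 : (1 + k%:R^-1 : R) @[k --> \oo] --> (1 : R).
    by rewrite -[X in _ --> X]addr0; apply: cvgD; [exact: cvg_cst|exact: cvg_natV].
  have := cvg_comp _ _ h1 (@continuous_powR_gt0 _ b 1 ltr01).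
  by rewrite powR1.
move=> a1; apply: (ind (Num.truncn `|a|).+1); rewrite a1/=.
by rewrite (le_trans (ler_norm _))// ltW// truncnS_gt.
Unshelve. all: end_near. Qed.

(** An explicit constant for every k > q is what domination requires, since a and q will grow with
    the summation index. Each use of [bcoef_shift] lowers k by one, hence the k - q. *)
Lemma norm_bcoef_le a q k : - 1 < a <= q%:R -> (q < k)%N ->
  `|bcoef a k| <= Gamma (a + 1) * (k - q)%:R `^ (- (a + 1)).
Proof.
elim: q a k => [|q IH] a k /andP[a1 aq] qk.
  have [->|a0] := eqVneq a 0.
    by rewrite -[0]/(0%:R) bcoef_eq0// normr0 mulr_ge0 ?powR_ge0 ?Gamma_ge0.
  have b01 : 0 < - a < 1 by rewrite oppr_gt0 lt_neqAle a0 aq ltrNl.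
  have /andP[bn0 bn1] := b01.
  rewrite ger0_norm ?bcoef_ge0// subn0 -[a in bcoef a]opprK.
  have bb : 0 < - a <= 1 by rewrite bn0 ltW.
  apply: (le_trans (bcoefN_le bb qk)).
  rewrite mulrC opprD -[a + 1]addrC ler_wpM2r ?powR_ge0//.
  rewrite Gamma_reflection// opprK ler_pdivrMr ?pi_gt0//.
  rewrite mulrC ler_wpM2l ?Gamma_ge0// (le_trans (sin_le1 _))//.
  by rewrite (le_trans _ (pi_ge2 R))// ler1n.
have kq0 : 0 < (k - q.+1)%:R :> R by rewrite ltr0n subn_gt0.
have [aq'|aq'] := leP a q%:R.
  have qk' : (q < k)%N by rewrite (leq_trans _ qk).
  apply: (le_trans (IH a k _ qk')); first by rewrite a1.
  rewrite ler_wpM2l ?Gamma_ge0// !powRN lef_pV2 ?posrE ?powR_gt0//; last first.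
    by rewrite ltr0n subn_gt0.
  apply: ge0_ler_powR; rewrite ?nnegrE//; first by lra.
  by rewrite ler_nat leq_sub2l.
have a0 : 0 < a by apply: le_lt_trans aq'.
case: k qk kq0 => // k qk; rewrite subSS => kq0.
have a1q : - 1 < a - 1 <= q%:R by rewrite ltrBDr addNr a0/= lerBlDr natr1.
have := IH (a - 1) k a1q qk; rewrite subrK => h.
have aS : 0 <= a / k.+1%:R by rewrite divr_ge0 ?(ltW a0).
rewrite bcoef_shift normrM mulNr normrN (ger0_norm aS).
apply: (le_trans (ler_wpM2l aS h)).
rewrite Gamma_recurrence// opprD powRD ?(gt_eqF kq0) ?implybT//.
rewrite [X in X <= _]mulrAC [a * (Gamma a * _)]mulrA [X in _ <= X]mulrA ler_wpM2l//.
  by rewrite !mulr_ge0 ?Gamma_ge0 ?powR_ge0 ?(ltW a0).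
rewrite powR_inv1 ?(ltW kq0)// lef_pV2 ?posrE// ler_nat.
by rewrite (leq_trans (leq_subr _ _)).
Qed.

End bcoef_asymptotics.

Section wright_density.
Context {R : realType} (kappa : R).
Hypothesis kappa_gt0 : 0 < kappa.
Hypothesis kappa_lt1 : kappa < 1.
Implicit Types (u M : R) (j k n : nat).

Let kappa01 : 0 <= kappa <= 1.
Proof. by rewrite !ltW. Qed.

Let expo_gt0 j : 0 < kappa * j.+1%:R.
Proof. by rewrite mulr_gt0. Qed.

(** By reflection the last factor is 1 / Gamma(1 - kappa (j + 1)), so the sum is the M-Wright
    function of order kappa. The unsimplified argument is that of [bcoef_cvg] at a = kappa (j + 1) -
    1. *)
Definition wright_term u j : R :=
  (-1) ^+ j * (u ^+ j / j`!%:R) *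
  - (sin (pi * (kappa * j.+1%:R - 1)) * Gamma (kappa * j.+1%:R - 1 + 1) / pi).

(** The power of 2 pays for replacing k - q by k / 2 in [norm_bcoef_le]; for kappa < 1 the factorial
    still wins against the Gamma factor. *)
Definition wright_bound M j : R :=
  M ^+ j / j`!%:R * (Gamma (kappa * j.+1%:R) * 2 `^ (kappa * j.+1%:R)).

Lemma cvg_wright_bound M : 0 <= M -> cvgn (series (wright_bound M)).
Proof.
move=> M0; apply: cvg_series_half.
  move=> j; rewrite /wright_bound !mulr_ge0 ?exprn_ge0 ?invr_ge0 ?Gamma_ge0 ?powR_ge0//.
have k10 : 0 < 1 - kappa by rewrite subr_gt0.
near=> j.
(* By Wendel the quotient of consecutive terms is at most 2 M (j + 1)^(kappa - 1), which is at most
   1 / 2 beyond this threshold. *)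
have h : 4 * M <= j.+1%:R `^ (1 - kappa).
  apply: (@le_trans _ _ (j%:R `^ (1 - kappa))).
    by near: j; exact: nbhs_infty_powR_ge.
  by apply: ge0_ler_powR; rewrite ?nnegrE ?(ltW k10)// ler_nat.
set x := kappa * j.+1%:R.
have x0 : 0 < x by exact: expo_gt0.
have E : kappa * j.+2%:R = x + kappa by rewrite /x -[j.+2%:R]natr1 mulrDr mulr1.
rewrite /wright_bound E -/x powRD; last by rewrite pnatr_eq0 implybT.
have G1 := Gamma_addr_le x0 kappa01.
have xk : x `^ kappa <= j.+1%:R `^ kappa.
  apply: ge0_ler_powR; rewrite ?nnegrE ?(ltW x0) ?(ltW kappa_gt0)//.
  by rewrite /x ler_piMl// ltW.
have tk : 2 `^ kappa <= 2 :> R.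
  by rewrite -[X in _ <= X]powRr1// ler_powR ?ler1n// ltW.
have J0 : 0 < j.+1%:R :> R by [].
have Jk : j.+1%:R `^ kappa * (4 * M) <= j.+1%:R.
  apply: (le_trans (ler_wpM2l (powR_ge0 _ _) h)).
  by rewrite -powRD ?pnatr_eq0 ?implybT// addrC subrK powRr1.
have G2 : Gamma (x + kappa) <= j.+1%:R `^ kappa * Gamma x.
  by apply: (le_trans G1); rewrite ler_wpM2r ?Gamma_ge0.
have G3 : Gamma (x + kappa) * 2 `^ kappa <= j.+1%:R `^ kappa * Gamma x * 2.
  by apply: ler_pM; rewrite ?Gamma_ge0 ?powR_ge0.
have f0 : 0 < j`!%:R :> R by rewrite ltr0n fact_gt0.
have -> : M ^+ j.+1 / j.+1`!%:R * (Gamma (x + kappa) * (2 `^ x * 2 `^ kappa)) =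
   (M ^+ j / j`!%:R * 2 `^ x) * (M / j.+1%:R * (Gamma (x + kappa) * 2 `^ kappa)).
  rewrite factS natrM exprS.
  move: (j`!%:R) f0 (j.+1%:R) J0 => f f0 J J0'.
  by field; rewrite !gt_eqF.
have -> : 2^-1 * (M ^+ j / j`!%:R * (Gamma x * 2 `^ x)) =
   (M ^+ j / j`!%:R * 2 `^ x) * (2^-1 * Gamma x) by ring.
rewrite ler_wpM2l ?mulr_ge0 ?exprn_ge0 ?invr_ge0 ?powR_ge0//.
have MJ : 0 <= M / j.+1%:R by rewrite divr_ge0.
apply: (le_trans (ler_wpM2l MJ G3)).
have g0 := Gamma_ge0 x.
have -> : M / j.+1%:R * (j.+1%:R `^ kappa * Gamma x * 2) =
    j.+1%:R `^ kappa * (4 * M) / j.+1%:R * (2^-1 * Gamma x).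
  move: (_ `^ _) (Gamma x) => P G; move: (j.+1%:R) J0 => J J0'.
  by field; rewrite gt_eqF.
by rewrite ler_piMl ?mulr_ge0 ?invr_ge0// ler_pdivrMr// mul1r.
Unshelve. all: end_near. Qed.

Lemma norm_wright_term_le u M j : 0 <= u <= M -> `|wright_term u j| <= wright_bound M j.
Proof.
move=> /andP[u0 uM]; rewrite /wright_term /wright_bound subrK normrM normrM.
rewrite normrX normrN1 expr1n mul1r ger0_norm; last by rewrite divr_ge0 ?exprn_ge0.
apply: ler_pM; rewrite ?divr_ge0 ?exprn_ge0//.
  by rewrite ler_wpM2r ?invr_ge0// lerXn2r ?nnegrE// (le_trans u0).
rewrite normrN 2!normrM (ger0_norm (Gamma_ge0 _)) [ `|pi^-1|]ger0_norm ?invr_ge0 ?pi_ge0//.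
have h2 : 1 <= 2 `^ (kappa * j.+1%:R) :> R.
  have t1 : 1 <= 2 :> R by rewrite ler1n.
  by have := ler_powR t1 (ltW (expo_gt0 j)); rewrite powRr0.
rewrite ler_pdivrMr ?pi_gt0// mulrAC -mulrA.
apply: (@le_trans _ _ (1 * Gamma (kappa * j.+1%:R))).
  by rewrite ler_wpM2r ?Gamma_ge0// sin_max.
rewrite mul1r ler_peMr ?Gamma_ge0//.
apply: (le_trans h2); rewrite ler_peMl ?powR_ge0//.
by rewrite (le_trans _ (pi_ge2 R))// ler1n.
Qed.

Lemma cvg_wright u : 0 <= u -> cvgn (series (wright_term u)).
Proof.
move=> u0; apply: normed_cvg; apply: (series_le_cvg _ _ _ (cvg_wright_bound u0)) => //= j.
- by rewrite /wright_bound !mulr_ge0 ?exprn_ge0 ?invr_ge0 ?Gamma_ge0 ?powR_ge0.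
- by apply: norm_wright_term_le; rewrite u0 lexx.
Qed.

Lemma ML_density_series u : 0 <= u ->
  ML_density kappa u = limn (series (wright_term u)).
Proof.
move=> u0; rewrite /ML_density.
have pk0 : pi * kappa != 0 by rewrite mulf_neq0 ?gt_eqF ?pi_gt0.
set S := fun n => \sum_(1 <= j < n) _.
have SE n : S n.+1 = (pi * kappa) * series (wright_term u) n.
  rewrite /S /series/= big_add1 /= mulr_sumr; apply: eq_bigr => j _.
  rewrite /wright_term subrK sin_piB1 Gamma_recurrence// factS natrM.
  rewrite -[pi * kappa * j.+1%:R]mulrA.
  have pin0 : pi != 0 :> R by rewrite gt_eqF ?pi_gt0.
  have f0 : j`!%:R != 0 :> R by rewrite pnatr_eq0 -lt0n fact_gt0.
  have J0 : j.+1%:R != 0 :> R by rewrite pnatr_eq0.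
  move: (sin _) (Gamma _) => v g; move: pi pin0 => p p0.
  move: (j`!%:R) f0 (j.+1%:R) J0 => f f0 J J0.
  by field; rewrite J0 f0 p0.
have : S n @[n --> \oo] --> (pi * kappa) * limn (series (wright_term u)).
  rewrite -cvg_shiftS /=; under eq_fun do rewrite SE.
  by apply: cvgMr; exact: cvg_wright.
by move=> /cvg_lim ->//; rewrite mulKf.
Qed.

Let cvg_natX : (k%:R `^ kappa : R)^-1 @[k --> \oo] --> (0 : R).
Proof.
apply/gtr0_cvgV0.
  near=> k; rewrite powR_gt0// ltr0n; near: k; exact: nbhs_infty_gt.
apply/cvgryPge => A; exact: nbhs_infty_powR_ge.
Unshelve. all: end_near. Qed.

Let jumps u k := Num.truncn (u * k%:R `^ kappa).

Let jumps_bin_cvg u j : 0 <= u ->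
  ('C(jumps u k, j)%:R / (k%:R `^ kappa) ^+ j) @[k --> \oo] --> u ^+ j / j`!%:R.
Proof.
move=> u0; elim: j => [|j IH].
  by under eq_fun do rewrite bin0 expr0 divr1; rewrite expr0 divr1; exact: cvg_cst.
have n_cvg : ((jumps u k - j)%N%:R / k%:R `^ kappa) @[k --> \oo] --> u.
  apply: (@squeeze_cvgr _ _ _ _ (fun k : nat => u - j.+1%:R * (k%:R `^ kappa)^-1) (fun=> u)).
  - near=> k.
    have K0 : 0 < k%:R `^ kappa :> R.
      by rewrite powR_gt0// ltr0n; near: k; exact: nbhs_infty_gt.
    have /andP[t1 t2] := truncn_itv (mulr_ge0 u0 (ltW K0)).
    apply/andP; split.
      rewrite ler_pdivlMr// mulrBl mulfVK ?gt_eqF//.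
      have : (jumps u k)%:R <= ((jumps u k - j)%N%:R + j%:R : R).
        by rewrite -natrD ler_nat addnC -leq_subLR.
      by rewrite -natr1 in t2 *; rewrite /jumps; lra.
    rewrite ler_pdivrMr//; apply: le_trans t1.
    by rewrite ler_nat leq_subr.
  - rewrite -[X in _ --> X]subr0; apply: cvgB; first exact: cvg_cst.
    by rewrite -[X in _ --> X](mulr0 j.+1%:R); apply: cvgMr; exact: cvg_natX.
  - exact: cvg_cst.
have -> : u ^+ j.+1 / j.+1`!%:R = u ^+ j / j`!%:R * (u * j.+1%:R^-1).
  by rewrite exprSr factS natrM mulrACA -invfM [j`!%:R * _]mulrC.
have -> : (fun k : nat => 'C(jumps u k, j.+1)%:R / (k%:R `^ kappa) ^+ j.+1 : R) = (fun k : nat =>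
   'C(jumps u k, j)%:R / (k%:R `^ kappa) ^+ j * ((jumps u k - j)%N%:R / k%:R `^ kappa * j.+1%:R^-1)).
  apply/funext => k.
  have := mul_bin_left (jumps u k) j => /(congr1 (fun n => n%:R : R)).
  rewrite !natrM => h.
  have J0 : j.+1%:R != 0 :> R by rewrite pnatr_eq0.
  have -> : 'C(jumps u k, j.+1)%:R = (jumps u k - j)%N%:R * 'C(jumps u k, j)%:R / j.+1%:R :> R.
    by rewrite -h mulrAC mulfV// mul1r.
  by rewrite exprSr invfM; ring.
apply: cvgM => //; apply: cvgM => //; exact: cvg_cst.
Unshelve. all: end_near. Qed.

Let renw_term u k j : R :=
  'C(jumps u k, j)%:R * (-1) ^+ j * bcoef (kappa * j.+1%:R - 1) k * k%:R `^ kappa.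

Let renw_sum u k J : (jumps u k < J)%N ->
  k%:R `^ kappa * renw kappa (jumps u k) k = \sum_(j < J) renw_term u k j.
Proof.
move=> nJ; rewrite /renw mulr_sumr.
rewrite (big_ord_widen J (fun j => k%:R `^ kappa * ('C(jumps u k, j)%:R * (-1) ^+ j *
  bcoef (kappa * j.+1%:R - 1) k)))//.
rewrite [RHS](bigID (fun j : 'I_J => (j < (jumps u k).+1)%N)) /= [X in _ + X]big1 ?addr0.
  by apply: eq_bigr => j _; rewrite mulrC.
by move=> j; rewrite -leqNgt => nj; rewrite /renw_term bin_small// !mul0r.
Qed.

Let powR_kappaS k j : k%:R `^ (kappa * j.+1%:R) = (k%:R `^ kappa) ^+ j * k%:R `^ kappa :> R.
Proof. by rewrite powRrM powR_mulrn ?powR_ge0// exprSr. Qed.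

Let expoB1 j : - 1 < kappa * j.+1%:R - 1.
Proof. by rewrite ltrBDr addNr. Qed.

Let renw_term_cvg u j : 0 <= u -> renw_term u k j @[k --> \oo] --> wright_term u j.
Proof.
move=> u0; rewrite /wright_term.
have h1 := @jumps_bin_cvg u j u0.
have h2 := bcoef_cvg (@expoB1 j).
have E k : (0 < k)%N -> renw_term u k j = (-1) ^+ j *
    ('C(jumps u k, j)%:R / (k%:R `^ kappa) ^+ j) *
   (bcoef (kappa * j.+1%:R - 1) k * k%:R `^ (kappa * j.+1%:R - 1 + 1)).
  move=> k0; rewrite subrK powR_kappaS /renw_term.
  have K0 : (k%:R `^ kappa) ^+ j != 0 :> R by rewrite gt_eqF// exprn_gt0// powR_gt0// ltr0n.
  move: ((k%:R `^ kappa) ^+ j) K0 => Kj Kj0.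
  by field.
apply: (@cvg_trans _ ((-1) ^+ j * ('C(jumps u k, j)%:R / (k%:R `^ kappa) ^+ j) *
   (bcoef (kappa * j.+1%:R - 1) k * k%:R `^ (kappa * j.+1%:R - 1 + 1)) @[k --> \oo])).
  apply: near_eq_cvg; near=> k; rewrite E//.
  by near: k; exact: nbhs_infty_gt.
by apply: cvgM => //; apply: cvgMr.
Unshelve. all: end_near. Qed.

Lemma bin_le_exp n j : 'C(n, j)%:R <= n%:R ^+ j / j`!%:R :> R.
Proof.
rewrite ler_pdivlMr ?ltr0n ?fact_gt0// -natrM bin_ffact -natrX ler_nat.
by elim: j => [//|j IH]; rewrite ffactnSr expnSr leq_mul// leq_subr.
Qed.

(** Terms with j above the number of jumps vanish, so j <= M k^kappa, which is o(k). Thus q, the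
    integer part of kappa (j + 1), stays below k / 2 and [norm_bcoef_le] applies with k - q >= k /
    2, uniformly in j and u. *)
Let renw_term_dom M : 0 <= M -> \forall k \near \oo,
  forall u j, 0 <= u <= M -> `|renw_term u k j| <= wright_bound M j.
Proof.
move=> M0; have k10 : 0 < 1 - kappa by rewrite subr_gt0.
near=> k => u j /andP[u0 uM].
have k2 : (1 < k)%N by near: k; exact: nbhs_infty_gt.
have kR : 0 < k%:R :> R by rewrite ltr0n (ltn_trans _ k2).
set K := k%:R `^ kappa; have K0 : 0 < K by rewrite powR_gt0.
have big : 2 * (M + 1) <= k%:R `^ (1 - kappa).
  by near: k; exact: nbhs_infty_powR_ge.
have K1 : 1 <= K.
  have := @ler_powR _ k%:R _ 0 kappa (ltW kappa_gt0); rewrite powRr0; apply.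
  by rewrite ler1n (ltn_trans _ k2).
have MK : 2 * (M * K + 1) <= k%:R.
  have := ler_wpM2l (ltW K0) big.
  have -> : K * k%:R `^ (1 - kappa) = k%:R.
    by rewrite /K -powRD ?(gt_eqF kR) ?implybT// [kappa + _]addrC subrK powRr1 ?ler0n.
  by apply: le_trans; nra.
have [nj|jn] := ltnP (jumps u k) j.
  rewrite /renw_term bin_small// !mul0r normr0.
  by rewrite /wright_bound !mulr_ge0 ?exprn_ge0 ?invr_ge0 ?Gamma_ge0 ?powR_ge0.
have nuK : (jumps u k)%:R <= M * K.
  apply: (@le_trans _ _ (u * K)); last by rewrite ler_wpM2r// ltW.
  by rewrite truncn_le mulr_ge0// ltW.
have jMK : j%:R <= M * K by apply: le_trans nuK; rewrite ler_nat.
set q := Num.truncn (kappa * j.+1%:R).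
have /andP[q1 q2] := truncn_itv (ltW (expo_gt0 j)).
have qk : q%:R <= k%:R / 2 :> R.
  apply: (le_trans q1); apply: (@le_trans _ _ j.+1%:R).
    by rewrite ler_piMl// ltW.
  by rewrite -natr1; lra.
have qltk : (q < k)%N.
  rewrite -(ltr_nat R); apply: (le_lt_trans qk).
  by rewrite ltr_pdivrMr// ltr_pMr// ltr1n.
have aq : - 1 < kappa * j.+1%:R - 1 <= q%:R.
  by rewrite expoB1 lerBlDr natr1 ltW.
have := norm_bcoef_le aq qltk; rewrite subrK => hb.
have kq : k%:R / 2 <= (k - q)%N%:R :> R.
  by rewrite natrB ?(ltnW qltk)//; lra.
have kqp : (k - q)%N%:R `^ (- (kappa * j.+1%:R)) <= 2 `^ (kappa * j.+1%:R) / (K ^+ j * K).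
  rewrite -powR_kappaS powRN.
  rewrite -[2 `^ _]invrK -invfM lef_pV2 ?posrE ?mulr_gt0 ?invr_gt0 ?powR_gt0//; last first.
    by rewrite ltr0n subn_gt0.
  have -> : (2 `^ (kappa * j.+1%:R))^-1 * k%:R `^ (kappa * j.+1%:R) = (k%:R / 2) `^ (kappa * j.+1%:R).
    rewrite powRM ?invr_ge0// mulrC; congr (_ * _).
    by rewrite -[in RHS]powR_inv1// -powRrM mulN1r powRN.
  by apply: ge0_ler_powR; rewrite ?nnegrE ?divr_ge0 ?(ltW (expo_gt0 j)).
have hC : 'C(jumps u k, j)%:R <= M ^+ j / j`!%:R * K ^+ j.
  apply: (le_trans (bin_le_exp _ _)); rewrite mulrAC ler_wpM2r ?invr_ge0//.
  by rewrite -exprMn lerXn2r ?nnegrE// mulr_ge0// ltW.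
rewrite /renw_term normrM normrM normrM normrX normrN1 expr1n mulr1.
rewrite (ger0_norm (ltW K0)) ger0_norm//.
have hb2 : `|bcoef (kappa * j.+1%:R - 1) k| <=
    Gamma (kappa * j.+1%:R) * (2 `^ (kappa * j.+1%:R) / (K ^+ j * K)).
  by apply: (le_trans hb); rewrite ler_wpM2l ?Gamma_ge0.
apply: (le_trans (ler_wpM2r (ltW K0) (ler_pM _ _ hC hb2))) => //.
rewrite /wright_bound; have KJ0 : K ^+ j != 0 by rewrite expf_neq0// gt_eqF.
rewrite le_eqVlt; apply/orP; left; apply/eqP.
move: (M ^+ j / _) (Gamma _) (2 `^ _) => A B C.
by field; rewrite KJ0 gt_eqF.
Unshelve. all: end_near. Qed.

Lemma renw_cvg_density u : 0 <= u ->
  (k%:R `^ kappa * renw kappa (Num.truncn (u * k%:R `^ kappa)) k) @[k --> \oo] -->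
  ML_density kappa u.
Proof.
move=> u0; rewrite ML_density_series//.
(* The sum is padded with vanishing binomials so that it has at least k terms, as [tannery] asks. *)
have -> : (fun k : nat => k%:R `^ kappa * renw kappa (Num.truncn (u * k%:R `^ kappa)) k) =
    (fun k => \sum_(j < k + (jumps u k).+1) renw_term u k j).
  by apply/funext => k; rewrite (@renw_sum u k (k + (jumps u k).+1)%N)// leq_addl.
apply: (tannery (b := wright_bound u)).
- by move=> j; exact: renw_term_cvg.
- near=> k => j.
  have h : forall u' j, 0 <= u' <= u -> `|renw_term u' k j| <= wright_bound u j.
    by near: k; exact: renw_term_dom.
  by apply: h; rewrite u0 lexx.
- exact: cvg_wright_bound.
- by move=> k; exact: leq_addr.
Unshelve. all: end_near. Qed.

Lemma renw_dominated M : 0 <= M -> exists C, \forall k \near \oo,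
  forall u, 0 <= u <= M ->
  k%:R `^ kappa * renw kappa (Num.truncn (u * k%:R `^ kappa)) k <= C.
Proof.
move=> M0; exists (limn (series (wright_bound M))).
near=> k => u uM.
rewrite (renw_sum (ltnSn _)) (le_trans (ler_norm _))// (le_trans (ler_norm_sum _ _ _))//.
apply: (@le_trans _ _ (series (wright_bound M) (jumps u k).+1)).
  rewrite /series/= big_mkord; apply: ler_sum => j _.
  have h : forall u j, 0 <= u <= M -> `|renw_term u k j| <= wright_bound M j.
    by near: k; exact: renw_term_dom.
  exact: h.
apply: nondecreasing_cvgn_le; last exact: cvg_wright_bound.
apply: nondecreasing_series => j _ _.
by rewrite /wright_bound !mulr_ge0 ?exprn_ge0 ?invr_ge0 ?Gamma_ge0 ?powR_ge0.
Unshelve. all: end_near. Qed.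

End wright_density.

Lemma integrable_le_cst {R : realType} d (T : measurableType d)
    (mu : {measure set T -> \bar R}) (D : set T) (f : T -> R) (M : R) :
  measurable D -> (mu D < +oo)%E -> measurable_fun D f ->
  (forall x, D x -> `|f x| <= M) -> mu.-integrable D (EFin \o f).
Proof.
move=> mD finD mf fM; apply: measurable_bounded_integrable => //.
exists M; split; first exact: num_real.
by move=> x Mx u Du /=; rewrite (le_trans (fM u Du))// ltW.
Qed.

(** * Passage to the limit in integrals, and the moments of the density *)

Section integral_limits.
Context {R : realType}.
Local Notation mu := (@lebesgue_measure R).
Local Notation D := (`[0%R, +oo[%classic : set R).
Implicit Types (F G : nat -> R -> R) (f : R -> R).

Let leD u : D u = (0 <= u) :> Prop.
Proof. by rewrite /= in_itv/= andbT. Qed.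

(* Fatou bounds the limit from above; domination on [0, M] together with
   u F_k <= G_k, which controls the mass of F_k beyond M, from below. *)
Lemma integral_lim_tight F G f (a b : R) :
  (forall k, measurable_fun D (F k)) -> (forall k, measurable_fun D (G k)) ->
  (forall k (u : R), 0 <= u -> 0 <= F k u) ->
  (forall u : R, 0 <= u -> F k u @[k --> \oo] --> f u) ->
  (forall M : R, 0 < M -> exists C, \forall k \near \oo,
      forall u : R, 0 <= u <= M -> F k u <= C) ->
  (forall k (u : R), 0 <= u -> u * F k u <= G k u) ->
  ((\int[mu]_(u in D) (F k u)%:E)%E @[k --> \oo] --> a%:E) ->
  ((\int[mu]_(u in D) (G k u)%:E)%E @[k --> \oo] --> b%:E) ->
  (\int[mu]_(u in D) (f u)%:E = a%:E)%E.
Proof.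
move=> mF mG F0 Ff Fdom FG Fa Gb.
have mFE k : measurable_fun D (EFin \o F k) by apply/measurable_EFinP.
have mGE k : measurable_fun D (EFin \o G k) by apply/measurable_EFinP.
have f0 (u : R) : 0 <= u -> 0 <= f u.
  move=> u0; apply: (cvgr_to_ge (Ff u u0)).
  by apply: nearW => k; exact: F0.
have G0 k (u : R) : 0 <= u -> 0 <= G k u.
  by move=> u0; apply: (le_trans _ (FG k u u0)); rewrite mulr_ge0// F0.
have mf : measurable_fun D f.
  by apply: (measurable_fun_cvg mF) => u; rewrite leD; exact: Ff.
have mfE : measurable_fun D (EFin \o f) by apply/measurable_EFinP.
apply/eqP; rewrite eq_le; apply/andP; split.
  have := fatou mu (measurable_itv _) mFE.
  have F0E n u : D u -> (0 <= (EFin \o F n) u)%E.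
    by rewrite leD => u0; rewrite lee_fin F0.
  move=> /(_ F0E); rewrite (cvg_limn_einf_sup Fa).1.
  apply: le_trans; rewrite le_eqVlt; apply/orP; left; apply/eqP.
  apply: eq_integral => u; rewrite inE leD => u0.
  have h : (EFin \o F^~ u) k @[k --> \oo] --> (f u)%:E.
    by apply: cvg_EFin; [exact: nearW|exact: Ff].
  by rewrite (cvg_limn_einf_sup h).1.
have b0 : 0 <= b.
  rewrite -lee_fin; apply: (cvge_to_ge Gb); apply: nearW => k.
  by apply: integral_ge0 => u; rewrite leD => u0; rewrite lee_fin G0.
suff h (M : R) : 0 < M -> (a%:E <= \int[mu]_(u in D) (f u)%:E + (b / M)%:E)%E.
  have I0 : (0 <= \int[mu]_(u in D) (f u)%:E)%E.
    by apply: integral_ge0 => u; rewrite leD => u0; rewrite lee_fin f0.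
  apply/lee_addgt0Pr => e e0.
  apply: (le_trans (h (b / e + 1) _)).
    by rewrite ltr_wpDl// divr_ge0// ltW.
  rewrite leeD2l// lee_fin ler_pdivrMr; last by rewrite ltr_wpDl// divr_ge0// ltW.
  by rewrite mulrDr mulr1 mulrCA mulfV ?gt_eqF// mulr1 lerDl ltW.
move=> M0.
have [C [N _ CN]] := Fdom M M0.
(* Domination on [0, M] holds only from the index N on, so the sequences are shifted by N. *)
pose F' k := F (k + N)%N.
have mDM : measurable `[0%R, M] by exact: measurable_itv.
have subM : `[0%R, M] `<=` D.
  by move=> u; rewrite leD /= in_itv/= => /andP[].
have MD : D = `[0%R, M]%classic `|` `]M, +oo[%classic.
  apply/seteqP; split => u; rewrite /= !in_itv/= !andbT.
    by move=> u0; rewrite u0/=; have [uM|uM] := leP u M; [left|right].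
  by move=> [/andP[]//|/(lt_trans M0)/ltW].
have disj : [disjoint `[0%R, M]%classic & `]M, +oo[%classic].
  apply/disj_setPS => u [] /=; rewrite !in_itv/= andbT => /andP[_ uM].
  by rewrite ltNge uM.
have [|||intf _ cvgM] := @dominated_convergence _ _ _ mu `[0%R, M]%classic mDM
  (fun k => EFin \o F' k) (EFin \o f) (EFin \o cst C)
  (fun k => measurable_funS (measurable_itv _) subM (mFE (k + N)%N))
  (measurable_funS (measurable_itv _) subM mfE).
- apply: aeW => u; rewrite /= in_itv/= => /andP[u0 _].
  apply: cvg_EFin; first exact: nearW.
  by apply: (cvg_comp _ _ _ (Ff u u0)); exact: cvg_addnr.
- apply: (@integrable_le_cst _ _ _ _ _ _ `|C|) => //.
  have e := @lebesgue_measure_itv R `[0%R, M].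
    by rewrite [ltLHS]e/= lte_fin M0 -EFinB ltry.
- apply: aeW => u k; rewrite /= in_itv/= => uM; have /andP[u0 _] := uM.
  by rewrite lee_fin ger0_norm ?F0// CN//= leq_addl.
have h k : (\int[mu]_(u in D) (F' k u)%:E <= \int[mu]_(u in `[0%R, M]) (F' k u)%:E +
    (M^-1)%:E * \int[mu]_(u in D) (G (k + N)%N u)%:E)%E.
  rewrite {1}MD ge0_integral_setU//=; last 2 first.
  - by rewrite -MD; exact: mFE.
  - move=> u hu; have : D u by rewrite MD; case: hu => hu; [left|right].
    by rewrite leD => u0; rewrite lee_fin F0.
  rewrite leeD2l//.
  apply: (@le_trans _ _ (\int[mu]_(u in `]M, +oo[) ((M^-1)%:E * (G (k + N)%N u)%:E))%E).
    have subD : `]M, +oo[ `<=` D by rewrite MD; exact: subsetUr.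
    apply: ge0_le_integral => //.
    - by move=> u /subD; rewrite leD => u0; rewrite lee_fin F0.
    - exact: measurable_funS (measurable_itv _) subD (mFE _).
    - by apply: emeasurable_funM => //; exact: measurable_funS (measurable_itv _) subD (mGE _).
    - move=> u Mu; have /subD := Mu; rewrite leD => u0.
      move: Mu; rewrite /= in_itv/= andbT => Mu.
      rewrite lee_fin ler_pdivlMl//; apply: le_trans (FG _ _ u0).
      by rewrite ler_wpM2r ?F0// ltW.
  have subD : `]M, +oo[ `<=` D by rewrite MD; exact: subsetUr.
  rewrite -ge0_integralZl//; last 3 first.
  - exact: mGE.
  - by move=> u; rewrite leD => u0; rewrite lee_fin G0.
  - by rewrite lee_fin invr_ge0 ltW.
  apply: ge0_subset_integral => //.
  - by apply: emeasurable_funM => //; exact: mGE.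
  - by move=> u; rewrite leD => u0; rewrite mule_ge0// lee_fin ?invr_ge0 ?G0// ltW.
have cl : (\int[mu]_(u in D) (F' k u)%:E)%E @[k --> \oo] --> a%:E.
  by apply: (cvg_comp _ _ _ Fa); exact: cvg_addnr.
have cG : ((M^-1)%:E * \int[mu]_(u in D) (G (k + N)%N u)%:E)%E @[k --> \oo] --> (b / M)%:E.
  rewrite mulrC EFinM; apply: cvgeZl => //.
  by apply: (cvg_comp _ _ _ Gb); exact: cvg_addnr.
have fin : (\int[mu]_(u in `[0%R, M]) (f u)%:E)%E \is a fin_num.
  exact: integrable_fin_num.
have cr : (\int[mu]_(u in `[0%R, M]) (F' k u)%:E +
    (M^-1)%:E * \int[mu]_(u in D) (G (k + N)%N u)%:E)%E @[k --> \oo] -->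
    (\int[mu]_(u in `[0%R, M]) (f u)%:E + (b / M)%:E)%E.
  by apply: cvgeD => //; exact: fin_num_adde_defr.
have : (limn (fun k => \int[mu]_(u in D) (F' k u)%:E) <=
    limn (fun k => \int[mu]_(u in `[0%R, M]) (F' k u)%:E +
      (M^-1)%:E * \int[mu]_(u in D) (G (k + N)%N u)%:E))%E.
  by apply: lee_lim; [exact: cvgP cl|exact: cvgP cr|exact: nearW].
rewrite (cvg_lim _ cl)// (cvg_lim _ cr)// => /le_trans; apply.
rewrite leeD2r//; apply: ge0_subset_integral => //.
by move=> u; rewrite leD => u0; rewrite lee_fin f0.
Qed.
End integral_limits.

Section step_functions.
Context {R : realType}.
Local Notation mu := (@lebesgue_measure R).
Local Notation D := (`[0%R, +oo[%classic : set R).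
Variables (K : R) (g : nat -> R) (N : nat).
Hypothesis K0 : 0 < K.
Hypothesis gN : forall n, (N <= n)%N -> g n = 0.

Let E n : set R := `[n%:R / K, n.+1%:R / K[%classic.

Let indicE n (u : R) : 0 <= u -> \1_(E n) u = (Num.truncn (u * K) == n)%:R :> R.
Proof.
move=> u0; rewrite indicE; congr (_%:R); congr nat_of_bool.
have uK : 0 <= u * K by rewrite mulr_ge0// ltW.
apply/idP/eqP => [|<-].
  rewrite inE /E /= in_itv/= ler_pdivrMr// ltr_pdivlMr// => h.
  exact: truncn_def.
by rewrite inE /E /= in_itv/= ler_pdivrMr// ltr_pdivlMr//; exact: truncn_itv.
Qed.

Let stepE (u : R) : 0 <= u -> g (Num.truncn (u * K)) = \sum_(n < N) g n * \1_(E n) u.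
Proof.
move=> u0; under eq_bigr do rewrite indicE//.
set t := Num.truncn _; have [tN|Nt] := ltnP t N; last first.
  rewrite gN// big1// => i _; rewrite gtn_eqF ?mulr0//.
  exact: leq_trans Nt.
rewrite (bigD1 (Ordinal tN))//= eqxx mulr1 big1 ?addr0// => i it.
by rewrite (_ : (t == i) = false) ?mulr0//; apply/negbTE; rewrite eq_sym.
Qed.

Lemma measurable_step : measurable_fun D (fun u => g (Num.truncn (u * K))).
Proof.
apply: (eq_measurable_fun (fun u => \sum_(n < N) g n * \1_(E n) u)).
  by move=> u; rewrite inE /= in_itv/= andbT => u0; rewrite stepE.
apply: measurable_sum => n; apply: measurable_funM => //.
by apply: measurable_indic; exact: measurable_itv.
Qed.

Hypothesis g0 : forall n, 0 <= g n.

Lemma integral_step :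
  (\int[mu]_(u in D) (g (Num.truncn (u * K)))%:E = (\sum_(n < N) g n / K)%:E)%E.
Proof.
transitivity (\int[mu]_(u in D) (\sum_(n < N) (g n)%:E * (\1_(E n) u)%:E))%E.
  apply: eq_integral => u; rewrite inE /= in_itv/= andbT => u0.
  by rewrite stepE// -sumEFin; apply: eq_bigr => n _; rewrite EFinM.
have mE n : measurable (E n) by exact: measurable_itv.
rewrite ge0_integral_sum//; last 2 first.
- move=> n; apply: emeasurable_funM => //; apply/measurable_EFinP.
  by apply: measurable_indic; exact: mE.
- by move=> n u _; rewrite mule_ge0// lee_fin.
rewrite -sumEFin; apply: eq_bigr => n _.
rewrite ge0_integralZl//; last 2 first.
- by apply/measurable_EFinP; apply: measurable_indic; exact: mE.
- by rewrite lee_fin.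
rewrite integral_indic//; last exact: measurable_itv.
rewrite setIidl; last first.
  move=> u; rewrite /E /= !in_itv/= andbT => /andP[+ _]; apply: le_trans.
  by rewrite divr_ge0// ltW.
have e := @lebesgue_measure_itv R `[n%:R / K, n.+1%:R / K[.
rewrite [X in (_ * X)%E]e/= lte_fin ltr_pM2r ?invr_gt0// ltr_nat ltnSn.
by rewrite -EFinB -mulrBl -natr1 addrAC subrr add0r mul1r -EFinM.
Qed.

End step_functions.

Section wright_moments.
Context {R : realType} (kappa : R).
Hypothesis kappa_gt0 : 0 < kappa.
Hypothesis kappa_lt1 : kappa < 1.
Local Notation mu := (@lebesgue_measure R).
Local Notation D := (`[0%R, +oo[%classic : set R).

Let kappa01 : 0 <= kappa <= 1.
Proof. by rewrite !ltW. Qed.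

Lemma ML_density_ge0 (u : R) : 0 <= u -> 0 <= ML_density kappa u.
Proof.
move=> u0; apply: (cvgr_to_ge (renw_cvg_density kappa_gt0 kappa_lt1 u0)).
by apply: nearW => k; rewrite mulr_ge0 ?powR_ge0 ?renw_ge0.
Qed.

(** The rising factorial (n + 1) ... (n + m): its sum against [renw] is explicit by
    [renw_rising_moment], and scaled by K^m it tends to u^m. *)
Let rise m (n : nat) : R := 'C(n + m, m)%:R * m`!%:R.

Let rise_ge0 m n : 0 <= rise m n.
Proof. by rewrite mulr_ge0. Qed.

Let riseS m n : rise m.+1 n = rise m n * (n + m.+1)%:R.
Proof.
rewrite /rise factS natrM mulrA -natrM.
have -> : ('C(n + m.+1, m.+1) * m.+1 = (n + m.+1) * 'C(n + m, m))%N.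
  by have := mul_bin_diag (n + m.+1) m; rewrite !addnS /= => ->; rewrite mulnC.
by rewrite natrM; ring.
Qed.

(** Time is shifted by one so that the scale is at least 1 for every k. *)
Let K k : R := k.+1%:R `^ kappa.

Let K1 k : 1 <= K k.
Proof.
have k1 : 1 <= k.+1%:R :> R by rewrite ler1n.
by have := ler_powR k1 (ltW kappa_gt0); rewrite powRr0.
Qed.

Let K0 k : 0 < K k. Proof. exact: lt_le_trans (K1 k). Qed.

Let n (u : R) k := Num.truncn (u * K k).

(* Smeared m-th rising moment of the number of jumps by time k + 1, divided by
   (k + 1)^kappa. *)
Let F m k (u : R) : R := rise m (n u k) / K k ^+ m * (K k * renw kappa (n u k) k.+1).

Let FE m k : F m k =
  (fun u => (fun i => rise m i / K k ^+ m * (K k * renw kappa i k.+1)) (Num.truncn (u * K k))).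
Proof. by []. Qed.

Let Fsupp m k i : (k.+2 <= i)%N -> rise m i / K k ^+ m * (K k * renw kappa i k.+1) = 0.
Proof. by move=> ki; rewrite renw_eq0// !mulr0. Qed.

Let F0 m k i : 0 <= rise m i / K k ^+ m * (K k * renw kappa i k.+1).
Proof. by rewrite !mulr_ge0 ?invr_ge0 ?exprn_ge0 ?renw_ge0// ltW. Qed.

Let mF m k : measurable_fun D (F m k).
Proof. by rewrite FE; exact: (measurable_step (K0 k) (@Fsupp m k)). Qed.

Let intF m k : (\int[mu]_(u in D) (F m k u)%:E)%E =
  (m`!%:R * (bcoef (- (kappa * m%:R + 1)) k.+1 * k.+1%:R `^ (1 - (kappa * m%:R + 1))))%:E.
Proof.
rewrite FE (integral_step (K0 k) (@Fsupp m k) (F0 m k)); congr EFin.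
rewrite opprD -(@renw_rising_moment _ kappa m k.+1 k.+2)//.
have KK : K k != 0 by rewrite gt_eqF.
have -> : 1 + (- (kappa * m%:R) - 1) = - (kappa * m%:R) by ring.
rewrite mulr_suml mulr_sumr; apply: eq_bigr => i _.
rewrite powRN powRrM powR_mulrn ?powR_ge0// -/(K k) /rise.
by field; rewrite KK expf_neq0.
Qed.

Let intF_cvg m : ((\int[mu]_(u in D) (F m k u)%:E)%E @[k --> \oo] -->
  (m`!%:R / Gamma (kappa * m%:R + 1))%:E).
Proof.
under eq_fun do rewrite intF.
apply: cvg_EFin; first exact: nearW.
apply: cvgMr.
have h : 0 < kappa * m%:R + 1 by rewrite ltr_wpDl// mulr_ge0// ltW.
have := bcoefN_cvg h; rewrite -cvg_shiftS; exact.
Qed.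

Let KV : (K k)^-1 @[k --> \oo] --> (0 : R).
Proof.
apply/gtr0_cvgV0; first exact: nearW.
have h : (k%:R `^ kappa : R) @[k --> \oo] --> +oo.
  by apply/cvgryPge => A; exact: nbhs_infty_powR_ge.
by move: h; rewrite -cvg_shiftS.
Qed.

Let natK_cvg (u : R) c : 0 <= u -> ((n u k + c)%N%:R / K k) @[k --> \oo] --> u.
Proof.
move=> u0.
apply: (@squeeze_cvgr _ _ _ _ (fun k => u - (K k)^-1) (fun k => u + c%:R * (K k)^-1)).
- near=> k.
  have uK : 0 <= u * K k by rewrite mulr_ge0// ltW.
  have /andP[t1 t2] := truncn_itv uK.
  rewrite ler_pdivlMr// ler_pdivrMr// mulrBl mulrDl mulfVK ?gt_eqF//.
  rewrite mulVf ?gt_eqF// natrD lerD2r t1 andbT.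
  rewrite -natr1 in t2.
  have := ler0n R c; rewrite /n; lra.
- rewrite -[X in _ --> X]subr0; apply: cvgB; first exact: cvg_cst.
  exact: KV.
- rewrite -[X in _ --> X]addr0; apply: cvgD; first exact: cvg_cst.
  by rewrite -[X in _ --> X](mulr0 c%:R); apply: cvgMr; exact: KV.
Unshelve. all: end_near. Qed.

Let riseK_cvg m (u : R) : 0 <= u -> rise m (n u k) / K k ^+ m @[k --> \oo] --> u ^+ m.
Proof.
move=> u0; elim: m => [|m IH].
  rewrite /rise; under eq_fun do rewrite bin0 expr0 divr1 mulr1.
  by rewrite expr0; exact: cvg_cst.
have -> : (fun k => rise m.+1 (n u k) / K k ^+ m.+1) =
    (fun k => rise m (n u k) / K k ^+ m * ((n u k + m.+1)%N%:R / K k)).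
  by apply/funext => k; rewrite riseS exprSr invfM mulrACA.
by rewrite exprSr; apply: cvgM => //; exact: natK_cvg.
Qed.

Let nK_le (u : R) k : 0 <= u -> (n u k)%:R <= u * K k.
Proof. by move=> u0; rewrite truncn_le// mulr_ge0// ltW. Qed.

Let riseK_le m k (u M : R) : 0 <= u <= M -> rise m (n u k) / K k ^+ m <= (M + m%:R) ^+ m.
Proof.
move=> /andP[u0 uM].
have M0 : 0 <= M by exact: le_trans uM.
have h p : (p <= m)%N -> rise p (n u k) / K k ^+ p <= (M + m%:R) ^+ p.
  elim: p => [|p IH] pm.
    by rewrite /rise bin0 !expr0 divr1 mulr1.
  rewrite riseS exprSr invfM mulrACA exprSr.
  apply: ler_pM; rewrite ?divr_ge0 ?exprn_ge0 ?(ltW (K0 k)) ?IH ?(ltnW pm)//.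
  rewrite ler_pdivrMr// natrD mulrDl lerD//.
    by apply: (le_trans (nK_le k u0)); rewrite ler_wpM2r// ltW.
  by apply: (@le_trans _ _ m%:R); rewrite ?ler_nat// ler_peMr.
exact: h.
Qed.

(** Rounding goes in the right direction: u K < n + 1 <= n + m + 1, which is the next factor of the
    rising factorial. Hence moment m + 1 supplies the tail control that [integral_lim_tight] needs
    for moment m. *)
Let F_step m k (u : R) : 0 <= u -> u * F m k u <= F m.+1 k u.
Proof.
move=> u0; rewrite /F mulrA ler_wpM2r//.
  by rewrite mulr_ge0 ?renw_ge0// ltW.
rewrite riseS exprSr invfM mulrACA mulrC ler_wpM2l ?divr_ge0 ?exprn_ge0 ?(ltW (K0 k))//.
rewrite ler_pdivlMr// addnS.
have /andP[_ t2] := truncn_itv (mulr_ge0 u0 (ltW (K0 k))).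
by apply: (le_trans (ltW t2)); rewrite ler_nat ltnS leq_addr.
Qed.

(** The integrals [intF] are exact before the limit and converge by [bcoefN_cvg]; the local limit
    theorem only has to identify the integrand. *)
Lemma ML_density_moment m :
  (\int[mu]_(u in D) (u ^+ m * ML_density kappa u)%:E =
   (m`!%:R / Gamma (kappa * m%:R + 1))%:E)%E.
Proof.
have h := @integral_lim_tight R (F m) (F m.+1) (fun u => u ^+ m * ML_density kappa u) _ _
  (mF m) (mF m.+1).
apply: (h _ _ _ _ _ (@F_step m) (@intF_cvg m) (@intF_cvg m.+1)).
- move=> k u u0; exact: F0.
- move=> u u0; apply: cvgM; first exact: riseK_cvg.
  by have := renw_cvg_density kappa_gt0 kappa_lt1 u0; rewrite -cvg_shiftS.
- move=> M M0; have [C HC] := renw_dominated kappa_gt0 kappa_lt1 (ltW M0).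
  exists ((M + m%:R) ^+ m * C).
  have [N _ HN] := HC; exists N => // k /= Nk u uM.
  apply: ler_pM; rewrite ?divr_ge0 ?exprn_ge0 ?mulr_ge0 ?renw_ge0 ?(ltW (K0 k))//.
    exact: riseK_le.
  by apply: (HN k.+1 _ u uM); rewrite /= ltnW// ltnS.
Qed.

Lemma measurable_ML_density : measurable_fun D (ML_density kappa).
Proof.
apply: (measurable_fun_cvg (mF 0)) => u; rewrite /= in_itv/= andbT => u0.
rewrite -[X in _ --> X]mul1r -[X in X * _](expr0 u).
apply: cvgM; first exact: riseK_cvg.
by have := renw_cvg_density kappa_gt0 kappa_lt1 u0; rewrite -cvg_shiftS.
Qed.

End wright_moments.

(** * Expectations of bounded functions and independence *)

Section bounded_measurable.
Context {R : realType} d (T : measurableType d).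
Implicit Types (f g : T -> R).

(** The class of test functions on which [mean] is linear and monotone without integrability side
    conditions. *)
Definition bmeas f := measurable_fun setT f /\ exists M, forall x, `|f x| <= M.

Lemma bmeas_cst (c : R) : bmeas (fun=> c).
Proof. by split => //; exists `|c|. Qed.

Lemma bmeasD f g : bmeas f -> bmeas g -> bmeas (fun x => f x + g x).
Proof.
move=> [mf [M fM]] [mg [K gK]]; split; first exact: measurable_funD.
by exists (M + K) => x; rewrite (le_trans (ler_normD _ _))// lerD.
Qed.

Lemma bmeasM f g : bmeas f -> bmeas g -> bmeas (fun x => f x * g x).
Proof.
move=> [mf [M fM]] [mg [K gK]]; split; first exact: measurable_funM.
by exists (M * K) => x; rewrite normrM ler_pM.
Qed.

Lemma bmeasN f : bmeas f -> bmeas (fun x => - f x).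
Proof.
move=> bf; rewrite (_ : (fun x => - f x) = (fun x => -1 * f x)).
  by apply: bmeasM => //; exact: bmeas_cst.
by apply/funext => x; rewrite mulN1r.
Qed.

Lemma bmeasB f g : bmeas f -> bmeas g -> bmeas (fun x => f x - g x).
Proof. by move=> bf bg; apply: bmeasD => //; exact: bmeasN. Qed.

Lemma bmeasZ (c : R) f : bmeas f -> bmeas (fun x => c * f x).
Proof. by move=> bf; apply: bmeasM => //; exact: bmeas_cst. Qed.

Lemma bmeas_sum (I : Type) (r : seq I) (F : I -> T -> R) :
  (forall i, bmeas (F i)) -> bmeas (fun x => \sum_(i <- r) F i x).
Proof.
move=> bF; elim: r => [|i r IH].
  by under eq_fun do rewrite big_nil; exact: bmeas_cst.
by under eq_fun do rewrite big_cons; exact: bmeasD.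
Qed.

Lemma bmeas_indic (A : set T) : measurable A -> bmeas (\1_A).
Proof.
move=> mA; split; first exact: measurable_indic.
by exists 1 => x; rewrite indicE; case: (_ \in _); rewrite ?normr1 ?normr0.
Qed.

Lemma bmeas_norm_le f M : measurable_fun setT f -> (forall x, `|f x| <= M) -> bmeas f.
Proof. by move=> mf fM; split => //; exists M. Qed.

End bounded_measurable.

Lemma bmeas_comp {R : realType} d d' (T : measurableType d) (T' : measurableType d')
    (f : T' -> R) (X : T -> T') :
  bmeas f -> measurable_fun setT X -> bmeas (fun x => f (X x)).
Proof. by move=> [mf [M fM]] mX; split; [exact: measurableT_comp|exists M => x]. Qed.

Section trigonometric.
Context {R : realType}.

Lemma bmeas_cos : bmeas (@cos R).
Proof.
apply: (@bmeas_norm_le _ _ _ _ 1) => [|x]; last exact: cos_max.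
by apply: continuous_measurable_fun => x; exact: continuous_cos.
Qed.

Lemma bmeas_sin : bmeas (@sin R).
Proof.
apply: (@bmeas_norm_le _ _ _ _ 1) => [|x]; last exact: sin_max.
by apply: continuous_measurable_fun => x; exact: continuous_sin.
Qed.

Context d (T : measurableType d) (X : T -> R).
Hypothesis mX : measurable_fun setT X.

Lemma bmeas_cosM (s : R) : bmeas (fun x => cos (s * X x)).
Proof. by apply: bmeas_comp bmeas_cos _; apply: measurable_funM. Qed.

Lemma bmeas_sinM (s : R) : bmeas (fun x => sin (s * X x)).
Proof. by apply: bmeas_comp bmeas_sin _; apply: measurable_funM. Qed.

Lemma bmeas_expRN (s : R) : 0 <= s -> (forall x, 0 <= X x) ->
  bmeas (fun x => expR (- (s * X x))).
Proof.
move=> s0 X0; apply: (@bmeas_norm_le _ _ _ _ 1) => [|x].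
  by apply: measurableT_comp => //; apply: measurableT_comp => //; exact: measurable_funM.
by rewrite ger0_norm ?expR_ge0// -expR0 ler_expR oppr_le0 mulr_ge0.
Qed.

End trigonometric.

Section mean.
Context {R : realType} d (T : measurableType d) (P : probability T R).
Implicit Types (f g : T -> R).

Definition mean f : R := Rintegral P setT f.

Lemma bmeas_integrable f : bmeas f -> P.-integrable setT (EFin \o f).
Proof.
move=> [mf [M fM]]; apply: (@integrable_le_cst _ _ _ _ _ _ M) => //.
by rewrite /= probability_setT ltry.
Qed.

Lemma meanE f : bmeas f -> ('E_P[f] = (mean f)%:E)%E.
Proof.
move=> bf; rewrite unlock /mean /Rintegral fineK//.
by apply: integrable_fin_num => //; exact: bmeas_integrable.
Qed.

Lemma integral_mean f : bmeas f -> (\int[P]_x (f x)%:E = (mean f)%:E)%E.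
Proof. by move=> bf; rewrite -meanE// unlock. Qed.

Lemma mean_cst (c : R) : mean (fun=> c) = c.
Proof.
have h := probability_setT P.
by rewrite /mean Rintegral_cst// [X in fine X]h mulr1.
Qed.

Lemma meanD f g : bmeas f -> bmeas g -> mean (fun x => f x + g x) = mean f + mean g.
Proof. by move=> bf bg; apply: RintegralD => //; exact: bmeas_integrable. Qed.

Lemma meanB f g : bmeas f -> bmeas g -> mean (fun x => f x - g x) = mean f - mean g.
Proof. by move=> bf bg; apply: RintegralB => //; exact: bmeas_integrable. Qed.

Lemma meanZ (c : R) f : bmeas f -> mean (fun x => c * f x) = c * mean f.
Proof. by move=> bf; apply: RintegralZl => //; exact: bmeas_integrable. Qed.

Lemma mean_sum (I : Type) (r : seq I) (F : I -> T -> R) : (forall i, bmeas (F i)) ->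
  mean (fun x => \sum_(i <- r) F i x) = \sum_(i <- r) mean (F i).
Proof.
move=> bF; elim: r => [|i r IH].
  by under eq_fun do rewrite big_nil; rewrite mean_cst big_nil.
under eq_fun do rewrite big_cons; rewrite meanD ?IH ?big_cons//.
exact: bmeas_sum.
Qed.

Lemma le_mean f g : bmeas f -> bmeas g -> (forall x, f x <= g x) -> mean f <= mean g.
Proof. by move=> bf bg fg; apply: le_Rintegral => //; exact: bmeas_integrable. Qed.

Lemma mean_le_cst f M : bmeas f -> (forall x, f x <= M) -> mean f <= M.
Proof. by move=> bf fM; rewrite -(mean_cst M); apply: le_mean => //; exact: bmeas_cst. Qed.

Lemma mean_ge0 f : (forall x, 0 <= f x) -> 0 <= mean f.
Proof. by move=> f0; apply: Rintegral_ge0. Qed.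

Lemma norm_mean_le f M : bmeas f -> (forall x, `|f x| <= M) -> `|mean f| <= M.
Proof.
move=> bf fM; rewrite ler_norml; apply/andP; split.
  rewrite -(mean_cst (- M)); apply: le_mean => //; first exact: bmeas_cst.
  by move=> x; have := fM x; rewrite ler_norml => /andP[].
by apply: mean_le_cst => // x; rewrite (le_trans _ (fM x))// ler_norm.
Qed.

Lemma mean_indic (A : set T) : measurable A -> mean \1_A = fine (P A).
Proof. by move=> mA; rewrite /mean /Rintegral integral_indic// setIT. Qed.

Lemma mean_bounded_cvg (F : nat -> T -> R) f (M : R) :
  (forall n, measurable_fun setT (F n)) -> (forall n x, `|F n x| <= M) ->
  (forall x, F n x @[n --> \oo] --> f x) ->
  mean (F n) @[n --> \oo] --> mean f.
Proof.
move=> mF FM Ff.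
have mf : measurable_fun setT f by apply: (measurable_fun_cvg mF) => x _; exact: Ff.
have fM x : `|f x| <= M.
  by apply: (cvgr_to_le (cvg_norm (Ff x))); exact: nearW.
have bf : bmeas f by split => //; exists M.
have [|||||_ _] := @dominated_convergence _ _ _ P setT measurableT
  (fun n => EFin \o F n) (EFin \o f) (EFin \o cst M).
- by move=> n; apply/measurable_EFinP.
- by apply/measurable_EFinP.
- by apply: aeW => x _; apply: cvg_EFin; [exact: nearW|exact: Ff].
- by apply: bmeas_integrable; exact: bmeas_cst.
- by apply: aeW => x n _; rewrite lee_fin.
- by rewrite (integral_mean bf) => h; exact: (fine_cvg h).
Qed.

End mean.

Lemma mean_comp {R : realType} d d' (T : measurableType d) (T' : measurableType d')
    (P : probability T R) (P' : probability T' R) (X : T -> T') (f : T' -> R) :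
  measurable_fun setT X -> (forall A, measurable A -> P (X @^-1` A) = P' A) ->
  bmeas f -> mean P (fun x => f (X x)) = mean P' f.
Proof.
move=> mX PX bf; have [M fM] := bf.2.
(* Adding the bound M makes the function nonnegative, so that the change of variables for
   nonnegative integrands applies. *)
have bfM : bmeas (fun x => f x + M) by apply: bmeasD => //; exact: bmeas_cst.
have f0 x : 0 <= f x + M by have := fM x; rewrite ler_norml; lra.
suff h : mean P (fun x => f (X x) + M) = mean P' (fun x => f x + M).
  move: h; rewrite !meanD ?mean_cst//; first exact: addIr.
  - exact: bmeas_cst.
  - exact: bmeas_comp mX.
  - exact: bmeas_cst.
rewrite /mean /Rintegral; congr fine.
transitivity (\int[pushforward P X]_y (f y + M)%:E)%E.
  rewrite ge0_integral_pushforward//.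
    by apply/measurable_EFinP; exact: bfM.1.
  by move=> y _; rewrite lee_fin.
by apply: eq_measure_integral => A mA _; exact: PX.
Qed.

Section mean_swap.
Context {R : realType} d d' (T : measurableType d) (T' : measurableType d').
Variables (P : probability T R) (Q : probability T' R) (f : T * T' -> R).
Hypothesis bf : bmeas f.

Lemma bmeas_section1 x : bmeas (fun y => f (x, y)).
Proof. by apply: bmeas_comp bf _; exact: measurable_pair1. Qed.

Lemma bmeas_section2 y : bmeas (fun x => f (x, y)).
Proof. by apply: bmeas_comp bf _; exact: measurable_pair2. Qed.

Let intf : (P \x Q)%E.-integrable setT (EFin \o f).
Proof.
have [mf [M fM]] := bf.
apply: (@integrable_le_cst _ _ _ _ _ _ M) => //.
by rewrite /= -setXTT product_measure1E//= !probability_setT mule1 ltry.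
Qed.

Lemma mean_swap :
  mean P (fun x => mean Q (fun y => f (x, y))) = mean Q (fun y => mean P (fun x => f (x, y))).
Proof.
have := Fubini intf; rewrite /mean /Rintegral => h.
transitivity (fine (\int[P]_x \int[Q]_y (f (x, y))%:E)%E).
  congr fine; apply: eq_integral => x _.
  by rewrite fineK// integral_mean//; exact: bmeas_section1.
transitivity (fine (\int[Q]_y \int[P]_x (f (x, y))%:E)%E); first by congr fine.
congr fine; apply: eq_integral => y _.
by rewrite fineK// integral_mean//; exact: bmeas_section2.
Qed.

Lemma bmeas_mean2 : bmeas (fun x => mean Q (fun y => f (x, y))).
Proof.
have [mf [M fM]] := bf.
apply: (@bmeas_norm_le _ _ _ _ M) => [|x].
  apply/measurable_EFinP; have := measurable_fubini_F intf.
  apply: eq_measurable_fun => x _ /=.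
  by rewrite /fubini_F integral_mean//; exact: bmeas_section1.
by apply: norm_mean_le => //; exact: bmeas_section1.
Qed.

Lemma mean_prod : mean (P \x Q)%E f = mean P (fun x => mean Q (fun y => f (x, y))).
Proof.
rewrite /mean /Rintegral -integral12_prod_meas1//; congr fine.
apply: eq_integral => x _; rewrite fineK// integral_mean//.
exact: bmeas_section1.
Qed.

End mean_swap.

Section integral_functional.
Context {R : realType} d' (T' : measurableType d').
Implicit Types (L : (T' -> R) -> R) (v : T' -> R).

(** What integration against a law, possibly with a bounded weight, has in common with integration
    against a density. Agreement on indicators then extends to all bounded measurable functions,
    once for independence and for densities. *)
Definition integral_functional L :=
  [/\ forall u v, bmeas u -> bmeas v -> L (fun y => u y + v y) = L u + L v,
      forall (a : R) v, bmeas v -> L (fun y => a * v y) = a * L v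
    & forall (F : nat -> T' -> R) v, (forall n, bmeas (F n)) ->
        (forall n y, 0 <= F n y <= 1) -> (forall y, F n y @[n --> \oo] --> v y) ->
        L (F n) @[n --> \oo] --> L v].

Variables (L1 L2 : (T' -> R) -> R).
Hypothesis hL1 : integral_functional L1.
Hypothesis hL2 : integral_functional L2.
Hypothesis L12 : forall A, measurable A -> L1 \1_A = L2 \1_A.

Let functional_sum L n (F : 'I_n -> T' -> R) : integral_functional L ->
  (forall i, bmeas (F i)) -> L (fun y => \sum_i F i y) = \sum_i L (F i).
Proof.
move=> [LD LZ _] bF; elim: (index_enum _) => [|i r IH].
  under eq_fun do rewrite big_nil; rewrite big_nil.
  have := LZ 0 _ (bmeas_cst _ 0); under eq_fun do rewrite mul0r.
  by rewrite mul0r.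
under eq_fun do rewrite big_cons; rewrite LD ?IH ?big_cons//.
exact: bmeas_sum.
Qed.

Let functional_eq01 (v : T' -> R) : measurable_fun setT v -> (forall y, 0 <= v y <= 1) ->
  L1 v = L2 v.
Proof.
move=> mv v01.
pose A n k : set T' := [set y | k.+1%:R / n.+1%:R <= v y].
have mA n k : measurable (A n k).
  have := mv measurableT `[k.+1%:R / n.+1%:R, +oo[%classic (measurable_itv _).
  rewrite setTI (_ : _ @^-1` _ = A n k)//.
  by apply/seteqP; split => y; rewrite /A /= in_itv/= andbT.
(* Layer-cake approximation: the number of levels (k + 1) / (n + 1) below v y is the integer part of
   (n + 1) v y, so [vn] is within 1 / (n + 1) of v and is a combination of indicators. *)
pose vn n y : R := n.+1%:R^-1 * \sum_(k < n.+1) \1_(A n k) y.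
have vnE n y : vn n y = (Num.truncn (v y * n.+1%:R))%:R / n.+1%:R.
  have /andP[v0 v1] := v01 y.
  rewrite /vn mulrC; congr (_ / _).
  have vn0 : 0 <= v y * n.+1%:R by rewrite mulr_ge0.
  have tn : (Num.truncn (v y * n.+1%:R) <= n.+1)%N.
    rewrite -(ler_nat R); apply: (@le_trans _ _ (v y * n.+1%:R)); first by rewrite truncn_le.
    by rewrite ler_piMl.
  under eq_bigr => k _.
    rewrite indicE (_ : (y \in A n k) = (k < Num.truncn (v y * n.+1%:R))%N); last first.
      rewrite truncn_ge_nat// -ler_pdivrMr//.
      by apply/idP/idP; rewrite inE.
    over.
  rewrite -(big_mkord xpredT (fun k => (k < Num.truncn (v y * n.+1%:R))%:R)).
  rewrite -natr_sum; congr (_%:R).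
  rewrite (big_cat_nat _ tn)//= [X in (_ + X)%N]big1_seq ?addn0; last first.
    by move=> i /=; rewrite mem_index_iota => /andP[ti _]; rewrite ltnNge ti.
  rewrite (eq_big_nat _ _ (F2 := fun=> 1%N)) ?sum_nat_const_nat ?subn0 ?muln1//.
  by move=> i /andP[_ ->].
have vn01 n y : 0 <= vn n y <= v y.
  have /andP[v0 v1] := v01 y.
  by rewrite vnE divr_ge0//= ler_pdivrMr// truncn_le mulr_ge0.
have bvn n : bmeas (vn n).
  by apply: bmeasZ; apply: bmeas_sum => k; apply: bmeas_indic.
have vn_cvg y : vn n y @[n --> \oo] --> v y.
  have /andP[v0 v1] := v01 y.
  apply: (@squeeze_cvgr _ _ _ _ (fun n => v y - n.+1%:R^-1) (fun=> v y)).
  - near=> n; have /andP[_ ->] := vn01 n y; rewrite andbT vnE.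
    rewrite ler_pdivlMr// mulrBl mulVf// lerBlDr natr1 ltW//.
    by have /andP[_] := truncn_itv (mulr_ge0 v0 (ler0n R n.+1)).
  - rewrite -[X in _ --> X]subr0; apply: cvgB; [exact: cvg_cst|exact: cvg_harmonic].
  - exact: cvg_cst.
have e n : L1 (vn n) = L2 (vn n).
  have [_ L1Z _] := hL1; have [_ L2Z _] := hL2.
  have bA k : bmeas (\1_(A n k) : T' -> R) by exact: bmeas_indic.
  rewrite /vn L1Z ?L2Z; [|exact: bmeas_sum..].
  rewrite !functional_sum//; congr (_ * _).
  by apply: eq_bigr => k _; exact: L12.
have vn1 n y : 0 <= vn n y <= 1.
  by have /andP[-> /le_trans->//] := vn01 n y; have /andP[] := v01 y.
have [_ _ /(_ _ v bvn vn1 vn_cvg) l1] := hL1.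
have [_ _ /(_ _ v bvn vn1 vn_cvg) l2] := hL2.
by move: l1; under eq_fun do rewrite e; move=> l1; exact: (cvg_unique _ l1 l2).
Unshelve. all: end_near. Qed.

Lemma integral_functional_eq (v : T' -> R) : bmeas v -> L1 v = L2 v.
Proof.
move=> bv; have [mv [M vM]] := bv.
pose K : R := `|M| + 1; have K0 : 0 < K by rewrite ltr_wpDl.
have vK y : - K <= v y <= K.
  rewrite -ler_norml (le_trans (vM y))// (le_trans (ler_norm M))//.
  by rewrite lerDl.
pose v' y : R := (2 * K)^-1 * (v y + K).
have v01 y : 0 <= v' y <= 1.
  have /andP[v1 v2] := vK y.
  rewrite /v' mulrC divr_ge0 ?mulr_ge0 ?(ltW K0)//=; last lra.
  by rewrite ler_pdivrMr ?mulr_gt0//; lra.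
have mv' : measurable_fun setT v'.
  by apply: measurable_funM => //; exact: measurable_funD.
have b1 : bmeas (\1_setT : T' -> R) by exact: bmeas_indic.
have bv' : bmeas v' by apply: bmeasZ; apply: bmeasD => //; exact: bmeas_cst.
have -> : v = (fun y => 2 * K * v' y + - K * \1_setT y).
  apply/funext => y; rewrite /v' mulrA mulfV ?gt_eqF ?mulr_gt0// mul1r.
  by rewrite indicT mulr1 addrK.
have [D1 Z1 _] := hL1; have [D2 Z2 _] := hL2.
rewrite D1 ?D2; [|exact: bmeasZ..].
rewrite (Z1 _ v')// (Z2 _ v')// (Z1 _ \1_setT)// (Z2 _ \1_setT)//.
by rewrite (functional_eq01 mv' v01) L12.
Qed.

End integral_functional.

Lemma integral_functional_mean {R : realType} d d' (T : measurableType d)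
    (T' : measurableType d') (P : probability T R) (X : T -> T') (G : T -> R) :
  measurable_fun setT X -> bmeas G ->
  integral_functional (fun v => mean P (fun w => G w * v (X w))).
Proof.
move=> mX bG.
have bGX v : bmeas v -> bmeas (fun w => G w * v (X w)).
  by move=> bv; apply: bmeasM => //; exact: bmeas_comp mX.
split => [u v bu bv|a v bv|F v bF F01 Fv].
- by under eq_fun do rewrite mulrDr; rewrite meanD//; exact: bGX.
- by under eq_fun do rewrite mulrCA; rewrite meanZ//; exact: bGX.
- have [mG [K GK]] := bG.
  apply: (@mean_bounded_cvg _ _ _ _ _ _ K).
  + by move=> n; exact: (bGX _ (bF n)).1.
  + move=> n x; rewrite normrM -[leRHS]mulr1 ler_pM//.
    by have /andP[h0 h1] := F01 n (X x); rewrite ger0_norm.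
  + by move=> x; apply: cvgMr; exact: Fv.
Qed.

(** With the weight G held fixed, both sides are integral functionals of v. Independence for
    functions follows from independence for events by freeing one variable at a time. *)
Lemma mean_factor {R : realType} d d' (T : measurableType d) (T' : measurableType d')
    (P : probability T R) (X : T -> T') (G : T -> R) (c : R) (v : T' -> R) :
  measurable_fun setT X -> bmeas G ->
  (forall A, measurable A ->
    mean P (fun w => G w * \1_A (X w)) = c * mean P (fun w => \1_A (X w))) ->
  bmeas v -> mean P (fun w => G w * v (X w)) = c * mean P (fun w => v (X w)).
Proof.
move=> mX bG GX bv.
have hc := integral_functional_mean P mX (bmeas_cst T c).
transitivity (mean P (fun w => c * v (X w))); last first.
  by rewrite meanZ//; exact: bmeas_comp mX.
apply: (integral_functional_eq (integral_functional_mean P mX bG) hc) => //.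
by move=> A mA; rewrite GX// meanZ//; apply: bmeas_comp mX; exact: bmeas_indic.
Qed.

Lemma mean_indep {R : realType} d d1 d2 (T : measurableType d) (T1 : measurableType d1)
    (T2 : measurableType d2) (P : probability T R) (X : T -> T1) (Y : T -> T2)
    (u : T1 -> R) (v : T2 -> R) :
  measurable_fun setT X -> measurable_fun setT Y ->
  indep P (sigma_rv X) (sigma_rv Y) -> bmeas u -> bmeas v ->
  mean P (fun w => u (X w) * v (Y w)) = mean P (fun w => u (X w)) * mean P (fun w => v (Y w)).
Proof.
move=> mX mY XY bu bv.
apply: mean_factor => // [|A mA]; first exact: bmeas_comp mX.
transitivity (mean P (fun w => \1_A (Y w) * u (X w))).
  by congr mean; apply/funext => w; rewrite mulrC.
rewrite mulrC; apply: mean_factor => // [|B mB].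
  by apply: bmeas_comp mY; exact: bmeas_indic.
have mAY : measurable (Y @^-1` A) by rewrite -[X in measurable X]setTI; exact: mY.
have mBX : measurable (X @^-1` B) by rewrite -[X in measurable X]setTI; exact: mX.
transitivity (mean P \1_(X @^-1` B `&` Y @^-1` A)).
  by congr mean; apply/funext => w; rewrite indicI mulrC.
rewrite mean_indic; last exact: measurableI.
rewrite XY; last 2 first.
- by exists B => //; rewrite setTI.
- by exists A => //; rewrite setTI.
by rewrite fineM ?fin_num_measure// -!mean_indic// mulrC.
Qed.

Section mutually_independent.
Context {R : realType} d d' (T : measurableType d) (T' : measurableType d').
Variables (P : probability T R) (X : nat -> T -> T').
Hypothesis mX : forall i, measurable_fun setT (X i).
Hypothesis indX : mutually_indep P X.

Let mean_prod_indic n (A : nat -> set T') : (forall i, measurable (A i)) ->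
  mean P (fun w => \prod_(i < n) \1_(A i) (X i w)) =
  \prod_(i < n) mean P (fun w => \1_(A i) (X i w)).
Proof.
move=> mA; pose E i := X i @^-1` A i.
have mE i : measurable (E i) by rewrite -[X in measurable X]setTI; exact: mX.
pose J := [fset i in iota 0 n]%fset.
have JE : perm_eq J (iota 0 n).
  by apply: uniq_perm; rewrite ?fset_uniq ?iota_uniq// => i; rewrite !inE.
have := indX (J := J) (E := E) (fun i _ => ex_intro2 _ _ (A i) (mA i) (setTI _)).
rewrite (perm_big _ JE)/= => h.
transitivity (fine (P (\bigcap_(i in [set` J]) E i))).
  rewrite -mean_indic; last by apply: fin_bigcap_measurable => //; exact: finite_fset.
  congr mean; apply/funext => w; rewrite indicE.
  have [wJ|wJ] := boolP (w \in _).
    rewrite big1// => i _; rewrite indicE mem_set//.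
    by move/set_mem : wJ; apply; rewrite /= !inE mem_iota/=.
  move/negP : wJ; rewrite inE => /existsNP[i /not_implyP[iJ niE]].
  have iN : (i < n)%N by move: iJ; rewrite /= !inE mem_iota.
  by rewrite (bigD1 (Ordinal iN))//= indicE memNset ?mul0r.
rewrite h; have -> : iota 0 n = index_iota 0 n by rewrite /index_iota subn0.
rewrite (eq_bigr (fun i => (mean P (fun w => \1_(A i) (X i w)))%:E)); last first.
  by move=> i _; rewrite -[P _]fineK ?fin_num_measure// -mean_indic.
by rewrite prodEFin/= big_mkord.
Qed.

Lemma mean_prod_indep n (v : nat -> T' -> R) : (forall i, bmeas (v i)) ->
  mean P (fun w => \prod_(i < n) v i (X i w)) = \prod_(i < n) mean P (fun w => v i (X i w)).
Proof.
(* Indicators are replaced by general functions one factor at a time; from index k on the factors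
   are still indicators. *)
suff h k : (k <= n)%N -> forall v : nat -> T' -> R, (forall i, bmeas (v i)) ->
   (forall i, (k <= i)%N -> exists2 A, measurable A & v i = \1_A) ->
   mean P (fun w => \prod_(i < n) v i (X i w)) = \prod_(i < n) mean P (fun w => v i (X i w)).
  move=> bv; pose v' i := if (i < n)%N then v i else \1_setT.
  have e (i : 'I_n) : v i = v' i by rewrite /v' ltn_ord.
  transitivity (mean P (fun w => \prod_(i < n) v' i (X i w))).
    by congr mean; apply/funext => w; apply: eq_bigr => i _; rewrite e.
  rewrite (h n)//; first by apply: eq_bigr => i _; rewrite e.
    by move=> i; rewrite /v'; case: ifP => // _; exact: bmeas_indic.
  by move=> i ni; exists setT => //; rewrite /v' ltnNge ni.
elim: k => [_ {}v bv vA|k IH kn {}v bv vA].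
  have /choice[A HA] : forall i, exists A, measurable A /\ v i = \1_A.
    by move=> i; have [A mA ->] := vA i (leq0n _); exists A.
  have -> : v = (fun i => \1_(A i)) by apply/funext => i; exact: (HA i).2.
  by apply: mean_prod_indic => i; exact: (HA i).1.
pose o := Ordinal kn.
transitivity (mean P (fun w => (\prod_(i < n | i != o) v i (X i w)) * v k (X k w))).
  by congr mean; apply/funext => w; rewrite (bigD1 o)//= mulrC.
rewrite [RHS](bigD1 o)//= mulrC; apply: (mean_factor (mX k)) => //.
  rewrite (_ : (fun w => _) = (fun w => \prod_(i <- index_enum 'I_n)
    (if i != o then v i (X i w) else 1))); last by apply/funext => w; rewrite big_mkcond.
  elim: (index_enum _) => [|i r IHr].
    by under eq_fun do rewrite big_nil; exact: bmeas_cst.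
  under eq_fun do rewrite big_cons; apply: bmeasM => //.
  by case: (i != o); [exact: bmeas_comp (mX i)|exact: bmeas_cst].
move=> A mA; pose v' i := if i == k then \1_A else v i.
have := IH (ltnW kn) v'; move=> /(_ _ _)/wrap[].
  by move=> i; rewrite /v'; case: ifP => // _; exact: bmeas_indic.
  move=> i ki; rewrite /v'; have [//|ik] := eqVneq i k; first by exists A.
  by apply: vA; rewrite ltn_neqAle eq_sym ik.
rewrite (bigD1 o)//= [in RHS]/v' eqxx => h.
rewrite [RHS]mulrC.
transitivity (mean P (fun w => \prod_(i < n) v' i (X i w))).
  congr mean; apply/funext => w.
  rewrite [RHS](bigD1 o)//= [v' k]/v' eqxx [RHS]mulrC; congr (_ * _).
  by apply: eq_bigr => i io; rewrite /v' (_ : (val i == k) = false)//; exact: negbTE.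
rewrite h; congr (_ * _); apply: eq_bigr => i io.
by rewrite (_ : (val i == k) = false)//; exact: negbTE.
Qed.

End mutually_independent.

Lemma eq_dist_mean {R : realType} d d1 d2 (T : measurableType d) (T1 : measurableType d1)
    (T' : measurableType d2) (P : probability T R) (P1 : probability T1 R)
    (X : T -> T') (X1 : T1 -> T') (f : T' -> R) :
  measurable_fun setT X -> measurable_fun setT X1 -> eq_dist P X P1 X1 -> bmeas f ->
  mean P (fun w => f (X w)) = mean P1 (fun w => f (X1 w)).
Proof.
move=> mX mX1 XX1 bf.
pose Xrv : {RV P1 >-> T'} := @mfun_Sub _ _ _ _ X1 (mem_set mX1).
rewrite (mean_comp (P' := distribution P1 Xrv) mX)//; apply/esym.
by rewrite (mean_comp (P' := distribution P1 Xrv) mX1).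
Qed.

(** * Characteristic functions of sums of independent variables *)

Section characteristic_function_of_sum.
Context {R : realType} d (T : measurableType d) (P : probability T R).
Variables (X : nat -> T -> R) (s : R).
Hypothesis mX : forall i, measurable_fun setT (X i).
Hypothesis iidX : iid P X.

Let S n w := \sum_(i < n) X i w.
Let c n := mean P (fun w => cos (s * S n w)).
Let e n := mean P (fun w => sin (s * S n w)).

Let mS n : measurable_fun setT (S n).
Proof. exact: measurable_sum. Qed.

(** A strengthened induction hypothesis standing in for the independence of S_k from the later
    variables. Only cosine and sine of S_k have to factor out, and the addition formulas keep the
    family closed. *)
Let tails := fun k => forall m (v : nat -> R -> R), (forall i, bmeas (v i)) ->
  mean P (fun w => cos (s * S k w) * \prod_(i < m) v i (X (k + i)%N w)) =
    c k * \prod_(i < m) mean P (fun w => v i (X (k + i)%N w)) /\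
  mean P (fun w => sin (s * S k w) * \prod_(i < m) v i (X (k + i)%N w)) =
    e k * \prod_(i < m) mean P (fun w => v i (X (k + i)%N w)).

Let cos1 := mean P (fun w => cos (s * X 0%N w)).
Let sin1 := mean P (fun w => sin (s * X 0%N w)).

Let cosE k : mean P (fun w => cos (s * X k w)) = cos1.
Proof.
have bc : bmeas (fun x : R => cos (s * x)) by exact: bmeas_cosM.
exact: (eq_dist_mean (mX k) (mX 0) (iidX.2 k) bc).
Qed.

Let sinE k : mean P (fun w => sin (s * X k w)) = sin1.
Proof.
have bc : bmeas (fun x : R => sin (s * x)) by exact: bmeas_sinM.
exact: (eq_dist_mean (mX k) (mX 0) (iidX.2 k) bc).
Qed.

Let bprod k m (v : nat -> R -> R) : (forall i, bmeas (v i)) ->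
  bmeas (fun w => \prod_(i < m) v i (X (k + i)%N w)).
Proof.
move=> bv; elim: (index_enum _) => [|i r IHr].
  by under eq_fun do rewrite big_nil; exact: bmeas_cst.
under eq_fun do rewrite big_cons; apply: bmeasM => //.
exact: bmeas_comp (mX _).
Qed.

Let tails0 : tails 0%N.
Proof.
move=> m v bv; have SE w : s * S 0 w = 0 by rewrite /S big_ord0 mulr0.
rewrite /c /e; split; under eq_fun do rewrite SE ?cos0 ?sin0 ?mul0r ?mul1r;
  under [in RHS]eq_fun do rewrite SE ?cos0 ?sin0; rewrite !mean_cst ?mul0r ?mul1r//.
exact: mean_prod_indep iidX.1 _ _ bv.
Qed.

(** The cosine or sine of s X_k is absorbed as the first of m + 1 test functions, so the hypothesis
    at k covers each of the four products in the addition formulas. *)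
Let tailsS k : tails k ->
  (forall m (v : nat -> R -> R), (forall i, bmeas (v i)) ->
  mean P (fun w => cos (s * S k.+1 w) * \prod_(i < m) v i (X (k.+1 + i)%N w)) =
    (c k * cos1 - e k * sin1) * \prod_(i < m) mean P (fun w => v i (X (k.+1 + i)%N w)) /\
  mean P (fun w => sin (s * S k.+1 w) * \prod_(i < m) v i (X (k.+1 + i)%N w)) =
    (e k * cos1 + c k * sin1) * \prod_(i < m) mean P (fun w => v i (X (k.+1 + i)%N w))).
Proof.
move=> IH m v bv.
pose vc i : R -> R := if i is j.+1 then v j else fun x => cos (s * x).
pose vs i : R -> R := if i is j.+1 then v j else fun x => sin (s * x).
have bvc i : bmeas (vc i) by case: i => //=; exact: bmeas_cosM.
have bvs i : bmeas (vs i) by case: i => //=; exact: bmeas_sinM.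
have kE (i : 'I_m) : (k + lift ord0 i = k.+1 + i)%N by rewrite /= /bump/= add1n addnS.
have pc w : \prod_(i < m.+1) vc i (X (k + i)%N w) =
    cos (s * X k w) * \prod_(i < m) v i (X (k.+1 + i)%N w).
  by rewrite big_ord_recl /= addn0; congr (_ * _); apply: eq_bigr => i _; rewrite kE.
have ps w : \prod_(i < m.+1) vs i (X (k + i)%N w) =
    sin (s * X k w) * \prod_(i < m) v i (X (k.+1 + i)%N w).
  by rewrite big_ord_recl /= addn0; congr (_ * _); apply: eq_bigr => i _; rewrite kE.
have qc : \prod_(i < m.+1) mean P (fun w => vc i (X (k + i)%N w)) =
    cos1 * \prod_(i < m) mean P (fun w => v i (X (k.+1 + i)%N w)).
  by rewrite big_ord_recl /= addn0 cosE; congr (_ * _); apply: eq_bigr => i _; rewrite kE.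
have qs : \prod_(i < m.+1) mean P (fun w => vs i (X (k + i)%N w)) =
    sin1 * \prod_(i < m) mean P (fun w => v i (X (k.+1 + i)%N w)).
  by rewrite big_ord_recl /= addn0 sinE; congr (_ * _); apply: eq_bigr => i _; rewrite kE.
have [cc sc] := IH m.+1 _ bvc; have [cs ss] := IH m.+1 _ bvs.
move: cc sc cs ss; rewrite qc qs.
under eq_fun do rewrite pc; move=> cc.
under eq_fun do rewrite pc; move=> sc.
under eq_fun do rewrite ps; move=> cs.
under eq_fun do rewrite ps; move=> ss.
have SS w : s * S k.+1 w = s * S k w + s * X k w by rewrite /S big_ord_recr /= mulrDr.
have bc := bmeas_cosM (mS k) s; have bs := bmeas_sinM (mS k) s.
have bcX := bmeas_cosM (mX k) s; have bsX := bmeas_sinM (mX k) s.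
have bp := bprod k.+1 m bv.
split.
  transitivity (mean P (fun w =>
     cos (s * S k w) * (cos (s * X k w) * \prod_(i < m) v i (X (k.+1 + i)%N w)) -
     sin (s * S k w) * (sin (s * X k w) * \prod_(i < m) v i (X (k.+1 + i)%N w)))).
    by congr mean; apply/funext => w; rewrite SS cosD; ring.
  rewrite meanB; [|by apply: bmeasM => //; exact: bmeasM..].
  by rewrite cc ss; ring.
transitivity (mean P (fun w =>
   sin (s * S k w) * (cos (s * X k w) * \prod_(i < m) v i (X (k.+1 + i)%N w)) +
   cos (s * S k w) * (sin (s * X k w) * \prod_(i < m) v i (X (k.+1 + i)%N w)))).
  by congr mean; apply/funext => w; rewrite SS sinD; ring.
rewrite meanD; [|by apply: bmeasM => //; exact: bmeasM..].
by rewrite sc cs; ring.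
Qed.

Let rec0 k : tails k -> c k.+1 = c k * cos1 - e k * sin1 /\ e k.+1 = e k * cos1 + c k * sin1.
Proof.
move=> /tailsS h.
have b (i : nat) : bmeas (fun _ : R => 0 : R) by exact: bmeas_cst.
have := h 0%N _ b; rewrite !big_ord0 !mulr1.
by under eq_fun do rewrite mulr1; under [X in _ /\ mean P X = _]eq_fun do rewrite mulr1.
Qed.

Let tails_all k : tails k.
Proof.
elim: k => [//|k IH] m v bv; have [-> ->] := rec0 IH.
exact: tailsS.
Qed.

Lemma mean_cos_sumS k : mean P (fun w => cos (s * S k.+1 w)) =
  mean P (fun w => cos (s * S k w)) * mean P (fun w => cos (s * X 0%N w)) -
  mean P (fun w => sin (s * S k w)) * mean P (fun w => sin (s * X 0%N w)).
Proof. exact: (rec0 (tails_all k)).1. Qed.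

Lemma mean_sin_sumS k : mean P (fun w => sin (s * S k.+1 w)) =
  mean P (fun w => sin (s * S k w)) * mean P (fun w => cos (s * X 0%N w)) +
  mean P (fun w => cos (s * S k w)) * mean P (fun w => sin (s * X 0%N w)).
Proof. exact: (rec0 (tails_all k)).2. Qed.

(* The recursion replaces complex powers: (cos, sin) is compared with (psi^n, 0). *)
Lemma char_sum_approx (psi eta : R) n : 0 <= psi < 1 ->
  `|mean P (fun w => cos (s * X 0%N w)) - psi| <= eta ->
  `|mean P (fun w => sin (s * X 0%N w))| <= eta ->
  `|mean P (fun w => cos (s * S n w)) - psi ^+ n| +
  `|mean P (fun w => sin (s * S n w))| <= 4 * eta / (1 - psi).
Proof.
move=> /andP[psi0 psi1] hc hs.
have eta0 : 0 <= eta by exact: le_trans hs.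
have p1 : 0 < 1 - psi by rewrite subr_gt0.
have B0 : 0 <= 4 * eta / (1 - psi) by rewrite divr_ge0 ?mulr_ge0// ltW.
elim: n => [|n IH].
  have SE w : s * S 0 w = 0 by rewrite /S big_ord0 mulr0.
  under eq_fun do rewrite SE cos0; under [X in _ + `|mean P X|]eq_fun do rewrite SE sin0.
  by rewrite !mean_cst expr0 subrr normr0 addr0.
rewrite mean_cos_sumS mean_sin_sumS -/(c n) -/(e n) -/cos1 -/sin1 in IH hc hs *.
have c1 : `|c n| <= 1 by apply: norm_mean_le; [exact: bmeas_cosM|move=> w; exact: cos_max].
have e1 : `|e n| <= 1 by apply: norm_mean_le; [exact: bmeas_sinM|move=> w; exact: sin_max].
set A := c n - psi ^+ n; set z := cos1 - psi.
have -> : c n * cos1 - e n * sin1 - psi ^+ n.+1 = A * psi + c n * z - e n * sin1.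
  by rewrite /A /z exprS; ring.
have -> : e n * cos1 + c n * sin1 = e n * psi + e n * z + c n * sin1 by rewrite /z; ring.
have t1 : `|A * psi + c n * z - e n * sin1| <= `|A| * psi + `|c n| * eta + `|e n| * eta.
  apply: (le_trans (ler_normB _ _)); rewrite (normrM (e n)) lerD ?ler_wpM2l//.
  apply: (le_trans (ler_normD _ _)); rewrite !normrM (ger0_norm psi0) lerD ?ler_wpM2l//.
have t2 : `|e n * psi + e n * z + c n * sin1| <= `|e n| * psi + `|e n| * eta + `|c n| * eta.
  apply: (le_trans (ler_normD _ _)); rewrite (normrM (c n)) lerD ?ler_wpM2l//.
  apply: (le_trans (ler_normD _ _)); rewrite !normrM (ger0_norm psi0) lerD ?ler_wpM2l//.
apply: (le_trans (lerD t1 t2)).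
set B := 4 * eta / (1 - psi) in IH B0 *.
(* [B] is the fixed point of the error recursion: one step multiplies the error by psi and adds at
   most 2 eta in the cosine part and 2 eta in the sine part. *)
have BE : B = psi * B + 4 * eta by rewrite /B; field; rewrite gt_eqF.
have Ae : (`|A| + `|e n|) * psi <= B * psi by rewrite ler_wpM2r.
have ce : `|c n| * eta <= eta by rewrite ler_piMl.
have ee : `|e n| * eta <= eta by rewrite ler_piMl.
by rewrite mulrDl in Ae; rewrite BE; lra.
Qed.

End characteristic_function_of_sum.

(** * Mittag-Leffler laws *)

Section density.
Context {R : realType} d (T : measurableType d) (mu : {measure set T -> \bar R}).
Variable g : T -> R.
Hypothesis g0 : forall x, 0 <= g x.
Hypothesis mg : measurable_fun setT g.

(* The hypotheses on g are arguments so that the measure instance below can be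
   inferred from the term. *)
Definition density_measure of (forall x, 0 <= g x) & measurable_fun setT g :=
  fun A : set T => (\int[mu]_(x in A) (g x)%:E)%E.

Local Notation nu := (density_measure g0 mg).

Let nu0 : nu set0 = 0%E. Proof. exact: integral_set0. Qed.

Let nu_ge0 A : (0 <= nu A)%E.
Proof. by apply: integral_ge0 => x _; rewrite lee_fin. Qed.

Let nu_sigma_additive : semi_sigma_additive nu.
Proof.
move=> A mA tA mUA; rewrite /density_measure ge0_integral_bigcup//; last 2 first.
- by apply/measurable_EFinP; exact: measurable_funTS.
- by move=> x _; rewrite lee_fin.
by apply: is_cvg_nneseries => n _ _; exact: nu_ge0.
Qed.

HB.instance Definition _ := isMeasure.Build _ _ _ nu nu0 nu_ge0 nu_sigma_additive.

Lemma density_probability : (\int[mu]_x (g x)%:E = 1)%E ->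
  exists Q : probability T R, forall A, Q A = (\int[mu]_(x in A) (g x)%:E)%E.
Proof.
move=> g1; pose hQ := Measure_isProbability.Build _ _ R nu g1.
pose Q : probability T R := HB.pack nu hQ.
by exists Q.
Qed.

(** Both sides are integral functionals of h that agree on indicators; dominated convergence on the
    right uses g itself as the bound. *)
Lemma density_mean (Q : probability T R) (h : T -> R) :
  (forall A, measurable A -> Q A = (\int[mu]_(x in A) (g x)%:E)%E) -> bmeas h ->
  mean Q h = Rintegral mu setT (fun x => h x * g x).
Proof.
move=> Qg bh.
have ig : mu.-integrable setT (EFin \o g).
  apply/integrableP; split; first exact/measurable_EFinP.
  under eq_integral do rewrite /= ger0_norm//.
  by rewrite -Qg// probability_setT ltry.
have igv v : bmeas v -> mu.-integrable setT (EFin \o (fun x => v x * g x)).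
  move=> [mv [M vM]].
  apply: (@le_integrable _ _ _ mu _ _ _ (EFin \o (fun x => M * g x))) => //.
  - by apply/measurable_EFinP; exact: measurable_funM.
  - move=> x _ /=; rewrite lee_fin normrM (ger0_norm (g0 x)).
    by rewrite (le_trans (ler_wpM2r (g0 x) (vM x)))// ler_norm.
  - rewrite (_ : _ \o _ = (fun x => M%:E * (g x)%:E)%E); first exact: integrableZl.
    by apply/funext => x /=; rewrite EFinM.
have h1 := integral_functional_mean Q (@measurable_id _ _ setT) (bmeas_cst T 1).
have h2 : integral_functional (fun v => Rintegral mu setT (fun x => v x * g x)).
  split => [u v bu bv|a v bv|F v bF F01 Fv].
  - by under eq_Rintegral do rewrite mulrDl; rewrite RintegralD//; exact: igv.
  - by under eq_Rintegral do rewrite -mulrA; rewrite RintegralZl//; exact: igv.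
  - have mv : measurable_fun setT v.
      by apply: (measurable_fun_cvg (fun n => (bF n).1)) => x _; exact: Fv.
    have [|||||iv _] := @dominated_convergence _ _ _ mu setT measurableT
        (fun n => EFin \o (fun x => F n x * g x)) (EFin \o (fun x => v x * g x)) (EFin \o g).
    + by move=> n; apply/measurable_EFinP; apply: measurable_funM => //; exact: (bF n).1.
    + by apply/measurable_EFinP; exact: measurable_funM.
    + apply: aeW => x _; apply: cvg_EFin; first exact: nearW.
      by apply: cvgM; [exact: Fv|exact: cvg_cst].
    + exact: ig.
    + apply: aeW => x n _ /=; have /andP[F0 F1] := F01 n x.
      by rewrite lee_fin normrM (ger0_norm (g0 x)) ger0_norm// ler_piMl.
    + move=> lim; have fin : (\int[mu]_x (v x * g x)%:E)%E \is a fin_num.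
        exact: (integrable_fin_num measurableT iv).
      by rewrite -(fineK fin) in lim; exact: (fine_cvg lim).
have := integral_functional_eq h1 h2.
move=> /(_ _ h bh) <- => [|A mA].
  by congr mean; apply/funext => x; rewrite mul1r.
under eq_fun do rewrite mul1r; rewrite mean_indic// Qg// /Rintegral; congr fine.
rewrite integral_mkcond; apply: eq_integral => x _.
by rewrite patchE indicE; case: (x \in A); rewrite ?mul1r ?mul0r.
Qed.

End density.

Section mittag_leffler_series.
Context {R : realType} (kappa : R).
Hypothesis kappa_gt0 : 0 < kappa.
Hypothesis kappa_le1 : kappa <= 1.

Let arg_gt0 m : 0 < kappa * m%:R + 1 :> R.
Proof. by rewrite ltr_wpDl// mulr_ge0// ltW. Qed.

(** Wendel's inequality from x + kappa up to x + 1 gives a bound in the reverse direction; kappa <=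
    x allows x + kappa to be replaced by 2 x, at the cost of a factor at most 2. *)
Lemma Gamma_ratio_le (x : R) : kappa <= x -> Gamma x <= 2 * x `^ (- kappa) * Gamma (x + kappa).
Proof.
move=> kx; have x0 : 0 < x by exact: lt_le_trans kx.
have k1 : 0 <= 1 - kappa <= 1 by rewrite subr_ge0 kappa_le1/= gerBl ltW.
have xk0 : 0 < x + kappa by rewrite addr_gt0.
have := Gamma_addr_le xk0 k1; rewrite addrA addrAC addrK Gamma_recurrence// => h.
have xk2 : (x + kappa) `^ (1 - kappa) <= 2 * x `^ (1 - kappa).
  apply: (@le_trans _ _ ((2 * x) `^ (1 - kappa))).
    apply: ge0_ler_powR; rewrite ?nnegrE ?subr_ge0 ?addr_ge0 ?mulr_ge0 ?(ltW x0) ?(ltW kappa_gt0)//.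
    by rewrite mulr_natl mulr2n lerD2l.
  rewrite powRM ?(ltW x0)// ler_wpM2r ?powR_ge0//.
  by rewrite -[leRHS]powRr1// ler_powR ?ler1n// gerBl ltW.
have xE : x * (2 * x `^ (- kappa)) = 2 * x `^ (1 - kappa).
  by rewrite powRD ?(gt_eqF x0) ?implybT// powRr1 ?(ltW x0)//; ring.
rewrite -(ler_pM2l x0) mulrA xE; apply: (le_trans h).
by rewrite ler_wpM2r// Gamma_ge0.
Qed.

Lemma cvg_mittag_leffler_abs (s : R) : 0 <= s ->
  cvgn (series (fun m => s ^+ m / Gamma (kappa * m%:R + 1))).
Proof.
move=> s0; apply: cvg_series_half.
  by move=> m; rewrite divr_ge0 ?exprn_ge0 ?Gamma_ge0.
near=> m.
(* Beyond this m one has 4 s <= (kappa m)^kappa, and [Gamma_ratio_le] brings the quotient of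
   consecutive terms below 1 / 2. *)
have h : 4 * s / kappa `^ kappa <= m%:R `^ kappa.
  by near: m; exact: nbhs_infty_powR_ge.
set x := kappa * m%:R + 1.
have -> : kappa * m.+1%:R + 1 = x + kappa by rewrite /x -natr1; ring.
have xk : 4 * s <= x `^ kappa.
  rewrite ler_pdivrMr ?powR_gt0// in h; apply: (le_trans h).
  rewrite -powRM// ?(ltW kappa_gt0)//; apply: ge0_ler_powR; rewrite ?nnegrE.
  - exact: ltW.
  - by rewrite mulr_ge0// ltW.
  - exact: ltW (arg_gt0 m).
  - by rewrite /x mulrC; lra.
have xkap : kappa <= x.
  by rewrite /x (le_trans kappa_le1)// lerDr mulr_ge0// ltW.
have g := Gamma_ratio_le xkap.
have G0 : 0 < Gamma x by exact: Gamma_gt0 (arg_gt0 m).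
have G1 : 0 < Gamma (x + kappa) by apply: Gamma_gt0; rewrite addr_gt0//; exact: arg_gt0.
have X0 : 0 < x `^ kappa by rewrite powR_gt0// arg_gt0.
suff h2 : s * Gamma x <= 2^-1 * Gamma (x + kappa).
  move: (Gamma x) G0 (Gamma (x + kappa)) G1 h2 => G G0 G' G1 h2.
  rewrite ler_pdivrMr// (_ : 2^-1 * _ * _ = s ^+ m * (2^-1 * G' / G)); last by ring.
  by rewrite exprSr ler_wpM2l ?exprn_ge0// ler_pdivlMr.
clear h.
rewrite powRN in g.
apply: (le_trans (ler_wpM2l s0 g)).
have -> : s * (2 * (x `^ kappa)^-1 * Gamma (x + kappa)) =
  4 * s / x `^ kappa * (2^-1 * Gamma (x + kappa)).
  by move: (x `^ kappa) X0 (Gamma _) => p p0 G; field; rewrite gt_eqF.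
by rewrite ler_piMl ?mulr_ge0 ?invr_ge0 ?(ltW G1)// ler_pdivrMr// mul1r.
Unshelve. all: end_near. Qed.

Lemma cvg_mittag_leffler (z : R) :
  cvgn (series (fun m => z ^+ m / Gamma (kappa * m%:R + 1))).
Proof.
apply: normed_cvg; apply: (series_le_cvg _ _ _ (cvg_mittag_leffler_abs (normr_ge0 z))) => //= m.
- by rewrite divr_ge0 ?exprn_ge0 ?Gamma_ge0.
- by rewrite normrM normrX [ `|_^-1|]ger0_norm// invr_ge0 Gamma_ge0.
Qed.

End mittag_leffler_series.

Section integral_series.
Context {R : realType} d (T : measurableType d) (mu : {measure set T -> \bar R}).
Variables (D : set T) (h : nat -> T -> R) (F : T -> R) (a b : nat -> R).
Hypothesis mD : measurable D.
Hypothesis mh : forall m, measurable_fun D (h m).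
Hypothesis h0 : forall m x, D x -> 0 <= h m x.
Hypothesis int_h : forall m, (\int[mu]_(x in D) (h m x)%:E = (b m)%:E)%E.
Hypothesis cvg_ab : cvgn (series (fun m => `|a m| * b m)).
Hypothesis F_series : forall x, D x -> series (fun m => a m * h m x) n @[n --> \oo] --> F x.

Let b0 m : 0 <= b m.
Proof. by rewrite -lee_fin -int_h; apply: integral_ge0 => x Dx; rewrite lee_fin h0. Qed.

Let H x : \bar R := (\sum_(m <oo) (`|a m| * h m x)%:E)%E.

Let mH : measurable_fun D H.
Proof.
apply: ge0_emeasurable_sum => m x; first by move=> Dx _; rewrite lee_fin mulr_ge0// h0.
by apply/measurable_EFinP; exact: measurable_funM.
Qed.

Let int_H : (\int[mu]_(x in D) H x < +oo)%E.
Proof.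
rewrite integral_nneseries//; last 2 first.
- by move=> m; apply/measurable_EFinP; exact: measurable_funM.
- by move=> m x Dx; rewrite lee_fin mulr_ge0// h0.
rewrite (eq_eseriesr (g := fun m => (`|a m| * b m)%:E)); last first.
  move=> m _; under eq_integral do rewrite EFinM.
  rewrite ge0_integralZl ?int_h//; first exact/measurable_EFinP.
  by move=> x Dx; rewrite lee_fin h0.
rewrite (_ : (\sum_(_ <oo) _)%E = (limn (series (fun m => `|a m| * b m)))%:E) ?ltry//.
rewrite -EFin_lim//; apply: congr_lim; apply/funext => n.
by rewrite /series/= sumEFin.
Qed.

Let integrable_h m : mu.-integrable D (EFin \o h m).
Proof.
apply/integrableP; split; first exact/measurable_EFinP.
rewrite (eq_integral (fun x => (h m x)%:E)) ?int_h ?ltry// => x /set_mem Dx /=.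
by rewrite ger0_norm// h0.
Qed.

(** Dominated convergence with bound [H], the sum of the absolute terms. It serves the three power
    series integrated below: the exponential against the density, the Mittag-Leffler tail against
    exp(- t), and the cosine against the Gaussian. *)
Lemma integral_series :
  (\int[mu]_(x in D) (F x)%:E = (limn (series (fun m => a m * b m)))%:E)%E.
Proof.
have H0 x : D x -> (0 <= H x)%E.
  by move=> Dx; apply: nneseries_ge0 => m _ _; rewrite lee_fin mulr_ge0// h0.
have mS n : measurable_fun D (fun x => series (fun m => a m * h m x) n).
  by apply: measurable_sum => m; exact: measurable_funM.
have mF : measurable_fun D F by apply: (measurable_fun_cvg mS).
have [||||| _ _] := @dominated_convergence _ _ _ mu D mD
  (fun n => EFin \o (fun x => series (fun m => a m * h m x) n)) (EFin \o F) H.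
- by move=> n; exact/measurable_EFinP.
- exact/measurable_EFinP.
- by apply: aeW => x Dx; apply: cvg_EFin; [exact: nearW|exact: F_series].
- apply/integrableP; split => //.
  by rewrite (eq_integral H)// => x /set_mem Dx; rewrite gee0_abs// H0.
- apply: aeW => x n Dx /=.
  apply: (@le_trans _ _ (\sum_(0 <= m < n) (`|a m| * h m x)%:E)%E).
    rewrite sumEFin lee_fin (le_trans (ler_norm_sum _ _ _))// ler_sum// => m _.
    by rewrite normrM (ger0_norm (h0 m Dx)).
  by apply: nneseries_lim_ge => m _; rewrite lee_fin mulr_ge0// h0.
have e n : (\int[mu]_(x in D) (series (fun m => a m * h m x)%R n)%:E)%E =
    (series (fun m => a m * b m) n)%:E.
  rewrite /series/= -sumEFin.
  under eq_integral do rewrite -sumEFin.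
  rewrite integral_sum//; last first.
    move=> m; under eq_fun do rewrite EFinM; exact: integrableZl (integrable_h m).
  apply: eq_bigr => m _; under eq_integral do rewrite EFinM.
  by rewrite integralZl ?int_h//; exact: integrable_h.
rewrite (_ : [sequence _]_n = fun n => (series (fun m => a m * b m) n)%:E); last first.
  by apply/funext => n; exact: e.
move=> lim; apply/esym; rewrite -EFin_lim; first exact/cvg_lim.
apply: normed_cvg; apply: (series_le_cvg _ _ _ cvg_ab) => //= m.
- by rewrite mulr_ge0.
- by rewrite normrM (ger0_norm (b0 m)).
Qed.

End integral_series.

Lemma cvg_exp_series {R : realType} (x : R) :
  series (fun m => x ^+ m / m`!%:R) n @[n --> \oo] --> expR x.
Proof. exact: is_cvg_series_exp_coeff. Qed.

Lemma mittag_leffler1 {R : realType} (z : R) : mittag_leffler 1 z = expR z.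
Proof.
rewrite /mittag_leffler (_ : (fun n => _) = series (exp_coeff z))//.
apply/funext => n; apply: eq_bigr => m _.
by rewrite mul1r natr1 Gamma_nat.
Qed.

Lemma mittag_leffler0 {R : realType} (kappa : R) : mittag_leffler kappa 0 = 1.
Proof.
suff h : (fun n => \sum_(0 <= m < n) 0 ^+ m / Gamma (kappa * m%:R + 1)) @ \oo --> (1 : R).
  exact: cvg_lim h.
rewrite -cvg_shiftS /=.
rewrite (_ : (fun n => _) = (fun=> 1)); first exact: cvg_cst.
apply/funext => n; rewrite big_nat_recl// mulr0 add0r Gamma1 expr0 divr1.
by rewrite big1 ?addr0// => i _; rewrite expr0n mul0r.
Qed.

Section mittag_leffler_law.
Context {R : realType} (kappa : R).
Hypothesis kappa_gt0 : 0 < kappa.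
Local Notation mu := (@lebesgue_measure R).
Local Notation D := (`[0%R, +oo[%classic : set R).

(** The exponential is expanded against the moments; this is legitimate because the absolute series
    is that of E_kappa(s), which converges. *)
Lemma ML_density_laplace (s : R) : kappa < 1 -> 0 <= s ->
  (\int[mu]_(u in D) (expR (- (s * u)) * ML_density kappa u)%:E =
   (mittag_leffler kappa (- s))%:E)%E.
Proof.
move=> kappa_lt1 s0.
pose a m : R := (- s) ^+ m / m`!%:R.
pose b m : R := m`!%:R / Gamma (kappa * m%:R + 1).
have f0 m : m`!%:R != 0 :> R by rewrite pnatr_eq0 -lt0n fact_gt0.
have mlE : mittag_leffler kappa (- s) = limn (series (fun m => a m * b m)).
  rewrite /mittag_leffler (_ : series _ = fun n => \sum_(0 <= m < n) (- s) ^+ m / Gamma (kappa * m%:R + 1))//.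
  apply/funext => n; apply: eq_bigr => m _.
  by rewrite /a /b mulrA mulfVK.
rewrite mlE; apply: (@integral_series _ _ _ mu D (fun m u => u ^+ m * ML_density kappa u)) => //.
- move=> m; apply: measurable_funM; last exact: measurable_ML_density.
  exact: measurable_funTS.
- move=> m u; rewrite /= in_itv/= andbT => u0.
  by rewrite mulr_ge0 ?exprn_ge0 ?ML_density_ge0.
- by move=> m; exact: ML_density_moment.
- rewrite (_ : (fun m => _) = fun m => s ^+ m / Gamma (kappa * m%:R + 1)).
    by apply: cvg_mittag_leffler_abs => //; exact: ltW.
  apply/funext => m; rewrite /a /b normrM normrX normrN (ger0_norm s0).
  by rewrite [ `|_^-1|]ger0_norm ?invr_ge0// mulrA mulfVK.
- move=> u _; have -> : expR (- (s * u)) * ML_density kappa u =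
    ML_density kappa u * expR (- (s * u)) by rewrite mulrC.
  rewrite (_ : series _ = fun n => ML_density kappa u * series (fun m => (- (s * u)) ^+ m / m`!%:R) n).
    by apply: cvgMr; exact: cvg_exp_series.
  apply/funext => n; rewrite /series/= mulr_sumr; apply: eq_bigr => m _.
  by rewrite /a -mulNr exprMn; ring.
Qed.

Hypothesis kappa_le1 : kappa <= 1.

Let g : R -> R := ML_density kappa \_ (`]0%R, +oo[%classic : set R).

Let g0 : kappa < 1 -> forall u, 0 <= g u.
Proof.
move=> k1 u; rewrite /g patchE; case: ifPn => // /set_mem.
by rewrite /= in_itv/= andbT => u0; rewrite ML_density_ge0// ltW.
Qed.

Let mg : kappa < 1 -> measurable_fun setT g.
Proof.
move=> k1; apply/(measurable_restrictT _ (measurable_itv _)).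
apply: measurable_funS (measurable_ML_density kappa_gt0 k1); first exact: measurable_itv.
by move=> u /=; rewrite !in_itv/= !andbT; exact: ltW.
Qed.

Let ML_lawE A : kappa < 1 -> ML_law kappa A = (\int[mu]_(u in A) (g u)%:E)%E.
Proof.
move=> k1; rewrite /ML_law lt_eqF// integral_mkcondr; apply: eq_integral => u _.
by rewrite /g !patchE; case: ifP.
Qed.

Let integral_g (h : R -> R) : kappa < 1 -> measurable_fun D (fun u => h u * ML_density kappa u) ->
  (\int[mu]_u (h u * g u)%:E = \int[mu]_(u in D) (h u * ML_density kappa u)%:E)%E.
Proof.
move=> k1 mh.
transitivity (\int[mu]_(u in `]0%R, +oo[) (h u * ML_density kappa u)%:E)%E.
  rewrite [RHS]integral_mkcond; apply: eq_integral => u _.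
  by rewrite /g !patchE; case: ifP; rewrite ?mulr0.
rewrite integral_itv_obnd_cbnd//; apply/measurable_EFinP.
apply: measurable_funS mh; first exact: measurable_itv.
by move=> u /=; rewrite !in_itv/= !andbT; exact: ltW.
Qed.

Lemma ML_law_exists :
  exists Q : probability (measurableTypeR R) R, forall A, measurable A -> Q A = ML_law kappa A.
Proof.
have [k1|k1] := eqVneq kappa 1.
  by exists (dirac (1 : measurableTypeR R)) => A _; rewrite /ML_law k1 eqxx.
have k_lt1 : kappa < 1 by rewrite lt_neqAle k1.
have [|Q QE] := @density_probability R _ (measurableTypeR R) mu g (g0 k_lt1) (mg k_lt1).
  transitivity (\int[mu]_u (1 * g u)%:E)%E.
    by apply: eq_integral => u _; rewrite mul1r.
  rewrite (@integral_g (fun=> 1))//; last first.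
    by apply: measurable_funM => //; exact: measurable_ML_density.
  have := ML_density_moment kappa_gt0 k_lt1 0.
  rewrite mulr0 add0r Gamma1 fact0 divr1 => <-.
  by apply: eq_integral => u _; rewrite expr0.
by exists Q => A _; rewrite QE -ML_lawE.
Qed.

Lemma bmeas_expR_maxN (s : R) : 0 <= s -> bmeas (fun u : R => expR (- (s * Num.max u 0))).
Proof.
move=> s0; apply: bmeas_expRN => //; last by move=> u; rewrite le_max lexx orbT.
exact: measurable_maxr.
Qed.

(** The law makes U positive only almost surely; the positive part keeps the exponential bounded
    everywhere, and is also the square of [Num.sqrt] on negative values. *)
Lemma ML_law_laplace d (T : measurableType d) (P : probability T R) (U : T -> R) (s : R) :
  measurable_fun setT U -> has_law P U (ML_law kappa) -> 0 <= s ->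
  mean P (fun w => expR (- (s * Num.max (U w) 0))) = mittag_leffler kappa (- s).
Proof.
move=> mU PU s0.
have [Q QE] := ML_law_exists.
have bh := bmeas_expR_maxN s0.
rewrite (mean_comp (P' := Q) mU _ bh); last by move=> A mA; rewrite PU// QE.
have [k1|k1] := eqVneq kappa 1.
  rewrite (_ : mean Q _ = mean (dirac (1 : measurableTypeR R)) (fun u => expR (- (s * Num.max u 0)))).
    rewrite /mean /Rintegral integral_dirac//; last by apply/measurable_EFinP; exact: bh.1.
    rewrite [X in fine (X * _)%E](@probability_setT _ _ _ (dirac (1 : measurableTypeR R))) mul1e/=.
    by rewrite max_l// mulr1 k1 mittag_leffler1.
  rewrite /mean /Rintegral; congr fine; apply: eq_measure_integral => A mA _.
  by apply: (eq_trans (QE A mA)); rewrite /ML_law k1 eqxx.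
have k_lt1 : kappa < 1 by rewrite lt_neqAle k1.
rewrite (@density_mean _ _ _ mu g (g0 k_lt1) (mg k_lt1))//; last first.
  by move=> A mA; rewrite QE// ML_lawE.
rewrite /Rintegral integral_g//; last first.
  apply: measurable_funM; last exact: measurable_ML_density.
  exact: measurable_funTS bh.1.
have e := ML_density_laplace k_lt1 s0.
transitivity (fine (mittag_leffler kappa (- s))%:E); last by [].
rewrite -e; congr fine.
apply: eq_integral => u; rewrite inE /= in_itv/= andbT => u0.
by rewrite max_l.
Qed.

End mittag_leffler_law.

(** * Fractional Poisson variables *)

Section laplace_of_mittag_leffler_tail.
Context {R : realType} (kappa : R).
Hypothesis kappa_gt0 : 0 < kappa.
Hypothesis kappa_le1 : kappa <= 1.
Local Notation mu := (@lebesgue_measure R).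

Let arg_gt0 m : 0 < kappa * m%:R + 1 :> R.
Proof. by rewrite ltr_wpDl// mulr_ge0// ltW. Qed.

(** The integral of t^(kappa m) exp(- t) cancels the Gamma factor of each term, leaving a geometric
    series in - rho. This is the origin of the condition rho < 1. *)
Lemma integral_one_sub_mittag_leffler (rho : R) : 0 <= rho < 1 ->
  (\int[mu]_(t in `]0%R, +oo[) ((1 - mittag_leffler kappa (- (rho * t `^ kappa))) * expR (- t))%:E =
   (rho / (1 + rho))%:E)%E.
Proof.
move=> /andP[rho0 rho1].
pose b m : R := Gamma (kappa * m%:R + 1).
pose a (m : nat) : R := (m == 0%N)%:R - (- rho) ^+ m / b m.
have b0 m : 0 < b m by exact: Gamma_gt0.
have b01 : b 0%N = 1 by rewrite /b mulr0 add0r Gamma1.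
have abE m : a m * b m = (m == 0%N)%:R - (- rho) ^+ m.
  have bn0 : b m != 0 by rewrite gt_eqF.
  rewrite /a mulrBl mulfVK//; congr (_ - _).
  by case: m {bn0} => [|m]; rewrite ?b01 ?mulr1 ?mul0r.
have abs_rho : `|- rho| < 1 by rewrite normrN ger0_norm.
have lim_ab : limn (series (fun m => a m * b m)) = rho / (1 + rho).
  have h : series (fun m => a m * b m) n @[n --> \oo] --> rho / (1 + rho).
    have -> : rho / (1 + rho) = 1 - 1 * (1 - (- rho))^-1.
      by rewrite opprK; field; rewrite gt_eqF// ltr_wpDr.
    rewrite -cvg_shiftS /=.
    rewrite (_ : (fun n => _) = fun n => 1 - series (geometric 1 (- rho)) n.+1).
      apply: cvgB; first exact: cvg_cst.
      by have := @cvg_geometric_series R 1 _ abs_rho; rewrite -cvg_shiftS.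
    apply/funext => n; rewrite /series/=.
    under eq_bigr do rewrite abE; rewrite sumrB; congr (_ - _).
      by rewrite big_nat_recl//= big1 ?addr0.
    by apply: eq_bigr => m _; rewrite mul1r.
  exact: cvg_lim h.
rewrite -lim_ab; apply: (@integral_series _ _ _ mu _ (fun m => gamma_integrand (kappa * m%:R + 1))).
- exact: measurable_itv.
- by move=> m; apply: measurable_funTS; exact: measurable_gamma_integrand.
- by move=> m t _; exact: gamma_integrand_ge0.
- by move=> m; exact: gammaE_fin.
- apply: (@series_le_cvg _ _ (fun m => rho ^+ m)) => [m|m|m|].
  + by rewrite mulr_ge0// ltW.
  + exact: exprn_ge0.
  + rewrite -[b m in leLHS]ger0_norm ?(ltW (b0 m))// -normrM abE.
    case: m => [|m]; first by rewrite expr0 subrr normr0.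
    by rewrite sub0r normrN normrX normrN ger0_norm.
  + rewrite (_ : (fun m => _) = geometric 1 rho); last by apply/funext => m; rewrite /= mul1r.
    by apply: is_cvg_geometric_series; rewrite ger0_norm.
- move=> t; rewrite /= in_itv/= andbT => t0.
  rewrite mulrC -cvg_shiftS /=.
  rewrite (_ : (fun n => _) = fun n => expR (- t) * (1 -
      series (fun m => (- (rho * t `^ kappa)) ^+ m / b m) n.+1)).
    apply: cvgMr; apply: cvgB; first exact: cvg_cst.
    have := @cvg_mittag_leffler R _ kappa_gt0 kappa_le1 (- (rho * t `^ kappa)).
    by rewrite -cvg_shiftS.
  apply/funext => n; rewrite /series/=.
  transitivity (expR (- t) * \sum_(0 <= m < n.+1) ((m == 0%N)%:R - (- (rho * t `^ kappa)) ^+ m / b m)).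
    rewrite mulr_sumr; apply: eq_bigr => m _.
    rewrite /gamma_integrand addrK powRrM powR_mulrn ?powR_ge0//.
    rewrite /a -[- (rho * _)]mulNr exprMn.
    case: m => [|m]; first by rewrite !expr0 b01; ring.
    by rewrite !sub0r; ring.
  rewrite sumrB; congr (_ * (_ - _)).
  by rewrite big_nat_recl//= big1 ?addr0.
Qed.

Let g (t : R) : R := if 0 <= t then expR (- t) else 0.

Let g0 t : 0 <= g t.
Proof. by rewrite /g; case: ifP => // _; exact: expR_ge0. Qed.

Let gE : g = (fun t => expR (- t)) \_ (`[0%R, +oo[%classic : set R).
Proof.
apply/funext => t; rewrite /g patchE; congr (if _ then _ else _).
by apply/idP/idP; rewrite inE /= in_itv/= andbT.
Qed.

Let mg : measurable_fun setT g.
Proof.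
rewrite gE; apply/(measurable_restrictT _ (measurable_itv _)).
by apply: measurable_funTS; apply: measurableT_comp.
Qed.

Let int_tail (a : R) : 0 <= a -> (\int[mu]_(t in `[a, +oo[) (g t)%:E = (expR (- a))%:E)%E.
Proof.
move=> a0; rewrite -integral_expRN.
rewrite -integral_itv_obnd_cbnd; last first.
  by apply/measurable_EFinP; exact: measurable_funTS.
apply: eq_integral => t; rewrite inE /= in_itv/= andbT => at_.
by rewrite /g (le_trans a0 (ltW at_)).
Qed.

Let int_g : (\int[mu]_t (g t)%:E = 1)%E.
Proof.
have := int_tail (lexx 0); rewrite oppr0 expR0 => <-.
rewrite [RHS]integral_mkcond; apply: eq_integral => t _.
rewrite patchE; case: ifPn => // /negP; rewrite inE /= in_itv/= andbT /g.
by case: ifP.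
Qed.

(** By Fubini, E exp(- V) is the probability that V does not exceed an independent standard
    exponential time: [Q] is the law of that time and [f] the indicator of the event. *)
Lemma mean_expRN_mittag_leffler_tail d (T : measurableType d) (P : probability T R)
    (V : T -> R) (rho : R) :
  measurable_fun setT V -> (forall w, 0 <= V w) -> 0 <= rho < 1 ->
  (forall t : R, 0 < t ->
    P [set w | V w <= t] = (1 - mittag_leffler kappa (- (rho * t `^ kappa)))%:E) ->
  mean P (fun w => expR (- V w)) = rho / (1 + rho).
Proof.
move=> mV V0 rho01 cdfV.
have [Q QE] := @density_probability R _ (measurableTypeR R) mu g g0 mg int_g.
pose f (p : T * R) : R := \1_[set p : T * R | V p.1 <= p.2] p.
have bf : bmeas f.
  apply: bmeas_indic.
  have mf : measurable_fun [set: T * R] (fun p : T * R => p.2 - V p.1).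
    by apply: measurable_funB => //; exact: measurableT_comp.
  have := mf measurableT `[0, +oo[%classic (measurable_itv _).
  rewrite setTI (_ : _ @^-1` _ = [set p : T * R | V p.1 <= p.2])//.
  by apply/seteqP; split => p; rewrite /= in_itv/= andbT subr_ge0.
have fQ w : mean Q (fun t => f (w, t)) = expR (- V w).
  transitivity (mean Q \1_(`[V w, +oo[%classic : set R)).
    congr mean; apply/funext => t; rewrite /f !indicE; congr (_%:R); congr nat_of_bool.
    by apply/idP/idP; rewrite !inE /= in_itv/= andbT.
  rewrite mean_indic; last exact: measurable_itv.
  by rewrite QE int_tail.
have fP t : 0 < t -> mean P (fun w => f (w, t)) = 1 - mittag_leffler kappa (- (rho * t `^ kappa)).
  move=> t0; transitivity (mean P \1_[set w | V w <= t]).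
    by congr mean; apply/funext => w; rewrite /f !indicE; congr (_%:R); congr nat_of_bool;
      apply/idP/idP; rewrite !inE.
  rewrite mean_indic ?cdfV//.
  have := mV measurableT `]-oo, t]%classic (measurable_itv _).
  rewrite setTI (_ : _ @^-1` _ = [set w | V w <= t])//.
transitivity (mean P (fun w => mean Q (fun t => f (w, t)))).
  by congr mean; apply/funext => w; rewrite fQ.
rewrite mean_swap//.
have bfP : bmeas (fun t => mean P (fun w => f (w, t))).
  have bf' : bmeas (fun p : R * T => f (p.2, p.1)).
    by apply: bmeas_comp bf _; exact: measurable_swap.
  exact: (bmeas_mean2 Q P bf').
rewrite (@density_mean _ _ _ mu g g0 mg Q _ _ bfP); last by move=> A _; exact: QE.
have e := integral_one_sub_mittag_leffler rho01.
transitivity (fine (rho / (1 + rho))%:E); last by [].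
rewrite -e /Rintegral; congr fine.
transitivity (\int[mu]_(t in `[0%R, +oo[) (mean P (fun w => f (w, t)) * g t)%:E)%E.
  rewrite [RHS]integral_mkcond; apply: eq_integral => t _.
  rewrite patchE; case: ifPn => // /negP; rewrite inE /= in_itv/= andbT /g.
  by case: ifP; rewrite ?mulr0.
rewrite -integral_itv_obnd_cbnd; last first.
  by apply/measurable_EFinP; apply: measurable_funM; apply: measurable_funTS => //; exact: bfP.1.
apply: eq_integral => t; rewrite inE /= in_itv/= andbT => t0.
by rewrite fP// /g ltW.
Qed.

End laplace_of_mittag_leffler_tail.

(** * Inversion of Laplace transforms at large rates *)

Section power_cutoff.
Context {R : realType}.
Implicit Types (x y s t : R) (k m : nat).

Let bernoulli y m : - 1 <= y -> 1 + m%:R * y <= (1 + y) ^+ m.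
Proof.
move=> y1; elim: m => [|m IH]; first by rewrite mul0r addr0 expr0.
have y0 : 0 <= 1 + y by lra.
rewrite exprS; apply: (le_trans _ (ler_wpM2l y0 IH)).
rewrite -natr1; have : 0 <= m%:R * y ^+ 2 by rewrite mulr_ge0 ?sqr_ge0.
by rewrite expr2; lra.
Qed.

(* (1 - 2^{-k x/t})^{2^k} tends to the indicator of x > t, away from x = t. *)
Definition power_cutoff t k x : R := (1 - expR (- (k%:R * (ln 2 / t) * x))) ^+ (2 ^ k)%N.

(** The rate ln 2 / t is chosen so that the exponent 2^k times the exponential crosses 1 exactly at
    x = t. *)
Let scale t k x : t != 0 ->
  (2 ^ k)%:R * expR (- (k%:R * (ln 2 / t) * x)) = expR (k%:R * (ln 2 / t) * (t - x)).
Proof.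
move=> t0; have -> : k%:R * (ln 2 / t) * (t - x) = k%:R * ln 2 + - (k%:R * (ln 2 / t) * x).
  by field.
rewrite expRD; congr (_ * _).
by rewrite natrX -[in LHS](@lnK _ 2) ?posrE// -expRM_natl.
Qed.

Let ln2 : 0 < ln 2 :> R.
Proof. by rewrite ln_gt0// ltr1n. Qed.

Let rate_ge0 t k : 0 < t -> 0 <= k%:R * (ln 2 / t).
Proof. by move=> t0; rewrite mulr_ge0// divr_ge0 ?ltW. Qed.

Let base01 t k x : 0 < t -> 0 <= x -> 0 <= expR (- (k%:R * (ln 2 / t) * x)) <= 1.
Proof.
move=> t0 x0; rewrite expR_ge0/= -[leRHS]expR0 ler_expR oppr_le0.
by rewrite mulr_ge0// rate_ge0.
Qed.

Lemma power_cutoff01 t k x : 0 < t -> 0 <= x -> 0 <= power_cutoff t k x <= 1.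
Proof.
move=> t0 x0; have /andP[y0 y1] := base01 k t0 x0.
by rewrite exprn_ge0 ?subr_ge0//= exprn_ile1 ?subr_ge0// gerBl.
Qed.

Lemma power_cutoff_ge t t' k x : 0 < t -> t <= t' -> t' <= x ->
  1 - expR (- (k%:R * (ln 2 / t) * (t' - t))) <= power_cutoff t k x.
Proof.
move=> t0 tt' t'x; have x0 : 0 <= x by rewrite (le_trans _ t'x)// (le_trans _ tt')// ltW.
have /andP[y0 y1] := base01 k t0 x0.
have yN1 : - 1 <= - expR (- (k%:R * (ln 2 / t) * x)) by rewrite lerN2.
apply: le_trans (bernoulli (2 ^ k)%N yN1).
rewrite mulrN scale ?gt_eqF// lerD2l lerN2 ler_expR -mulrN opprB.
by rewrite ler_wpM2l ?rate_ge0// lerD2l lerN2.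
Qed.

Lemma power_cutoff_le t s k x : 0 < t -> 0 <= x -> x <= s ->
  power_cutoff t k x <= expR (- (k%:R * (ln 2 / t) * (t - s))).
Proof.
move=> t0 x0 xs; have /andP[y0 y1] := base01 k t0 x0.
set y := expR (- (k%:R * (ln 2 / t) * x)) in y0 y1.
have yN1 : - 1 <= y by rewrite (le_trans _ y0)// lerN10.
have b := bernoulli (2 ^ k)%N yN1.
have E : (2 ^ k)%:R * y = expR (k%:R * (ln 2 / t) * (t - x)) by rewrite scale ?gt_eqF.
have q0 : 0 <= (1 - y) ^+ (2 ^ k)%N by rewrite exprn_ge0 ?subr_ge0.
(* With n = 2^k, the product (1 - y)^n (1 + y)^n is at most 1, and Bernoulli for the second factor
   gives (1 - y)^n <= 1 / (n y). *)
have h : (1 - y) ^+ (2 ^ k)%N * ((2 ^ k)%:R * y) <= 1.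
  apply: (@le_trans _ _ ((1 - y) ^+ (2 ^ k)%N * (1 + y) ^+ (2 ^ k)%N)).
    by rewrite ler_wpM2l// (le_trans _ b)// lerDr.
  rewrite -exprMn exprn_ile1 ?mulr_ge0 ?subr_ge0 ?addr_ge0//.
  by rewrite -subr_sqr expr1n gerBl sqr_ge0.
rewrite E -ler_pdivlMr ?expR_gt0// div1r -expRN in h.
apply: (le_trans h); rewrite ler_expR lerN2 ler_wpM2l ?rate_ge0//.
by rewrite lerD2l lerN2.
Qed.

Lemma power_cutoff_expand t k x : power_cutoff t k x =
  \sum_(j < (2 ^ k).+1) ((-1) ^+ j * 'C(2 ^ k, j)%:R) * expR (- (j%:R * k%:R * (ln 2 / t) * x)).
Proof.
rewrite /power_cutoff exprBn; apply: eq_bigr => j _.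
rewrite expr1n mulr1 -mulr_natr mulrAC; congr (_ * _).
by rewrite -expRM_natl; congr expR; ring.
Qed.

Context d (T : measurableType d) (P : probability T R) (Z : T -> R).
Hypothesis mZ : measurable_fun setT Z.
Hypothesis Z0 : forall w, 0 <= Z w.

Let btail (a : R) : bmeas (fun w => \1_`]a, +oo[ (Z w) : R).
Proof. by apply: bmeas_comp mZ; apply: bmeas_indic; exact: measurable_itv. Qed.

Lemma cutoff_mean_ge t t' k : 0 < t -> t < t' -> bmeas (fun w => power_cutoff t k (Z w)) ->
  (1 - expR (- (k%:R * (ln 2 / t) * (t' - t)))) * mean P (fun w => \1_`]t', +oo[ (Z w)) <=
  mean P (fun w => power_cutoff t k (Z w)).
Proof.
move=> t0 tt' bq; rewrite -meanZ//; apply: le_mean => // [|w]; first exact: bmeasZ.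
rewrite indicE; case: (boolP (_ \in _)) => [|_]; last first.
  by rewrite mulr0; have /andP[] := power_cutoff01 k t0 (Z0 w).
rewrite inE /= in_itv/= andbT mulr1 => t'Z.
by apply: power_cutoff_ge => //; exact: ltW.
Qed.

Lemma cutoff_mean_le t s k : 0 < t -> s < t -> bmeas (fun w => power_cutoff t k (Z w)) ->
  mean P (fun w => power_cutoff t k (Z w)) <=
  mean P (fun w => \1_`]s, +oo[ (Z w)) + expR (- (k%:R * (ln 2 / t) * (t - s))).
Proof.
move=> t0 st bq; rewrite -[X in _ + X](mean_cst P) -meanD//; last exact: bmeas_cst.
apply: le_mean => // [|w]; first by apply: bmeasD => //; exact: bmeas_cst.
have /andP[q0 q1] := power_cutoff01 k t0 (Z0 w).
rewrite indicE; case: (boolP (_ \in _)) => [_|/negP].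
  by rewrite (le_trans q1)// lerDl expR_ge0.
rewrite inE /= in_itv/= andbT => /negP; rewrite -leNgt add0r => Zs.
exact: power_cutoff_le.
Qed.

End power_cutoff.

Section laplace_mixture.
Context {R : realType} d d' (T : measurableType d) (T' : measurableType d').
Variables (P : probability T R) (P' : probability T' R).
Variables (X : nat -> T -> R) (V : T' -> R) (y g s0 : R).
Hypothesis mX : forall n, measurable_fun setT (X n).
Hypothesis mV : measurable_fun setT V.
Hypothesis X0 : forall n w, 0 <= X n w.
Hypothesis V0 : forall w, 0 <= V w.
Hypothesis y01 : 0 <= y < 1.

Let Phi M (f : R -> R) : R := \sum_(n < M) (1 - y) * y ^+ n * mean P (fun w => f (X n w)).

Hypothesis laplaceE : forall s, s0 <= s -> 0 < s ->
  Phi M (fun x => expR (- (s * x))) @[M --> \oo] --> mean P' (fun w => expR (- (s * V w))).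
Hypothesis tailE : Phi M (\1_`]1, +oo[) @[M --> \oo] --> g.

Let wt n : 0 <= (1 - y) * y ^+ n.
Proof. by have /andP[? ?] := y01; rewrite mulr_ge0 ?subr_ge0 ?exprn_ge0// ltW. Qed.

Let sum_wt M : \sum_(n < M) (1 - y) * y ^+ n = 1 - y ^+ M.
Proof.
rewrite -mulr_sumr -[in RHS](expr1n _ M) subrXX; congr (_ * _).
by apply: eq_bigr => i _; rewrite expr1n mul1r.
Qed.

Let sum_wt_le1 M : \sum_(n < M) (1 - y) * y ^+ n <= 1.
Proof. by rewrite sum_wt gerBl exprn_ge0//; case/andP: y01. Qed.

Let good f := [/\ forall n, bmeas (fun w => f (X n w)), bmeas (fun w => f (V w))
  & Phi M f @[M --> \oo] --> mean P' (fun w => f (V w))].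

Let good_lin (I : Type) (r : seq I) (c : I -> R) (F : I -> R -> R) :
  (forall i, good (F i)) -> good (fun x => \sum_(i <- r) c i * F i x).
Proof.
move=> gF; split.
- by move=> n; apply: bmeas_sum => i; apply: bmeasZ; have [] := gF i.
- by apply: bmeas_sum => i; apply: bmeasZ; have [] := gF i.
- have bV i : bmeas (fun w => c i * F i (V w)) by apply: bmeasZ; have [] := gF i.
  have bX n i : bmeas (fun w => c i * F i (X n w)).
    by apply: bmeasZ; have [h _ _] := gF i; exact: h.
  rewrite mean_sum//.
  have -> : (fun M => Phi M (fun x => \sum_(i <- r) c i * F i x)) =
      (fun M => \sum_(i <- r) c i * Phi M (F i)).
    apply/funext => M; rewrite /Phi.
    under [RHS]eq_bigr do rewrite mulr_sumr.
    rewrite exchange_big/=; apply: eq_bigr => n _.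
    rewrite mean_sum// mulr_sumr; apply: eq_bigr => i _.
    by rewrite meanZ; [ring|have [h _ _] := gF i; exact: h].
  elim: r => [|i r IH].
    by under eq_fun do rewrite big_nil; rewrite big_nil; exact: cvg_cst.
  under eq_fun do rewrite big_cons; rewrite big_cons; apply: cvgD => //.
  have [_ bi ci] := gF i.
  by rewrite meanZ//; apply: cvgMr.
Qed.

Let good_cst : good (fun=> 1).
Proof.
split => [n||]; [exact: bmeas_cst|exact: bmeas_cst|].
rewrite mean_cst /Phi.
rewrite (_ : (fun M => _) = fun M => 1 - y ^+ M).
  rewrite -[X in _ --> X]subr0; apply: cvgB; first exact: cvg_cst.
  by apply: cvg_expr; have /andP[? ?] := y01; rewrite ger0_norm.
by apply/funext => M; rewrite -sum_wt; apply: eq_bigr => n _; rewrite mean_cst mulr1.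
Qed.

(** Apart from its constant term, the binomial expansion involves only multiples of k ln 2 / t as
    rates, and these exceed [s0] for large k. Convergence of the transforms beyond [s0] therefore
    suffices. *)
Let good_cutoff t : 0 < t -> \forall k \near \oo, good (power_cutoff t k).
Proof.
move=> t0; have ln2 : 0 < ln 2 :> R by rewrite ln_gt0// ltr1n.
have c0 : 0 < ln 2 / t by rewrite divr_gt0.
near=> k.
have k0 : (0 < k)%N by near: k; exact: nbhs_infty_gt.
have ks : s0 <= k%:R * (ln 2 / t).
  by rewrite -ler_pdivrMr//; near: k; exact: nbhs_infty_ger.
have -> : power_cutoff t k = fun x =>
    \sum_(j < (2 ^ k).+1) ((-1) ^+ j * 'C(2 ^ k, j)%:R) * expR (- (j%:R * k%:R * (ln 2 / t) * x)).
  by apply/funext => x; exact: power_cutoff_expand.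
apply: good_lin => j.
have [->|j0] := eqVneq (val j) 0%N.
  by under eq_fun do rewrite !mul0r oppr0 expR0; exact: good_cst.
have j1 : 1 <= (val j)%:R :> R by rewrite ler1n lt0n.
have kc : 0 < k%:R * (ln 2 / t) by rewrite mulr_gt0// ltr0n.
have sj : k%:R * (ln 2 / t) <= (val j)%:R * k%:R * (ln 2 / t).
  by rewrite -mulrA ler_peMl// ltW.
split.
- by move=> n; apply: bmeas_expRN => //; rewrite (le_trans _ sj)// ltW.
- by apply: bmeas_expRN => //; rewrite (le_trans _ sj)// ltW.
- by apply: laplaceE; [exact: le_trans sj|exact: lt_le_trans sj].
Unshelve. all: end_near. Qed.

Let delta_cvg (c a : R) : 0 < c -> 0 < a -> expR (- (k%:R * c * a)) @[k --> \oo] --> (0 : R).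
Proof.
move=> c0 a0; rewrite (_ : (fun k => _) = fun k => expR (- (c * a)) ^+ k); last first.
  by apply/funext => k; rewrite -expRM_natl; congr expR; ring.
apply: cvg_expr; rewrite ger0_norm ?expR_ge0// -expR0 ltr_expR oppr_lt0.
by rewrite mulr_gt0.
Qed.

(** Up to errors exponentially small in k, the cutoff at the midpoint t lies above the indicator of
    x > t' and below that of x > 1. A gap on each side of t is needed because the cutoff is not
    controlled at its threshold. *)
Lemma mixture_tail_le t' : 1 < t' -> mean P' (fun w => \1_`]t', +oo[ (V w)) <= g.
Proof.
move=> t'1; pose t : R := (1 + t') / 2.
have t1 : 1 < t by rewrite /t; lra.
have tt' : t < t' by rewrite /t; lra.
have t0 : 0 < t by exact: lt_trans t1.
have c0 : 0 < ln 2 / t by rewrite divr_gt0// ln_gt0// ltr1n.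
pose p := mean P' (fun w => \1_`]t', +oo[ (V w)).
have l : (1 - expR (- (k%:R * (ln 2 / t) * (t' - t)))) * p @[k --> \oo] --> p.
  rewrite -[X in _ --> X]mul1r; apply: cvgM; last exact: cvg_cst.
  rewrite -[X in _ --> X]subr0; apply: cvgB; first exact: cvg_cst.
  by apply: delta_cvg => //; rewrite subr_gt0.
have r : g + expR (- (k%:R * (ln 2 / t) * (t - 1))) @[k --> \oo] --> g.
  rewrite -[X in _ --> X]addr0; apply: cvgD; first exact: cvg_cst.
  by apply: delta_cvg => //; rewrite subr_gt0.
apply: (ler_cvg_to l r); near=> k.
have [bX bV lim] : good (power_cutoff t k) by near: k; exact: good_cutoff.
apply: (@le_trans _ _ (mean P' (fun w => power_cutoff t k (V w)))).
  exact: cutoff_mean_ge.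
have lim' : Phi M (\1_`]1, +oo[) + expR (- (k%:R * (ln 2 / t) * (t - 1))) @[M --> \oo] -->
    g + expR (- (k%:R * (ln 2 / t) * (t - 1))).
  by apply: cvgD; [exact: tailE|exact: cvg_cst].
apply: (ler_cvg_to lim lim'); apply: nearW => M.
apply: (@le_trans _ _ (\sum_(n < M) (1 - y) * y ^+ n *
    (mean P (fun w => \1_`]1, +oo[ (X n w)) + expR (- (k%:R * (ln 2 / t) * (t - 1)))))).
  by apply: ler_sum => n _; rewrite ler_wpM2l// cutoff_mean_le.
under eq_bigr do rewrite mulrDr; rewrite big_split lerD2l -mulr_suml.
by rewrite ler_piMl ?expR_ge0.
Unshelve. all: end_near. Qed.

Lemma mixture_tail_ge s : 0 < s -> s < 1 -> g <= mean P' (fun w => \1_`]s, +oo[ (V w)).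
Proof.
move=> s0_ s1; pose t : R := (s + 1) / 2.
have t1 : t < 1 by rewrite /t; lra.
have st : s < t by rewrite /t; lra.
have t0 : 0 < t by exact: lt_trans st.
have c0 : 0 < ln 2 / t by rewrite divr_gt0// ln_gt0// ltr1n.
pose p := mean P' (fun w => \1_`]s, +oo[ (V w)).
have l : (1 - expR (- (k%:R * (ln 2 / t) * (1 - t)))) * g @[k --> \oo] --> g.
  rewrite -[X in _ --> X]mul1r; apply: cvgM; last exact: cvg_cst.
  rewrite -[X in _ --> X]subr0; apply: cvgB; first exact: cvg_cst.
  by apply: delta_cvg => //; rewrite subr_gt0.
have r : p + expR (- (k%:R * (ln 2 / t) * (t - s))) @[k --> \oo] --> p.
  rewrite -[X in _ --> X]addr0; apply: cvgD; first exact: cvg_cst.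
  by apply: delta_cvg => //; rewrite subr_gt0.
apply: (ler_cvg_to l r); near=> k.
have [bX bV lim] : good (power_cutoff t k) by near: k; exact: good_cutoff.
apply: (@le_trans _ _ (mean P' (fun w => power_cutoff t k (V w)))); last first.
  exact: cutoff_mean_le.
have lim' : (1 - expR (- (k%:R * (ln 2 / t) * (1 - t)))) * Phi M (\1_`]1, +oo[) @[M --> \oo] -->
    (1 - expR (- (k%:R * (ln 2 / t) * (1 - t)))) * g.
  by apply: cvgMr; exact: tailE.
apply: (ler_cvg_to lim' lim); apply: nearW => M.
rewrite mulr_sumr; apply: ler_sum => n _.
by rewrite mulrCA ler_wpM2l// cutoff_mean_ge.
Unshelve. all: end_near. Qed.

End laplace_mixture.

Section mittag_leffler_continuity.
Context {R : realType} (kappa : R).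
Hypothesis kappa_gt0 : 0 < kappa.
Hypothesis kappa_le1 : kappa <= 1.

(** Continuity on the negative half-line comes from the Laplace representation by the Mittag-Leffler
    law and bounded convergence, rather than from the series. *)
Lemma mittag_leffler_cvg (x : nat -> R) (l : R) : (forall n, 0 <= x n) ->
  x n @[n --> \oo] --> l ->
  mittag_leffler kappa (- x n) @[n --> \oo] --> mittag_leffler kappa (- l).
Proof.
move=> x0 xl; have l0 : 0 <= l by apply: (cvgr_to_ge xl); exact: nearW.
have [Q QE] := ML_law_exists kappa_gt0 kappa_le1.
have E s : 0 <= s -> mittag_leffler kappa (- s) = mean Q (fun u => expR (- (s * Num.max u 0))).
  move=> s0; have h : has_law Q (@id (measurableTypeR R)) (ML_law kappa) by exact: QE.
  by rewrite (ML_law_laplace kappa_gt0 kappa_le1 _ h).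
rewrite E//; under eq_fun do rewrite E//.
apply: (@mean_bounded_cvg _ _ _ _ _ _ 1).
- by move=> n; have [] := bmeas_expR_maxN (x0 n).
- move=> n u; rewrite ger0_norm ?expR_ge0// -[leRHS]expR0 ler_expR oppr_le0.
  by rewrite mulr_ge0// le_max lexx orbT.
- move=> u; apply: (@continuous_cvg _ _ _ _ _ _ _); first exact: continuous_expR.
  by apply: cvgN; apply: cvgM => //; exact: cvg_cst.
Qed.

Lemma mittag_leffler_powR_cvg (c l : R) (t : nat -> R) : 0 <= c -> 0 < l ->
  (forall n, 0 < t n) -> t n @[n --> \oo] --> l ->
  mittag_leffler kappa (- (c * t n `^ kappa)) @[n --> \oo] --> mittag_leffler kappa (- (c * l `^ kappa)).
Proof.
move=> c0 l0 t0 tl; apply: mittag_leffler_cvg => [n|]; first by rewrite mulr_ge0 ?powR_ge0.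
apply: cvgMr; have h := @continuous_powR_gt0 R kappa l l0.
exact: (cvg_comp _ _ tl h).
Qed.

Lemma mittag_leffler_powR_cvg0 (c : R) : 0 <= c ->
  mittag_leffler kappa (- (c * n.+1%:R^-1 `^ kappa)) @[n --> \oo] --> (1 : R).
Proof.
move=> c0; rewrite -[X in _ --> X](mittag_leffler0 kappa) -[X in _ --> mittag_leffler _ X]oppr0.
apply: mittag_leffler_cvg => [n|]; first by rewrite mulr_ge0 ?powR_ge0.
rewrite -[X in _ --> X](mulr0 c); apply: cvgMr.
have h : (n.+1%:R `^ kappa : R) @[n --> \oo] --> +oo.
  have h : (k%:R `^ kappa : R) @[k --> \oo] --> +oo.
    by apply/cvgryPge => A; exact: nbhs_infty_powR_ge.
  by move: h; rewrite -cvg_shiftS.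
rewrite (_ : (fun n => _) = fun n => (n.+1%:R `^ kappa)^-1).
  by apply/gtr0_cvgV0 => //; apply: nearW => n; rewrite powR_gt0.
by apply/funext => n; rewrite -powR_inv1// -powRrM mulN1r powRN.
Qed.

End mittag_leffler_continuity.

Lemma measure_eq_off_null {R : realType} d (T : measurableType d) (P : probability T R)
    (A B E : set T) : measurable A -> measurable B -> measurable E -> P E = 0%E ->
  (forall w, ~ E w -> (A w <-> B w)) -> P A = P B.
Proof.
suff h A' B' : measurable A' -> measurable B' -> measurable E -> P E = 0%E ->
    (forall w, ~ E w -> (A' w <-> B' w)) -> (P A' <= P B')%E.
  move=> mA mB mE PE AB; apply/eqP; rewrite eq_le h//= h//.
  by move=> w /AB[? ?]; split.
move=> mA mB mE PE AB; apply: (@le_trans _ _ (P (B' `|` E))).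
  apply: le_measure; rewrite ?inE//; first exact: measurableU.
  by move=> w A'w; have [Ew|/AB[BA _]] := pselect (E w); [right|left; exact: BA].
by have := @measureU0 _ _ _ P B' E mB mE PE => ->.
Qed.

Section level_sets.
Context {R : realType} d (T : measurableType d) (X : T -> R) (a : R).
Hypothesis mX : measurable_fun setT X.

Let measurable_level (i : interval R) : measurable (X @^-1` [set` i]).
Proof. by rewrite -[Y in measurable Y]setTI; apply: mX => //; exact: measurable_itv. Qed.

Lemma measurable_lt_cst : measurable [set w | X w < a].
Proof.
by have := measurable_level `]-oo, a[; rewrite (_ : _ @^-1` _ = [set w | X w < a])//.
Qed.

Lemma measurable_le_cst : measurable [set w | X w <= a].
Proof.
by have := measurable_level `]-oo, a]; rewrite (_ : _ @^-1` _ = [set w | X w <= a])//.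
Qed.

Lemma measurable_gt_cst : measurable [set w | a < X w].
Proof.
have := measurable_level `]a, +oo[; rewrite (_ : _ @^-1` _ = [set w | a < X w])//.
by apply/seteqP; split => w; rewrite /= in_itv/= andbT.
Qed.

End level_sets.

(** * Waiting times and the generating function of the count *)

Section renewal.
Context {R : realType} (kappa nu : R).
Hypothesis kappa_gt0 : 0 < kappa.
Hypothesis kappa_le1 : kappa <= 1.
Hypothesis nu_gt0 : 0 < nu.
Context d (T : measurableType d) (P : probability T R) (Delta : nat -> {RV P >-> R}).
Hypothesis indep_Delta : iid P Delta.
Hypothesis cdf_Delta : forall k t, 0 < t ->
  P [set w | Delta k w <= t] = (1 - mittag_leffler kappa (- nu * t `^ kappa))%:E.

(** The waiting times are nonnegative only almost surely, by [null_neg]. Their positive parts have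
    the same distribution function at t > 0 and make the partial sums monotone at every point. *)
Let posDelta k w := Num.max (Delta k w) 0.

Definition waiting_time n w := \sum_(k < n) posDelta k w.

Let mpos k : measurable_fun setT (posDelta k).
Proof. by apply: measurable_maxr => //; exact: measurable_cst. Qed.

Let pos_ge0 k w : 0 <= posDelta k w.
Proof. by rewrite le_max lexx orbT. Qed.

Lemma measurable_waiting_time n : measurable_fun setT (waiting_time n).
Proof. exact: measurable_sum. Qed.

Lemma waiting_time_ge0 n w : 0 <= waiting_time n w.
Proof. by rewrite sumr_ge0. Qed.

Let cdf_pos k t : 0 < t ->
  P [set w | posDelta k w <= t] = (1 - mittag_leffler kappa (- (nu * t `^ kappa)))%:E.
Proof.
move=> t0; rewrite -mulNr -(cdf_Delta k t0); congr (P _).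
by apply/seteqP; split => w; rewrite /posDelta /= ge_max (ltW t0) andbT.
Qed.

(** Scaling time by s replaces nu by nu / s^kappa, which has to be below 1 for the geometric
    series. *)
Let laplace_pos k s : 0 < s -> nu < s `^ kappa ->
  mean P (fun w => expR (- (s * posDelta k w))) = nu / s `^ kappa / (1 + nu / s `^ kappa).
Proof.
move=> s0 nus; have S0 : 0 < s `^ kappa by rewrite powR_gt0.
apply: (mean_expRN_mittag_leffler_tail kappa_gt0 kappa_le1).
- exact: measurable_funM.
- by move=> w; rewrite mulr_ge0// ltW.
- by rewrite divr_ge0 ?(ltW nu_gt0) ?(ltW S0)//= ltr_pdivrMr// mul1r.
- move=> t t0; have ts0 : 0 < t / s by rewrite divr_gt0.
  have -> : nu / s `^ kappa * t `^ kappa = nu * (t / s) `^ kappa.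
    rewrite powRM ?invr_ge0 ?(ltW s0) ?(ltW t0)// -[s^-1]powR_inv1 ?(ltW s0)// -powRrM mulN1r powRN.
    by ring.
  rewrite -(cdf_pos k ts0); congr (P _).
  by apply/seteqP; split => w /=; rewrite ler_pdivlMr// mulrC.
Qed.

Lemma laplace_waiting_time n s : 0 < s -> nu < s `^ kappa ->
  mean P (fun w => expR (- (s * waiting_time n w))) =
  (nu / s `^ kappa / (1 + nu / s `^ kappa)) ^+ n.
Proof.
move=> s0 nus.
transitivity (mean P (fun w => \prod_(i < n) expR (- (s * Num.max (Delta i w) 0)))).
  congr mean; apply/funext => w; rewrite -expR_sum; congr expR.
  by rewrite /waiting_time mulr_sumr sumrN.
have bv (i : nat) : bmeas (fun x : R => expR (- (s * Num.max x 0))).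
  by apply: bmeas_expR_maxN; exact: ltW.
rewrite (mean_prod_indep (fun i => measurable_funPT (Delta i)) indep_Delta.1 n bv).
under eq_bigr do rewrite laplace_pos//.
by rewrite prodr_const card_ord.
Qed.

Lemma tail_interarrival k t : 0 < t ->
  mean P (fun w => \1_`]t, +oo[ (posDelta k w)) = mittag_leffler kappa (- (nu * t `^ kappa)).
Proof.
move=> t0; have mE : measurable [set w | posDelta k w <= t] by exact: measurable_le_cst.
transitivity (mean P (fun w => 1 - \1_[set w | posDelta k w <= t] w)).
  congr mean; apply/funext => w; rewrite !indicE.
  rewrite (_ : (_ \in `]t, +oo[%classic) = ~~ (w \in [set w | posDelta k w <= t])).
    by case: (w \in _); rewrite /= ?subrr ?subr0.
  by apply/idP/negP; rewrite !inE /= in_itv/= andbT ltNge => /negP.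
rewrite meanB; [|exact: bmeas_cst|exact: bmeas_indic].
by rewrite mean_cst mean_indic// cdf_pos//= opprB addrCA subrr addr0.
Qed.

Let neg := \bigcup_k [set w | Delta k w < 0].

Let mneg k : measurable [set w | Delta k w < 0].
Proof. exact: measurable_lt_cst. Qed.

(** The distribution function is known only at t > 0; the event lies below each level 1 / (n + 1),
    whose probability tends to 0 by continuity of E_kappa at 0. *)
Let null_neg : P neg = 0%E.
Proof.
apply: measure_negligible; first exact: bigcupT_measurable.
apply: negligible_bigcup => k; apply/negligibleP => //.
have fin : P [set w | Delta k w < 0] \is a fin_num by exact: fin_num_measure.
suff le0 : (P [set w | (Delta k w < 0)%R] <= 0%:E)%E.
  by apply/eqP; rewrite eq_le measure_ge0 andbT; exact: le0.
rewrite -(fineK fin) lee_fin.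
have h := mittag_leffler_powR_cvg0 kappa_gt0 kappa_le1 (ltW nu_gt0).
have h2 : 1 - mittag_leffler kappa (- (nu * n.+1%:R^-1 `^ kappa)) @[n --> \oo] --> (0 : R).
  by rewrite -[X in _ --> X](subrr 1); apply: cvgB => //; exact: cvg_cst.
apply: (cvgr_to_ge h2); apply: nearW => n.
rewrite -lee_fin fineK// -mulNr -(cdf_Delta k) ?invr_gt0//.
apply: le_measure; rewrite ?inE//.
  exact: measurable_le_cst.
by move=> w /= /ltW /le_trans; apply; rewrite invr_ge0.
Qed.

(** The supremum is at most n iff every m with S_m <= 1 is at most n. Off the null set the partial
    sums are monotone, and this amounts to S_(n + 1) > 1. *)
Lemma renewal_count_le n :
  P (renewal_count Delta 1 @^-1` [set x | (x <= n%:R%:E)%E]) =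
  (mean P (fun w => \1_`]1, +oo[ (waiting_time n.+1 w)))%:E.
Proof.
pose S m w := \sum_(k < m) Delta k w.
have mS m : measurable_fun setT (S m) by exact: measurable_sum.
have mSm m : measurable [set w | S m w <= 1 -> (m <= n)%N].
  have [mn|nm] := leqP m n; first by rewrite (_ : [set w | _] = setT)//; apply/seteqP; split.
  rewrite (_ : [set w | _] = [set w | 1 < S m w]); first exact: measurable_gt_cst.
  apply/seteqP; split => w /=; rewrite ltNge => h.
    by apply/negP => /h.
  by rewrite (negbTE h).
have AE : renewal_count Delta 1 @^-1` [set x | (x <= n%:R%:E)%E] =
    \bigcap_m [set w | S m w <= 1 -> (m <= n)%N].
  apply/seteqP; split => w /= h.
    move=> m _ /= Sm; rewrite -(ler_nat R) -lee_fin; apply: le_trans h.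
    by apply: ereal_sup_ubound; exists m.
  by apply: ge_ereal_sup => _ [m Sm <-]; rewrite lee_fin ler_nat; exact: h.
pose B := [set w | 1 < waiting_time n.+1 w].
have mB : measurable B by apply: measurable_gt_cst; exact: measurable_waiting_time.
transitivity (P B).
  apply: (measure_eq_off_null (E := neg)) => //.
  - by rewrite AE; exact: bigcapT_measurable.
  - exact: bigcupT_measurable.
  move=> w nneg; have ST m : S m w = waiting_time m w.
    apply: eq_bigr => k _; rewrite /posDelta max_l// leNgt; apply/negP => Dk.
    by apply: nneg; exists k.
  rewrite AE; split => [h|Bw m _ /=].
    rewrite /B /= ltNge -ST; apply/negP => /(h n.+1 I).
    by rewrite ltnn.
  rewrite ST leqNgt => Tm; apply/negP => nm.
  move: Bw; rewrite /B /= ltNge => /negP; apply; apply: le_trans Tm.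
  rewrite /waiting_time (big_ord_widen m (fun k => posDelta k w))// big_mkcond.
  by apply: ler_sum => k _; case: ifP.
rewrite -[LHS]fineK ?fin_num_measure// -mean_indic//; congr (mean _ _)%:E.
apply/funext => w; rewrite !indicE; congr (_%:R); congr nat_of_bool.
by apply/idP/idP; rewrite !inE /B /= in_itv/= andbT.
Qed.

End renewal.

Lemma bmeas_exprn_nat {R : realType} d (T : measurableType d) (N : T -> nat) (y : R) :
  measurable_fun setT N -> 0 <= y <= 1 -> bmeas (fun w => y ^+ N w).
Proof.
move=> mN /andP[y0 y1]; apply: (@bmeas_comp _ _ _ _ _ (fun n : nat => y ^+ n)) => //.
split; first by [].
by exists 1 => n; rewrite ger0_norm ?exprn_ge0// exprn_ile1.
Qed.

Section pgf.
Context {R : realType} (kappa nu y : R).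
Hypothesis kappa_gt0 : 0 < kappa.
Hypothesis kappa_le1 : kappa <= 1.
Hypothesis nu_gt0 : 0 < nu.
Hypothesis y01 : 0 <= y < 1.

Let rate_large s : (nu + 1) `^ kappa^-1 <= s -> nu < s `^ kappa.
Proof.
move=> h; have n1 : 0 <= nu + 1 by rewrite addr_ge0// ltW.
apply: (@lt_le_trans _ _ (((nu + 1) `^ kappa^-1) `^ kappa)).
  by rewrite -powRrM mulVf ?gt_eqF// powRr1// ltrDl.
apply: ge0_ler_powR; rewrite ?nnegrE ?powR_ge0 ?(ltW kappa_gt0)//.
by rewrite (le_trans _ h)// powR_ge0.
Qed.

(* The geometric mixture of the laws of the arrival times is the law of a single
   waiting time of rate (1 - y) nu, as their Laplace transforms show. *)
Lemma frac_poisson_pgf d d2 (T : measurableType d) (T2 : measurableType d2)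
    (P : probability T R) (P2 : probability T2 R) (N : T -> nat) (N2 : T2 -> nat) :
  measurable_fun setT N -> frac_poisson nu kappa P N ->
  frac_poisson ((1 - y) * nu) kappa P2 N2 ->
  mean P (fun w => y ^+ N w) = mittag_leffler kappa (- (nu * (1 - y))).
Proof.
(* The second count is taken for its first waiting time [Delta2 0], which has rate (1 - y) nu. *)
move=> mN [d' [T' [P' [Delta [iidD cdfD eqN]]]]] [d'' [T'' [Q [Delta2 [iidD2 cdfD2 _]]]]].
have /andP[y0 y1] := y01; have y1' : 0 < 1 - y by rewrite subr_gt0.
pose nu' : R := (1 - y) * nu; have nu'0 : 0 < nu' by rewrite mulr_gt0.
pose X n := waiting_time Delta n.+1.
pose V w := Num.max (Delta2 0%N w) 0.
have mX n : measurable_fun setT (X n) by exact: measurable_waiting_time.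
have X0 n w : 0 <= X n w by exact: waiting_time_ge0.
have mV : measurable_fun setT V by apply: measurable_maxr.
have V0 w : 0 <= V w by rewrite le_max lexx orbT.
have VE w : waiting_time Delta2 1 w = V w by rewrite /waiting_time big_ord1.
pose s0 := (nu + 1) `^ kappa^-1.
have laplaceE s : s0 <= s -> 0 < s ->
   \sum_(n < M) (1 - y) * y ^+ n * mean P' (fun w => expR (- (s * X n w))) @[M --> \oo] -->
   mean Q (fun w => expR (- (s * V w))).
  move=> s0s s_gt0; have nus := rate_large s0s.
  have nus' : nu' < s `^ kappa.
    by apply: le_lt_trans nus; rewrite /nu' ler_piMl ?(ltW nu_gt0)// gerBl.
  have := laplace_waiting_time kappa_gt0 kappa_le1 nu'0 iidD2 cdfD2 1 s_gt0 nus'.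
  under eq_fun do rewrite VE; rewrite expr1 => ->.
  under eq_fun do under eq_bigr do rewrite (laplace_waiting_time kappa_gt0 kappa_le1 nu_gt0 iidD cdfD)//.
  set r := nu / s `^ kappa; have S0 : 0 < s `^ kappa by rewrite powR_gt0.
  have r0 : 0 < r by rewrite divr_gt0.
  have r1 : 0 < 1 + r by rewrite addr_gt0.
  have ra : `|y * (r / (1 + r))| < 1.
    rewrite ger0_norm; last by rewrite mulr_ge0// divr_ge0// ltW.
    rewrite (le_lt_trans _ y1)// ler_piMr// ler_pdivrMr// mul1r; lra.
  (* Sum over n of (1 - y) y^n (r / (1 + r))^(n + 1). It equals (1 - y) r / (1 + (1 - y) r), the
     transform of a waiting time with r multiplied by 1 - y. *)
  have -> : nu' / s `^ kappa / (1 + nu' / s `^ kappa) =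
      (1 - y) * (r / (1 + r)) * (1 - y * (r / (1 + r)))^-1.
    have -> : nu' / s `^ kappa = (1 - y) * r by rewrite /nu' mulrA.
    have h1 : 0 <= y * r by rewrite mulr_ge0// ltW.
    have h2 : 0 <= (1 - y) * r by rewrite mulr_ge0// ltW.
    field; rewrite ?gt_eqF//; lra.
  have := @cvg_geometric_series R ((1 - y) * (r / (1 + r))) _ ra.
  apply: cvg_trans; apply: near_eq_cvg; apply: nearW => M.
  rewrite /series/= big_mkord; apply: eq_bigr => n _.
  by rewrite exprMn exprS; ring.
have bN : bmeas (fun w => y ^+ N w) by apply: bmeas_exprn_nat => //; rewrite y0 ltW.
pose G n w : R := \1_[set m | (m <= n)%N] (N w).
have bG n : bmeas (G n).
  by apply: (@bmeas_comp _ _ _ _ _ (\1_[set m : nat | (m <= n)%N])) => //; exact: bmeas_indic.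
have GE n w : G n w = (N w <= n)%N%:R.
  rewrite /G indicE; congr (_%:R); congr nat_of_bool.
  by apply/idP/idP; rewrite inE.
have meanG n : mean P' (fun w => \1_`]1, +oo[ (X n w)) = mean P (G n).
  apply: EFin_inj; rewrite -(renewal_count_le kappa_gt0 kappa_le1 nu_gt0 cdfD n).
  rewrite -eqN; last first.
    rewrite (_ : [set x | _] = [set` `]-oo, n%:R%:E]]); last first.
      by apply/seteqP; split => x; rewrite /= in_itv.
    exact: emeasurable_itv.
  have -> : G n = \1_(N @^-1` [set m | (m <= n)%N]) by apply/funext => w.
  rewrite mean_indic; last by rewrite -[Y in measurable Y]setTI; exact: mN.
  rewrite fineK; last first.
    by apply: fin_num_measure; rewrite -[Y in measurable Y]setTI; exact: mN.
  by congr (P _); apply/seteqP; split => w /=; rewrite lee_fin ler_nat.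
(* The weights from n = N w on add up to y^(N w), and N w <= n has the probability that T_(n + 1) >
   1. So E y^N is the mixture probability of exceeding 1. *)
have sumG M w : \sum_(n < M) (1 - y) * y ^+ n * G n w =
    (if (N w < M)%N then y ^+ N w - y ^+ M else 0).
  under eq_bigr do rewrite GE.
  elim: M => [|M IH]; first by rewrite big_ord0.
  rewrite big_ord_recr /= IH ltnS.
  by have [NM|NM|->] := ltngtP (N w) M; rewrite ?mulr1 ?mulr0 ?exprS; ring.
have tailE : \sum_(n < M) (1 - y) * y ^+ n * mean P' (fun w => \1_`]1, +oo[ (X n w)) @[M --> \oo] -->
    mean P (fun w => y ^+ N w).
  under eq_fun do under eq_bigr do rewrite meanG.
  have -> : (fun M => \sum_(n < M) (1 - y) * y ^+ n * mean P (G n)) =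
      (fun M => mean P (fun w => \sum_(n < M) (1 - y) * y ^+ n * G n w)).
    apply/funext => M; rewrite mean_sum; last by move=> n; exact: bmeasZ.
    by apply: eq_bigr => n _; rewrite meanZ.
  apply: (@mean_bounded_cvg _ _ _ _ _ _ 1).
  - by move=> M; have [] : bmeas (fun w => \sum_(n < M) (1 - y) * y ^+ n * G n w)
      by apply: bmeas_sum => n; exact: bmeasZ.
  - move=> M w; rewrite sumG; case: ifP => NM; last by rewrite normr0.
    have h1 : y ^+ N w <= 1 by rewrite exprn_ile1// ltW.
    have h2 : 0 <= y ^+ M by rewrite exprn_ge0.
    have h3 : y ^+ M <= y ^+ N w by apply: ler_wiXn2l; rewrite ?y0 ?(ltW y1)// ltnW.
    by rewrite ger0_norm ?subr_ge0//; lra.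
  - move=> w; rewrite -[X in _ --> X]subr0.
    apply: (@cvg_trans _ (y ^+ N w - y ^+ M @[M --> \oo])); last first.
      by apply: cvgB; [exact: cvg_cst|apply: cvg_expr; rewrite ger0_norm].
    apply: near_eq_cvg; near=> M; rewrite sumG ifT//; near: M.
    exact: nbhs_infty_gt.
have tailV t : 0 < t -> mean Q (fun w => \1_`]t, +oo[ (V w)) = mittag_leffler kappa (- (nu' * t `^ kappa)).
  by move=> t0; rewrite (tail_interarrival cdfD2).
have up t : 1 < t -> mittag_leffler kappa (- (nu' * t `^ kappa)) <= mean P (fun w => y ^+ N w).
  move=> t1; rewrite -tailV ?(lt_trans _ t1)//.
  exact: (mixture_tail_le mX mV X0 V0 y01 laplaceE tailE).
have down t : 0 < t -> t < 1 -> mean P (fun w => y ^+ N w) <= mittag_leffler kappa (- (nu' * t `^ kappa)).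
  move=> t0 t1; rewrite -tailV//.
  exact: (mixture_tail_ge mX mV X0 V0 y01 laplaceE tailE).
have -> : nu * (1 - y) = nu' * 1 `^ kappa by rewrite powR1 mulr1 mulrC.
have h0 : (n.+2%:R^-1 : R) @[n --> \oo] --> (0 : R).
  by have := @cvg_harmonic R; rewrite -cvg_shiftS.
have ni n : 0 < n.+2%:R^-1 :> R by rewrite invr_gt0.
have ni1 n : n.+2%:R^-1 < 1 :> R by rewrite invf_lt1// ltr1n.
(* The comparisons hold for t > 1 and t < 1 only; continuity of E_kappa closes the gap at t = 1. *)
apply/eqP; rewrite eq_le; apply/andP; split.
  have l : 1 - n.+2%:R^-1 @[n --> \oo] --> (1 : R).
    by rewrite -[X in _ --> X]subr0; apply: cvgB => //; exact: cvg_cst.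
  have pos n : 0 < 1 - n.+2%:R^-1 :> R by rewrite subr_gt0.
  have := mittag_leffler_powR_cvg kappa_gt0 kappa_le1 (ltW nu'0) ltr01 pos l.
  by move=> /cvgr_to_ge; apply; apply: nearW => n; apply: down => //; rewrite gtrBl.
have l : 1 + n.+2%:R^-1 @[n --> \oo] --> (1 : R).
  by rewrite -[X in _ --> X]addr0; apply: cvgD => //; exact: cvg_cst.
have pos n : 0 < 1 + n.+2%:R^-1 :> R by rewrite addr_gt0.
have := mittag_leffler_powR_cvg kappa_gt0 kappa_le1 (ltW nu'0) ltr01 pos l.
by move=> /cvgr_to_le; apply; apply: nearW => n; apply: up; rewrite ltrDl.
Unshelve. all: end_near. Qed.

End pgf.

(** * Characteristic functions *)

Section gaussian.
Context {R : realType}.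
Local Notation mu := (@lebesgue_measure R).
Local Notation p := (normal_pdf 0 1 : R -> R).

Let c : R := normal_peak 1.

Let pE x : p x = c * expR (- (x ^+ 2 / 2)).
Proof.
rewrite normal_pdfE ?oner_eq0// /c /normal_fun subr0 expr1n; congr (_ * expR _).
by rewrite mulNr.
Qed.

Let c0 : 0 < c. Proof. by rewrite normal_peak_gt0 ?oner_eq0. Qed.

Let p0 x : 0 <= p x. Proof. exact: normal_pdf_ge0. Qed.

Let cp : continuous p. Proof. by apply: continuous_normal_pdf; rewrite oner_eq0. Qed.

Let h m x : R := x ^+ m * p x.

Let ch m : continuous (h m).
Proof. by move=> x; apply: cvgM; [exact: exprn_continuous|exact: cp]. Qed.

Let mh m : measurable_fun setT (h m).
Proof. exact: continuous_measurable_fun. Qed.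

(** The antiderivative behind the recurrence E Z^(m + 2) = (m + 1) E Z^m. *)
Let dh m (x : R) : is_derive x 1 (fun x => - h m.+1 x) (h m.+2 x - m.+1%:R * h m x).
Proof.
have dE : is_derive x 1 (fun x : R => expR (- (x ^+ 2 / 2))) (- x * expR (- (x ^+ 2 / 2))).
  have d1 : is_derive x 1 (fun x : R => - (x ^+ 2 / 2)) (- x).
    by apply: is_derive_eq; rewrite /GRing.scale/=; field.
  have := @is_derive1_comp _ expR (fun x : R => - (x ^+ 2 / 2)) x _ _ (is_derive_expR _) d1.
  by rewrite mulrC.
have -> : (fun x => - h m.+1 x) = (fun x => - c * (x ^+ m.+1 * expR (- (x ^+ 2 / 2)))).
  by apply/funext => z; rewrite /h pE; ring.
have dX : is_derive x 1 (fun x : R => x ^+ m.+1) (m.+1%:R * x ^+ m).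
  have := @is_deriveX _ _ (@id R) m.+1 x 1 1 (is_derive_id x 1).
  by rewrite exprfctE /GRing.scale/= mulr1.
have d2 := is_deriveM dX dE.
have d3 := is_deriveZ (- c) d2.
apply: (is_derive_eq d3).
rewrite /h !pE /GRing.scale/= [X in _ = X * _ - _]exprSr exprSr.
by ring.
Qed.

Let I n : set R := `[- n.+2%:R, n.+2%:R]%classic.

Let itvI : setT = \bigcup_n I n :> set R.
Proof.
apply/esym/seteqP; split => // x _; exists (Num.truncn `|x|) => //.
rewrite /I /= in_itv/= -ler_norml.
rewrite (le_trans (ltW (truncnS_gt _)))// ler_nat.
exact: leqnSn.
Qed.

Let ndI : nondecreasing_seq I.
Proof.
move=> m n mn; apply/subsetPset => x; rewrite /I /= !in_itv/= -!ler_norml => /le_trans; apply.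
by rewrite ler_nat.
Qed.

Let mI n : measurable (I n). Proof. exact: measurable_itv. Qed.

Let h_even_ge0 m x : 0 <= h m.*2 x.
Proof. by rewrite mulr_ge0// -muln2 exprM sqr_ge0. Qed.

Let h_cvg m : ((\int[mu]_(x in I n) (h m.*2 x)%:E)%E @[n --> \oo] --> \int[mu]_x (h m.*2 x)%:E)%E.
Proof.
rewrite itvI; apply: ge0_nondecreasing_set_cvg_integral => //.
- by move=> n; apply/measurable_EFinP; apply: measurable_funTS; exact: mh.
- by move=> n x _; rewrite lee_fin.
Qed.

Let int_h m n : mu.-integrable (I n) (EFin \o h m).
Proof.
apply: continuous_compact_integrable; first exact: segment_compact.
by apply: continuous_subspaceT; exact: ch.
Qed.

Let h_itv m n : (\int[mu]_(x in I n) (h m.*2.+2 x)%:E =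
  (- (2 * h m.*2.+1 n.+2%:R))%:E + m.*2.+1%:R%:E * \int[mu]_(x in I n) (h m.*2 x)%:E)%E.
Proof.
have n0 : - n.+2%:R < n.+2%:R :> R by rewrite (@lt_trans _ _ 0)// oppr_lt0.
have := @ftc_itv _ (fun x => h m.*2.+2 x - m.*2.+1%:R * h m.*2 x) (fun x => - h m.*2.+1 x) _ _ n0.
move=> /(_ _ _)/wrap[].
- by move=> x _; exact: dh.
- by move=> x _; apply: cvgB; [exact: ch|apply: cvgM; [exact: cvg_cst|exact: ch]].
under eq_integral do rewrite EFinB (EFinM m.*2.+1%:R).
have fin k : (\int[mu]_(x in I n) (h k x)%:E)%E \is a fin_num.
  by apply: integrable_fin_num; [exact: measurable_itv|exact: int_h].
have ix : mu.-integrable (I n) (fun x => m.*2.+1%:R%:E * (h m.*2 x)%:E)%E.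
  by apply: integrableZl; [exact: mI|exact: int_h].
rewrite integralB; [|exact: mI|exact: int_h|exact: ix].
rewrite integralZl; [|exact: mI|exact: int_h].
have /fineK <- : (\int[mu]_(x in I n) (h m.*2.+2 x)%:E)%E \is a fin_num.
  exact: fin.
have /fineK <- : (\int[mu]_(x in I n) (h m.*2 x)%:E)%E \is a fin_num.
  exact: fin.
have -> : h m.*2.+1 (- n.+2%:R) = - h m.*2.+1 n.+2%:R.
  by rewrite /h !pE sqrrN exprNn -signr_odd /= odd_double /= expr1; ring.
rewrite -EFinM -EFinB => -[e]; rewrite -EFinD; congr EFin; lra.
Qed.

Let boundary_cvg m : h m n.+2%:R @[n --> \oo] --> (0 : R).
Proof.
have n2 : (n.+2%:R : R) @[n --> \oo] --> +oo.
  apply/cvgryPge => A; near=> n; apply: (@le_trans _ _ n%:R).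
    by near: n; exact: nbhs_infty_ger.
  by rewrite ler_nat -addn2 leq_addr.
apply: (@squeeze_cvgr _ _ _ _ (fun=> 0) (fun n => c * (n.+2%:R `^ m%:R * expR (- n.+2%:R)))).
- near=> n; rewrite /h pE mulr_ge0 ?exprn_ge0 ?mulr_ge0 ?(ltW c0) ?expR_ge0//=.
  rewrite mulrCA ler_wpM2l ?(ltW c0)// powR_mulrn// ler_wpM2l ?exprn_ge0//.
  rewrite ler_expR lerN2 ler_pdivlMr// expr2 ler_wpM2l// ler_nat.
  by [].
- exact: cvg_cst.
- rewrite -[X in _ --> X](mulr0 c); apply: cvgMr.
  exact: (cvg_comp _ _ n2 (powR_expR_cvg0 m%:R)).
Unshelve. all: end_near. Qed.

Lemma gaussian_moment m : (\int[mu]_x (x ^+ m.*2 * p x)%:E =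
  (m.*2`!%:R / (2 ^+ m * m`!%:R))%:E)%E.
Proof.
elim: m => [|m IH].
  rewrite /= !fact0 expr0 mulr1 divr1 -(integral_normal_pdf (0 : R) 1).
  by apply: eq_integral => x _; rewrite expr0 mul1r.
have h1 := @h_cvg m.+1.
have h2 : ((\int[mu]_(x in I n) (h m.+1.*2 x)%:E)%E @[n --> \oo] -->
    (0%:E + m.*2.+1%:R%:E * \int[mu]_x (h m.*2 x)%:E)%E)%classic.
  rewrite doubleS; under eq_fun do rewrite h_itv.
  apply: cvgeD => //; last by apply: cvgeZl => //; exact: h_cvg.
  apply: cvg_EFin; first exact: nearW.
  rewrite -[X in _ --> X]oppr0; apply: cvgN.
  rewrite -[X in _ --> X](mulr0 2); apply: cvgMr; exact: boundary_cvg.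
rewrite (cvg_unique _ h1 h2)// add0e IH -EFinM; congr EFin.
rewrite doubleS !factS !natrM exprS.
have f0 : m`!%:R != 0 :> R by rewrite pnatr_eq0 -lt0n fact_gt0.
have t0 : (2 : R) ^+ m != 0 by rewrite expf_neq0.
have m0 : m.+1%:R != 0 :> R by rewrite pnatr_eq0.
have -> : m.*2.+2%:R = 2 * m.+1%:R :> R by rewrite -doubleS -muln2 mulnC natrM.
move: (m.*2.+1%:R) (m.*2`!%:R) (m`!%:R) f0 (2 ^+ m) t0 (m.+1%:R) m0 => A B f f0 t t0 q q0.
by field; rewrite f0 t0 q0.
Qed.

Lemma density_normal_prob (m s : R) (f : R -> R) : bmeas f ->
  mean (normal_prob m s) f = Rintegral mu setT (fun x => f x * normal_pdf m s x).
Proof.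
move=> bf; apply: (@density_mean _ _ _ mu (normal_pdf m s)) => //.
- exact: normal_pdf_ge0.
- exact: measurable_normal_pdf.
Qed.

(** The cosine series is integrated termwise: with the even moments, [a m * b m] is the m-th term of
    the series of exp(- s^2 / 2), and the absolute series is that of exp(s^2 / 2). *)
Lemma gaussian_cos (s : R) :
  mean (normal_prob 0 1) (fun x => cos (s * x)) = expR (- (s ^+ 2 / 2)).
Proof.
have bc : bmeas (fun x : R => cos (s * x)) by exact: bmeas_cosM.
rewrite density_normal_prob//.
pose a m : R := (-1) ^+ m * s ^+ m.*2 / m.*2`!%:R.
pose b m : R := m.*2`!%:R / (2 ^+ m * m`!%:R).
have f0 n : n`!%:R != 0 :> R by rewrite pnatr_eq0 -lt0n fact_gt0.
have abE m : a m * b m = (- (s ^+ 2 / 2)) ^+ m / m`!%:R.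
  rewrite /a /b -[- (s ^+ 2 / 2)]mulN1r exprMn expr_div_n -exprM mulnC muln2.
  have t0 : (2 : R) ^+ m != 0 by rewrite expf_neq0.
  by field; rewrite !f0 t0.
have := @integral_series R _ _ mu setT (fun m x => x ^+ m.*2 * p x) (fun x => cos (s * x) * p x) a b
  measurableT.
move=> /(_ _ _ _ _ _)/wrap[].
- by move=> m; exact: mh.
- by move=> m x _; exact: h_even_ge0.
- by move=> m; exact: gaussian_moment.
- apply: (series_le_cvg _ _ _ (is_cvg_series_exp_coeff (s ^+ 2 / 2))) => // m.
  + by rewrite mulr_ge0// divr_ge0// mulr_ge0 ?exprn_ge0.
  + by rewrite /exp_coeff/= divr_ge0// exprn_ge0// divr_ge0// sqr_ge0.
  + have b0 : 0 <= b m by rewrite divr_ge0// mulr_ge0 ?exprn_ge0.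
    rewrite -[X in _ * X](ger0_norm b0) -normrM abE normrM normrX normrN.
    have s0 : 0 <= s ^+ 2 / 2 by rewrite divr_ge0// sqr_ge0.
    by rewrite (ger0_norm s0) [ `|_^-1|]ger0_norm ?invr_ge0.
- move=> x _; have := @cvg_cos_coeff' R (s * x) => cx.
  rewrite mulrC (_ : series _ = fun n => p x * series (cos_coeff' (s * x)) n).
    by apply: cvgMr.
  apply/funext => n; rewrite /series/= mulr_sumr; apply: eq_bigr => m _.
  by rewrite /a /cos_coeff' exprMn /exprz; ring.
move=> e; rewrite /Rintegral e/=.
rewrite (_ : series _ = series (exp_coeff (- (s ^+ 2 / 2))))//.
by apply/funext => n; apply: eq_bigr => m _; exact: abE.
Qed.

(** The integrand is odd. The substitution of - x for x is made on symmetric compact intervals,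
    which then exhaust the line. *)
Lemma gaussian_sin (s : R) : mean (normal_prob 0 1) (fun x => sin (s * x)) = 0.
Proof.
have bs : bmeas (fun x : R => sin (s * x)) by exact: bmeas_sinM.
have bI n : bmeas (\1_(I n) : R -> R) by exact: bmeas_indic.
have lim : mean (normal_prob 0 1) (fun x => sin (s * x) * \1_(I n) x) @[n --> \oo] -->
    mean (normal_prob 0 1) (fun x => sin (s * x)).
  apply: (@mean_bounded_cvg _ _ _ _ _ _ 1).
  - by move=> n; apply: measurable_funM; [exact: bs.1|exact: (bI n).1].
  - move=> n x; rewrite normrM -[leRHS]mulr1 ler_pM// ?sin_max//.
    by rewrite indicE; case: (_ \in _); rewrite ?normr1 ?normr0.
  - move=> x; rewrite -[X in _ --> X]mulr1; apply: cvgM; first exact: cvg_cst.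
    apply: (@cvg_trans _ ((1 : R) @[n --> \oo])); last exact: cvg_cst.
    apply: near_eq_cvg; have : (\bigcup_n I n) x by rewrite -itvI.
    move=> [k _ Ik]; exists k => // n /= kn; rewrite indicE mem_set//.
    by have /subsetPset := ndI kn; exact.
suff z n : mean (normal_prob 0 1) (fun x => sin (s * x) * \1_(I n) x) = 0.
  by move: lim; under eq_fun do rewrite z; move=> lim; exact: (cvg_unique _ lim (cvg_cst _)).
rewrite density_normal_prob; last exact: bmeasM.
transitivity (Rintegral mu (I n) (fun x => sin (s * x) * p x)).
  rewrite [RHS]Rintegral_mkcond; apply: eq_Rintegral => x _.
  by rewrite patchE indicE; case: (x \in I n); rewrite ?mulr1 ?mulr0 ?mul0r.
have n0 : - n.+2%:R <= n.+2%:R :> R by rewrite (@le_trans _ _ 0)// oppr_le0.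
have cG : continuous (fun x : R => sin (s * x) * p x).
  move=> x; apply: cvgM; last exact: cp.
  apply: (continuous_comp (g := sin)); last exact: continuous_sin.
  by apply: cvgM; [exact: cvg_cst|exact: cvg_id].
have := @integration_by_substitution_oppr R (fun x => sin (s * x) * p x) _ _ n0.
rewrite opprK => /(_ _)/wrap[]; first by apply: continuous_subspaceT; exact: cG.
move=> e; have e2 : Rintegral mu (I n) (fun x => sin (s * x) * p x) =
    - Rintegral mu (I n) (fun x => sin (s * x) * p x).
  transitivity (Rintegral mu (I n) (fun x => -1 * (sin (s * x) * p x))).
    rewrite /Rintegral; congr fine; apply: (eq_trans e); apply: eq_integral => x _ /=.
    by rewrite mulrN sinN !pE sqrrN; congr EFin; ring.
  rewrite RintegralZl; [by rewrite mulN1r|exact: measurable_itv|].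
  apply: continuous_compact_integrable; first exact: segment_compact.
  exact: continuous_subspaceT.
move: e2; move: (Rintegral _ _ _) => r; lra.
Qed.

End gaussian.

(** * Gaussian smoothing and the continuity theorem *)

Section gaussian_smoothing.
Context {R : realType}.
Local Notation mu := (@lebesgue_measure R).
Implicit Types (h : R -> R) (x s e M L : R).

(** The density at scale s is compared with the one at scale 2 s: their quotient is 2 exp(- (1/2 -
    1/8) (y - x)^2 / s^2), whence the 3 / 8. *)
Lemma normal_tail x s e : 0 < s -> 0 < e ->
  mean (normal_prob x s) (\1_[set y | e <= `|y - x|]) <= 2 * expR (- (3 / 8 * (e / s) ^+ 2)).
Proof.
move=> s0 e0; have sn0 : s != 0 by rewrite gt_eqF.
have s2n0 : 2 * s != 0 by rewrite mulf_neq0.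
have mA : measurable [set y | e <= `|y - x|].
  have m : measurable_fun setT (fun y : R => `|y - x|).
    by apply: measurableT_comp => //; exact: measurable_funB.
  have := m measurableT `[e, +oo[%classic (measurable_itv _).
  rewrite setTI (_ : _ @^-1` _ = [set y | e <= `|y - x|])//.
  by apply/seteqP; split => y; rewrite /= in_itv/= andbT.
have pdf_le y : e <= `|y - x| ->
    normal_pdf x s y <= 2 * expR (- (3 / 8 * (e / s) ^+ 2)) * normal_pdf x (2 * s) y.
  move=> ey; rewrite !normal_pdfE// /normal_fun.
  have -> : normal_peak (2 * s) = normal_peak s / 2 :> R.
    rewrite /normal_peak -invfM; congr (_^-1).
    have -> : (2 * s) ^+ 2 * pi *+ 2 = (s ^+ 2 * pi *+ 2) * 2 ^+ 2 :> R.
      by move: (pi : R) => q; ring.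
    rewrite sqrtrM; last by rewrite mulrn_wge0// mulr_ge0 ?sqr_ge0 ?pi_ge0.
    by rewrite sqrtr_sqr ger0_norm// mulrC.
  have -> : 2 * expR (- (3 / 8 * (e / s) ^+ 2)) * (normal_peak s / 2 *
      expR (- (y - x) ^+ 2 / ((2 * s) ^+ 2 *+ 2))) = normal_peak s *
      expR (- (3 / 8 * (e / s) ^+ 2) + - (y - x) ^+ 2 / ((2 * s) ^+ 2 *+ 2)) :> R.
    by rewrite expRD; move: (normal_peak s) (expR _) (expR _) => q A B; field.
  rewrite ler_wpM2l ?normal_peak_ge0// ler_expR.
  have h : e ^+ 2 <= (y - x) ^+ 2.
    by rewrite -[leRHS]real_normK ?num_real// lerXn2r ?nnegrE// ltW.
  have -> : - (y - x) ^+ 2 / (s ^+ 2 *+ 2) = - (3 / 8 * ((y - x) ^+ 2 / s ^+ 2)) +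
      - (y - x) ^+ 2 / ((2 * s) ^+ 2 *+ 2).
    by field.
  rewrite lerD2r lerN2 ler_wpM2l ?divr_ge0// expr_div_n ler_wpM2r// invr_ge0 sqr_ge0.
  by [].
rewrite density_normal_prob; last exact: bmeas_indic.
have ip : mu.-integrable setT (EFin \o normal_pdf x (2 * s)) by exact: integrable_normal_pdf.
have ip1 : mu.-integrable setT (EFin \o normal_pdf x s) by exact: integrable_normal_pdf.
set c := 2 * expR _.
have -> : c = Rintegral mu setT (fun y => c * normal_pdf x (2 * s) y).
  rewrite RintegralZl// (_ : Rintegral _ _ _ = 1) ?mulr1//.
  by rewrite /Rintegral integral_normal_pdf.
have c0 : 0 <= c by rewrite mulr_ge0// expR_ge0.
apply: le_Rintegral => //.
- apply: (le_integrable _ _ _ ip1) => //.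
    apply/measurable_EFinP; apply: measurable_funM; last exact: measurable_normal_pdf.
    exact: measurable_indic.
  move=> y _ /=; rewrite lee_fin normrM ler_piMl// indicE.
  by case: (_ \in _); rewrite ?normr1 ?normr0.
- rewrite (_ : _ \o _ = (fun y => c%:E * (normal_pdf x (2 * s) y)%:E)%E).
    exact: integrableZl.
  by apply/funext => y /=; rewrite EFinM.
- move=> y _; rewrite indicE; have [ey|_] := boolP (y \in _).
    by rewrite mul1r; apply: pdf_le; move: ey; rewrite inE.
  by rewrite mul0r mulr_ge0// normal_pdf_ge0.
Qed.

Lemma gaussian_smoothing_le h M e a s x : measurable_fun setT h ->
  (forall y, `|h y| <= M) -> 0 < s -> 0 < e ->
  (forall y, `|y - x| < e -> `|h y - h x| <= a) ->
  `|mean (normal_prob x s) h - h x| <= a + 4 * M * expR (- (3 / 8 * (e / s) ^+ 2)).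
Proof.
move=> mh hM s0 e0 ha.
have bh : bmeas h by split => //; exists M.
have M0 : 0 <= M by exact: le_trans (hM 0).
have a0 : 0 <= a.
  by have := ha x; rewrite !subrr normr0; apply.
have mA : measurable [set y | e <= `|y - x|].
  have m : measurable_fun setT (fun y : R => `|y - x|).
    by apply: measurableT_comp => //; exact: measurable_funB.
  have := m measurableT `[e, +oo[%classic (measurable_itv _).
  rewrite setTI (_ : _ @^-1` _ = [set y | e <= `|y - x|])//.
  by apply/seteqP; split => y; rewrite /= in_itv/= andbT.
have bA : bmeas (\1_[set y | e <= `|y - x|] : R -> R) by exact: bmeas_indic.
have bd : bmeas (fun y => a + 2 * M * \1_[set y | e <= `|y - x|] y).
  by apply: bmeasD; [exact: bmeas_cst|exact: bmeasZ].
have le y : `|h y - h x| <= a + 2 * M * \1_[set y | e <= `|y - x|] y.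
  rewrite indicE; have [ey|/negP ey] := boolP (y \in _).
    rewrite mulr1 (le_trans (ler_normB _ _))// (le_trans (lerD (hM y) (hM x)))//.
    by rewrite mulr_natl mulr2n lerDr.
  rewrite mulr0 addr0; apply: ha; rewrite ltNge; apply/negP => h1.
  by apply: ey; rewrite inE.
have -> : mean (normal_prob x s) h - h x = mean (normal_prob x s) (fun y => h y - h x).
  by rewrite meanB ?mean_cst//; exact: bmeas_cst.
have bhx : bmeas (fun y => h y - h x) by apply: bmeasB => //; exact: bmeas_cst.
apply: (@le_trans _ _ (mean (normal_prob x s) (fun y => a + 2 * M * \1_[set y | e <= `|y - x|] y))).
  rewrite ler_norml; apply/andP; split.
    rewrite -mulN1r -meanZ//; apply: le_mean => //; first exact: bmeasZ.
    by move=> y; have := le y; rewrite mulN1r ler_norml => /andP[].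
  by apply: le_mean => // y; exact: le_trans (ler_norm _) (le y).
rewrite meanD; [|exact: bmeas_cst|exact: bmeasZ].
rewrite mean_cst meanZ// lerD2l.
have := normal_tail x s0 e0.
have M2 : 0 <= 2 * M by rewrite mulr_ge0.
by move=> /(ler_wpM2l M2) /le_trans; apply; lra.
Qed.

Lemma gaussian_smoothing_uniform h M a : measurable_fun setT h -> 0 < a ->
  (forall y, `|h y| <= M) ->
  (exists2 e : R, 0 < e & forall x y, `|y - x| < e -> `|h y - h x| <= a) ->
  exists2 s : R, 0 < s & forall x, `|mean (normal_prob x s) h - h x| <= 2 * a.
Proof.
move=> mh a0 hM [e e0 he].
have M0 : 0 <= M by exact: le_trans (hM 0).
(* At scale s = e / A the error is 4 M exp(- u) with u = 3/8 A^2. From A >= 4 one gets u >= A > 4 M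
   / a, and exp(- u) <= 1 / u brings the error below a. *)
pose A := 4 * (M / a) + 4.
have Ma : 0 <= M / a by rewrite divr_ge0// ltW.
have A4 : 4 <= A by rewrite /A; lra.
have A0 : 0 < A by lra.
exists (e / A); first by rewrite divr_gt0.
move=> x; have s0 : 0 < e / A by rewrite divr_gt0.
apply: (le_trans (gaussian_smoothing_le mh hM s0 e0 (he x))).
rewrite [leRHS]mulr_natl mulr2n lerD2l.
have -> : e / (e / A) = A by rewrite invfM invrK mulrA mulfV ?mul1r// gt_eqF.
set u := 3 / 8 * A ^+ 2.
have u0 : 4 * (M / a) + 4 <= u by rewrite /u -/A expr2; nra.
have up : 0 < u by lra.
have eu : expR (- u) <= u^-1.
  rewrite expRN lef_pV2 ?posrE ?expR_gt0//.
  by have := expR_ge1Dx u; lra.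
have M4 : 0 <= 4 * M by rewrite mulr_ge0.
apply: (le_trans (ler_wpM2l M4 eu)).
rewrite ler_pdivrMr//.
apply: (@le_trans _ _ (a * (4 * (M / a)))).
  by rewrite mulrCA [a * _]mulrC divfK ?gt_eqF// mulr_natl.
by rewrite ler_wpM2l ?(ltW a0)//; lra.
Qed.

Section fourier_representation.
Variables (h : R -> R) (L s : R).
Hypothesis bh : bmeas h.
Hypothesis L0 : 0 < L.
Hypothesis s0 : 0 < s.
Hypothesis hL : forall y, L < `|y| -> h y = 0.

Let g (y : R) : R := (2 * L)^-1 * \1_(`[- L, L]%classic : set R) y.

Let g0 y : 0 <= g y.
Proof. by rewrite mulr_ge0// invr_ge0 mulr_ge0// ltW. Qed.

Let mg : measurable_fun setT g.
Proof.
by apply: measurable_funM => //; apply: measurable_indic; exact: measurable_itv.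
Qed.

Let int_g : (\int[mu]_y (g y)%:E = 1)%E.
Proof.
have mI : measurable (`[- L, L]%classic : set R) by exact: measurable_itv.
under eq_integral do rewrite EFinM.
rewrite ge0_integralZl//; last 2 first.
- by apply/measurable_EFinP; exact: measurable_indic.
- by rewrite lee_fin invr_ge0 mulr_ge0// ltW.
rewrite integral_indic// setIT.
have e := @lebesgue_measure_itv R `[- L, L].
have LL : - L < L by rewrite gtrN.
rewrite [X in (_ * X)%E]e/= lte_fin LL -EFinB -EFinM; congr EFin.
by field; rewrite gt_eqF.
Qed.

Let F d (T : measurableType d) (X : T -> R) (z : T * (measurableTypeR R * measurableTypeR R)) : R :=
  h z.2.1 * cos ((z.2.2 : R) * (((z.2.1 : R) - X z.1) / s)).

Let bF d (T : measurableType d) (X : T -> R) : measurable_fun setT X -> bmeas (F X).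
Proof.
move=> mX; apply: bmeasM.
  by apply: bmeas_comp bh _; apply: measurableT_comp => //; exact: measurableT_comp.
apply: bmeas_comp bmeas_cos _; apply: measurable_funM.
  by apply: measurableT_comp => //; exact: measurableT_comp.
apply: measurable_funM => //; apply: measurable_funB.
  by apply: measurableT_comp => //; exact: measurableT_comp.
exact: measurableT_comp.
Qed.

(** Up to its peak, the Gaussian density at (y - x) / s is itself a Gaussian characteristic
    function, so the smoothed mean depends on X only through its characteristic function. The
    support of h lets y be averaged over the uniform law on [- L, L]. [K] and [P0] do not depend on
    X, which permits limits under [P0]. *)
Lemma gaussian_smoothing_fourier : exists (K : R) (P0 : probability (measurableTypeR R * measurableTypeR R)%type R),
  forall d (T : measurableType d) (P : probability T R) (X : T -> R),
    measurable_fun setT X ->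
    bmeas (fun w => mean (normal_prob (X w) s) h) /\
    mean P (fun w => mean (normal_prob (X w) s) h) =
    K * mean P0 (fun z => h z.1 *
      (cos (z.2 / s * z.1) * mean P (fun w => cos (z.2 / s * X w)) +
       sin (z.2 / s * z.1) * mean P (fun w => sin (z.2 / s * X w)))).
Proof.
have [U UE] := @density_probability R _ (measurableTypeR R) mu g g0 mg int_g.
pose G : probability (measurableTypeR R) R := normal_prob 0 1.
pose K := 2 * L * normal_peak s.
pose P0 : probability (measurableTypeR R * measurableTypeR R)%type R := (U \x G)%E.
exists K, P0 => d T P X mX.
have bFX := bF mX.
have repr x : mean (normal_prob x s) h =
    K * mean P0 (fun z => h z.1 * cos (z.2 * ((z.1 - x) / s))).
  have bFx : bmeas (fun z : measurableTypeR R * measurableTypeR R => h z.1 * cos (z.2 * ((z.1 - x) / s))).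
    have := bF (@measurable_cst _ _ R R setT x).
    by move=> b; exact: (bmeas_section1 b (0 : R)).
  rewrite /P0 mean_prod//.
  have inner y : mean G (fun z => h y * cos (z * ((y - x) / s))) =
      h y * expR (- (((y - x) / s) ^+ 2 / 2)).
    under eq_fun do rewrite [_ * ((y - x) / s)]mulrC.
    by rewrite meanZ ?gaussian_cos//; exact: bmeas_cosM.
  have bi : bmeas (fun y => mean G (fun z => h y * cos (z * ((y - x) / s)))).
    exact: (bmeas_mean2 U G bFx).
  rewrite -meanZ//.
  rewrite (@density_mean _ _ _ mu g g0 mg U _ _ (bmeasZ K bi)); last by move=> A _; exact: UE.
  rewrite density_normal_prob//; apply: eq_Rintegral => y _.
  rewrite inner normal_pdfE ?gt_eqF// /normal_fun /g indicE.
  have -> : - (y - x) ^+ 2 / (s ^+ 2 *+ 2) = - (((y - x) / s) ^+ 2 / 2).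
    by field; rewrite gt_eqF.
  have [yL|yL] := boolP (y \in _).
    rewrite /K mulr1; move: (normal_peak s) (expR _) (h y) => q E hy.
    by field; rewrite gt_eqF.
  rewrite hL; first by rewrite !(mul0r, mulr0).
  rewrite ltNge; apply: contra yL; rewrite inE /= in_itv/=.
  by rewrite -ler_norml.
split.
  under eq_fun do rewrite repr; apply: bmeasZ.
  exact: (bmeas_mean2 P P0 bFX).
under eq_fun do rewrite repr.
rewrite meanZ; last exact: (bmeas_mean2 P P0 bFX).
congr (_ * _).
rewrite (mean_swap P P0 bFX); congr mean; apply/funext => -[y z] /=.
transitivity (mean P (fun w => h y * (cos (z / s * y) * cos (z / s * X w) +
    sin (z / s * y) * sin (z / s * X w)))).
  congr mean; apply/funext => w; rewrite /F /=; congr (_ * _).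
  rewrite -[RHS]cosB; congr cos; ring.
have bc := bmeas_cosM mX (z / s); have bs := bmeas_sinM mX (z / s).
by rewrite meanZ ?meanD ?meanZ//; [exact: bmeasZ..|apply: bmeasD; exact: bmeasZ].
Qed.

End fourier_representation.
End gaussian_smoothing.

Section compact_support.
Context {R : realType}.
Implicit Types (h : R -> R) (x L : R).

Lemma compact_support_unif_continuous h L : continuous h ->
  (forall y, L < `|y| -> h y = 0) -> forall a : R, 0 < a ->
  exists2 e : R, 0 < e & forall x y, `|y - x| < e -> `|h y - h x| <= a.
Proof.
move=> ch hL a a0.
(* One unit wider than the support: with e < 1, a point x outside [A] has all its e-neighbours
   beyond L, where h vanishes. *)
pose A := (`[- (L + 1), L + 1]%classic : set R).
have cA : compact A by exact: segment_compact.
pose P (e x : R) := forall y, `|y - x| < e -> `|h y - h x| <= a.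
have nearP x : A x -> \forall x' \near x & e \near 0^'+, P e x'.
  move=> _; have a2 : 0 < a / 2 by rewrite divr_gt0.
  have /cvgrPdist_le/(_ _ a2) := ch x.
  move=> /nbhs_ballP[r /= r0 br].
  have r2 : 0 < r / 2 by rewrite divr_gt0.
  exists (ball x (r / 2), [set e : R | e < r / 2]) => /=.
    by split; [exact: nbhsx_ballx|exact: nbhs_right_lt].
  move=> [x' e] [/= bx' er] y ye.
  have hx' : `|h x - h x'| <= a / 2.
    apply: br; rewrite /ball /= in bx' *; apply: (lt_trans bx').
    by rewrite ltr_pdivrMr// ltr_pMr// ltr1n.
  have hy : `|h x - h y| <= a / 2.
    apply: br; rewrite /ball /= in bx' *.
    have -> : x - y = (x - x') - (y - x') by ring.
    rewrite (le_lt_trans (ler_normB _ _))//.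
    by rewrite [ltRHS]splitr ltrD// (lt_trans ye).
  have -> : h y - h x' = (h x - h x') - (h x - h y) by ring.
  by rewrite (le_trans (ler_normB _ _))// [leRHS]splitr lerD.
have := (compact_near_coveringP A).1 cA _ _ (fun e => P e) _ nearP.
move=> /(_ _) near0.
have [e [e0 [e1 eP]]] : exists e : R, 0 < e /\ e < 1 /\ A `<=` P e.
  near (0 : R)^'+ => e; exists e; split; first by near: e; exact: nbhs_right_gt.
  split; first by near: e; exact: nbhs_right_lt.
  by near: e; exact: near0.
exists e => // x y xy; have [Ax|Ax] := pselect (A x); first exact: eP.
have xL : L + 1 < `|x|.
  by rewrite ltNge; apply/negP => xL; apply: Ax; rewrite /A /= in_itv/= -ler_norml.
have yL : L < `|y|.
  have : `|x| <= `|y| + `|y - x|.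
    by rewrite {1}(_ : x = y - (y - x)) ?ler_normB//; ring.
  by lra.
rewrite !hL// ?subrr ?normr0 ?(ltW a0)//.
by rewrite (lt_trans _ xL)// ltrDl.
Unshelve. all: end_near. Qed.

(* The clamp of u to [0, 1] is (|u| - |u - 1| + 1) / 2. *)
Definition cutoff L x : R := (`|L + 1 - `|x| | - `|L - `|x| | + 1) / 2.

Lemma continuous_cutoff L : continuous (cutoff L).
Proof.
move=> x; apply: cvgM; last exact: cvg_cst.
have cn : `|y| @[y --> x] --> `|x| by apply: cvg_norm; exact: cvg_id.
apply: cvgD; last exact: cvg_cst.
by apply: cvgB; apply: cvg_norm; apply: cvgB => //; exact: cvg_cst.
Qed.

Lemma cutoff01 L x : 0 <= cutoff L x <= 1.
Proof.
rewrite /cutoff; move: ( `|x| : R) => u.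
have e1 : `|L + 1 - u| <= `|L - u| + 1.
  have -> : L + 1 - u = (L - u) + 1 by ring.
  by rewrite (le_trans (ler_normD _ _))// normr1.
have e2 : `|L - u| <= `|L + 1 - u| + 1.
  have -> : L - u = (L + 1 - u) - 1 by ring.
  by rewrite (le_trans (ler_normB _ _))// normr1.
by lra.
Qed.

Lemma cutoff1 L x : `|x| <= L -> cutoff L x = 1.
Proof.
move=> xL; rewrite /cutoff (@ger0_norm _ (L + 1 - _)) ?(@ger0_norm _ (L - _)).
- by field.
- by rewrite subr_ge0.
- by rewrite subr_ge0 (le_trans xL)// lerDl.
Qed.

Lemma cutoff0 L x : L + 1 < `|x| -> cutoff L x = 0.
Proof.
move=> xL; rewrite /cutoff (@ltr0_norm _ (L + 1 - _)) ?(@ltr0_norm _ (L - _)); [by field|lra|lra].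
Qed.

End compact_support.

Section levy_continuity.
Context {R : realType} d d' (T : measurableType d) (T' : measurableType d').
Variables (P : probability T R) (Q : probability T' R).
Variables (X : nat -> T -> R) (Y : T' -> R).
Hypothesis mX : forall n, measurable_fun setT (X n).
Hypothesis mY : measurable_fun setT Y.
Hypothesis cvg_cos : forall s : R,
  mean P (fun w => cos (s * X n w)) @[n --> \oo] --> mean Q (fun w => cos (s * Y w)).
Hypothesis cvg_sin : forall s : R,
  mean P (fun w => sin (s * X n w)) @[n --> \oo] --> mean Q (fun w => sin (s * Y w)).

Let smoothed_cvg (h : R -> R) (L s : R) : bmeas h -> 0 < L -> 0 < s ->
  (forall y, L < `|y| -> h y = 0) ->
  mean P (fun w => mean (normal_prob (X n w) s) h) @[n --> \oo] -->
  mean Q (fun w => mean (normal_prob (Y w) s) h).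
Proof.
move=> bh L0 s0 hL; have [K [P0 KP]] := gaussian_smoothing_fourier bh L0 s0 hL.
have [_ ->] := KP _ _ Q _ mY.
under eq_fun => n do rewrite (KP _ _ P _ (mX n)).2.
apply: cvgMr; have [mh [M hM]] := bh.
have bc : bmeas (fun z : measurableTypeR R * measurableTypeR R => cos ((z.2 : R) / s * z.1)).
  apply: bmeas_comp bmeas_cos _; apply: measurable_funM => //.
  by apply: measurable_funM => //; exact: measurable_snd.
have bs : bmeas (fun z : measurableTypeR R * measurableTypeR R => sin ((z.2 : R) / s * z.1)).
  apply: bmeas_comp bmeas_sin _; apply: measurable_funM => //.
  by apply: measurable_funM => //; exact: measurable_snd.
have bhz : bmeas (fun z : measurableTypeR R * measurableTypeR R => h z.1).
  exact: bmeas_comp bh measurable_fst.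
have bC n : bmeas (fun z : measurableTypeR R * measurableTypeR R =>
    mean P (fun w => cos ((z.2 : R) / s * X n w))).
  have b : bmeas (fun p : (measurableTypeR R * measurableTypeR R) * T => cos ((p.1.2 : R) / s * X n p.2)).
    apply: bmeas_comp bmeas_cos _; apply: measurable_funM.
      by apply: measurable_funM => //; exact: measurableT_comp measurable_snd measurable_fst.
    exact: measurableT_comp (mX n) measurable_snd.
  exact: (bmeas_mean2 P0 P b).
have bS n : bmeas (fun z : measurableTypeR R * measurableTypeR R =>
    mean P (fun w => sin ((z.2 : R) / s * X n w))).
  have b : bmeas (fun p : (measurableTypeR R * measurableTypeR R) * T => sin ((p.1.2 : R) / s * X n p.2)).
    apply: bmeas_comp bmeas_sin _; apply: measurable_funM.
      by apply: measurable_funM => //; exact: measurableT_comp measurable_snd measurable_fst.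
    exact: measurableT_comp (mX n) measurable_snd.
  exact: (bmeas_mean2 P0 P b).
apply: (@mean_bounded_cvg _ _ _ _ _ _ (M * 2)).
- move=> n; have [] : bmeas (fun z : measurableTypeR R * measurableTypeR R => h z.1 *
     (cos ((z.2 : R) / s * z.1) * mean P (fun w => cos ((z.2 : R) / s * X n w)) +
      sin ((z.2 : R) / s * z.1) * mean P (fun w => sin ((z.2 : R) / s * X n w)))) by
    apply: bmeasM => //; apply: bmeasD; exact: bmeasM.
  by [].
- move=> n z; rewrite normrM ler_pM// (le_trans (ler_normD _ _))//.
  have c1 : `|mean P (fun w => cos ((z.2 : R) / s * X n w))| <= 1.
    by apply: norm_mean_le; [exact: bmeas_cosM|move=> w; exact: cos_max].
  have s1 : `|mean P (fun w => sin ((z.2 : R) / s * X n w))| <= 1.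
    by apply: norm_mean_le; [exact: bmeas_sinM|move=> w; exact: sin_max].
  rewrite !normrM -[2]/(1 + 1) lerD// -[leRHS]mulr1 ler_pM//; [exact: cos_max|exact: sin_max].
- move=> z; apply: cvgMr; apply: cvgD; apply: cvgMr; [exact: cvg_cos|exact: cvg_sin].
Qed.

Let mean_dist d0 (T0 : measurableType d0) (P0 : probability T0 R) (u v : T0 -> R) (a : R) :
  bmeas u -> bmeas v -> (forall w, `|u w - v w| <= a) -> `|mean P0 u - mean P0 v| <= a.
Proof. by move=> bu bv uv; rewrite -meanB//; apply: norm_mean_le => //; exact: bmeasB. Qed.

Let compact_support_cvg (h : R -> R) (L : R) : continuous h -> bmeas h -> 0 < L ->
  (forall y, L < `|y| -> h y = 0) ->
  mean P (fun w => h (X n w)) @[n --> \oo] --> mean Q (fun w => h (Y w)).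
Proof.
move=> ch bh L0 hL; have [mh [M hM]] := bh.
apply/cvgrPdist_le => e e0.
have e8 : 0 < e / 8 by rewrite divr_gt0.
have [s s0 hs] := gaussian_smoothing_uniform mh e8 hM (compact_support_unif_continuous ch hL e8).
have [K [P0 KP]] := gaussian_smoothing_fourier bh L0 s0 hL.
have e2 : 0 < e / 2 by rewrite divr_gt0.
have /cvgrPdist_le/(_ _ e2) := smoothed_cvg bh L0 s0 hL.
apply: filterS => n hn.
have bhX : bmeas (fun w => h (X n w)) by exact: bmeas_comp (mX n).
have bhY : bmeas (fun w => h (Y w)) by exact: bmeas_comp mY.
have dX := mean_dist P (KP _ _ P _ (mX n)).1 bhX (fun w => hs (X n w)).
have dY := mean_dist Q (KP _ _ Q _ mY).1 bhY (fun w => hs (Y w)).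
move: dX dY hn; move: (mean P _) (mean P _) (mean Q _) (mean Q _) => a b c d0.
by rewrite !ler_distl; lra.
Qed.

(** The limit being a given Y, tightness is not a separate issue: the means of a cutoff under X_n
    converge to its mean under Y, which is close to 1, so truncating f costs little on both
    sides. *)
Theorem levy_continuity (f : R -> R) (M : R) : continuous f -> (forall x, `|f x| <= M) ->
  mean P (fun w => f (X n w)) @[n --> \oo] --> mean Q (fun w => f (Y w)).
Proof.
move=> cf fM.
have mf : measurable_fun setT f by exact: continuous_measurable_fun.
have bf : bmeas f by split => //; exists M.
have M0 : 0 <= M by exact: le_trans (fM 0).
have bc L : bmeas (cutoff L : R -> R).
  split; first by apply: continuous_measurable_fun; exact: continuous_cutoff.
  by exists 1 => x; have /andP[h0 h1] := cutoff01 L x; rewrite ger0_norm.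
have tight : mean Q (fun w => cutoff k%:R (Y w)) @[k --> \oo] --> (1 : R).
  rewrite -[X in _ --> X](mean_cst Q).
  apply: (@mean_bounded_cvg _ _ _ _ _ _ 1).
  - by move=> k; have [] := bmeas_comp (bc k%:R) mY.
  - by move=> k w; have /andP[h0 h1] := cutoff01 k%:R (Y w); rewrite ger0_norm.
  - move=> w; apply: (@cvg_trans _ ((1 : R) @[k --> \oo])); last exact: cvg_cst.
    apply: near_eq_cvg; near=> k; rewrite cutoff1//.
    by near: k; exact: nbhs_infty_ger.
apply/cvgrPdist_le => e e0.
(* Chosen so that a M <= e / 8; the M + 1 avoids dividing by zero. *)
pose a : R := e / (8 * (M + 1)).
have a0 : 0 < a by rewrite divr_gt0// mulr_gt0// ltr_wpDl.
have aM : a * M <= e / 8.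
  have aE : 8 * (a * M) + 8 * a = e.
    have M1 : M + 1 != 0 by rewrite gt_eqF// ltr_wpDl.
    by rewrite /a; field.
  by lra.
have /cvgrPdist_le/(_ _ a0)[k0 _ hk0] := tight.
pose L : R := k0.+1%:R; have L0 : 0 < L + 1 by rewrite ltr_wpDl.
have tL := hk0 k0.+1 (leqnSn k0).
have z0 y : L + 1 < `|y| -> cutoff L y = 0 by exact: cutoff0.
have z1 y : L + 1 < `|y| -> f y * cutoff L y = 0 by move=> /cutoff0 ->; rewrite mulr0.
have cfc : continuous (fun y => f y * cutoff L y).
  by move=> y; apply: cvgM; [exact: cf|exact: continuous_cutoff].
have bfc : bmeas (fun y => f y * cutoff L y) by exact: bmeasM.
have /cvgrPdist_le/(_ _ a0) h1 := compact_support_cvg (@continuous_cutoff R L) (bc L) L0 z0.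
have e8 : 0 < e / 8 by rewrite divr_gt0.
have /cvgrPdist_le/(_ _ e8) h2 := compact_support_cvg cfc bfc L0 z1.
have trunc d0 (T0 : measurableType d0) (P0 : probability T0 R) (Z : T0 -> R) :
    measurable_fun setT Z ->
    `|mean P0 (fun w => f (Z w)) - mean P0 (fun w => f (Z w) * cutoff L (Z w))| <=
    M * (1 - mean P0 (fun w => cutoff L (Z w))).
  move=> mZ; have bfZ : bmeas (fun w => f (Z w)) by exact: bmeas_comp mZ.
  have bcZ : bmeas (fun w => cutoff L (Z w)) by exact: bmeas_comp (bc L) mZ.
  have bfcZ : bmeas (fun w => f (Z w) * cutoff L (Z w)) by exact: bmeasM.
  have b1 : bmeas (fun w => M * (1 - cutoff L (Z w))).
    by apply: bmeasZ; apply: bmeasB => //; exact: bmeas_cst.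
  have -> : M * (1 - mean P0 (fun w => cutoff L (Z w))) = mean P0 (fun w => M * (1 - cutoff L (Z w))).
    by rewrite meanZ ?meanB ?mean_cst//; [exact: bmeas_cst|apply: bmeasB => //; exact: bmeas_cst].
  rewrite -meanB//.
  have bB := bmeasB bfZ bfcZ.
  have le w : `|f (Z w) - f (Z w) * cutoff L (Z w)| <= M * (1 - cutoff L (Z w)).
    have /andP[c0 c1] := cutoff01 L (Z w).
    have -> : f (Z w) - f (Z w) * cutoff L (Z w) = f (Z w) * (1 - cutoff L (Z w)) by ring.
    by rewrite normrM [X in _ * X]ger0_norm ?subr_ge0// ler_wpM2r// subr_ge0.
  rewrite ler_norml; apply/andP; split; last first.
    by apply: le_mean => // w; exact: le_trans (ler_norm _) (le w).
  rewrite -mulN1r -meanZ//; apply: le_mean => //; first exact: bmeasZ.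
  by move=> w; have := le w; rewrite mulN1r ler_norml => /andP[].
near=> n.
have n1 : `|mean Q (fun w => cutoff L (Y w)) - mean P (fun w => cutoff L (X n w))| <= a.
  by near: n; exact: h1.
have n2 : `|mean Q (fun w => f (Y w) * cutoff L (Y w)) -
   mean P (fun w => f (X n w) * cutoff L (X n w))| <= e / 8 by near: n; exact: h2.
have tX := trunc _ _ P _ (mX n); have tY := trunc _ _ Q _ mY.
set cX := mean P (fun w => cutoff L (X n w)) in n1 tX.
set cY := mean Q (fun w => cutoff L (Y w)) in n1 tY tL.
have bX : M * (1 - cX) <= 2 * (e / 8).
  rewrite !ler_distl in n1 tL; have h3 : 1 - cX <= 2 * a by lra.
  by apply: (le_trans (ler_wpM2l M0 h3)); lra.
have bY : M * (1 - cY) <= e / 8.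
  rewrite !ler_distl in tL; have h3 : 1 - cY <= a by lra.
  by apply: (le_trans (ler_wpM2l M0 h3)); lra.
have tX' := le_trans tX bX; have tY' := le_trans tY bY.
move: tX' tY' n2; rewrite !ler_distl.
move: (mean P (fun w => f (X n w))) (mean P (fun w => f (X n w) * _)) (mean Q (fun w => f (Y w)))
  (mean Q (fun w => f (Y w) * _)) => p q r t.
by lra.
Unshelve. all: end_near. Qed.

End levy_continuity.

Lemma probability_eq_rays {R : realType} (m1 m2 : probability (measurableTypeR R) R) :
  (forall a : R, m1 `]a, +oo[%classic = m2 `]a, +oo[%classic) ->
  forall A, measurable A -> m1 A = m2 A.
Proof.
move=> m12 A mA.
apply: (@measure_unique _ R (measurableTypeR R) (@RGenOInfty.G R)
  (fun n => `]- n%:R, +oo[%classic) _ _ _ _ m1 m2) => //.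
- exact: RGenOInfty.measurableE.
- move=> _ _ [x ->] [y ->]; exists (Num.max x y).
  by apply/seteqP; split => z; rewrite /= !in_itv/= !andbT gt_max; [move=> [-> ->]|move=> /andP[]].
- by move=> n; exists (- n%:R).
- apply/seteqP; split => // x _; exists (Num.truncn `|x|).+1 => //.
  rewrite /= in_itv/= andbT ltrNl (le_lt_trans (ler_norm _))// normrN.
  exact: truncnS_gt.
- by move=> _ [a ->]; exact: m12.
- move=> n; apply: (@le_lt_trans _ _ (m1 setT)); last by rewrite probability_setT ltry.
  by apply: le_measure; rewrite ?inE//; exact: measurable_itv.
Qed.

Section characteristic_function_uniqueness.
Context {R : realType} d d' (T : measurableType d) (T' : measurableType d').
Variables (P : probability T R) (Q : probability T' R) (X : T -> R) (Y : T' -> R).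
Hypothesis mX : measurable_fun setT X.
Hypothesis mY : measurable_fun setT Y.
Hypothesis eq_cos : forall s : R,
  mean P (fun w => cos (s * X w)) = mean Q (fun w => cos (s * Y w)).
Hypothesis eq_sin : forall s : R,
  mean P (fun w => sin (s * X w)) = mean Q (fun w => sin (s * Y w)).

(** Uniqueness is the continuity theorem for a constant sequence. *)
Let eq_mean (f : R -> R) (M : R) : continuous f -> (forall x, `|f x| <= M) ->
  mean P (fun w => f (X w)) = mean Q (fun w => f (Y w)).
Proof.
move=> cf fM.
have c s : mean P (fun w => cos (s * X w)) @[n --> \oo] --> mean Q (fun w => cos (s * Y w)).
  by rewrite eq_cos; exact: cvg_cst.
have s s : mean P (fun w => sin (s * X w)) @[n --> \oo] --> mean Q (fun w => sin (s * Y w)).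
  by rewrite eq_sin; exact: cvg_cst.
have l := levy_continuity (fun=> mX) mY c s cf fM.
exact: (cvg_unique _ (cvg_cst _) l).
Qed.

(** The clamp of k (x - a) to [0, 1], in the form used for [cutoff]; vanishing for x <= a, it tends
    to the indicator of the open ray. *)
Let ramp (k : nat) (a x : R) : R := (`|k%:R * (x - a)| - `|k%:R * (x - a) - 1| + 1) / 2.

Let ramp01 k a x : `|ramp k a x| <= 1.
Proof.
rewrite /ramp; set u := k%:R * (x - a).
have e1 : `|u| <= `|u - 1| + 1.
  by have := ler_normD (u - 1) 1; rewrite normr1 subrK.
have e2 : `|u - 1| <= `|u| + 1 by have := ler_normB u 1; rewrite normr1.
by rewrite ger0_norm; lra.
Qed.

Let continuous_ramp k a : continuous (ramp k a).
Proof.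
move=> x; apply: cvgM; last exact: cvg_cst.
have h : k%:R * (y - a) @[y --> x] --> k%:R * (x - a).
  by apply: cvgMr; apply: cvgB; [exact: cvg_id|exact: cvg_cst].
apply: cvgD; last exact: cvg_cst.
by apply: cvgB; apply: cvg_norm => //; apply: cvgB => //; exact: cvg_cst.
Qed.

Let ramp_cvg a x : ramp k a x @[k --> \oo] --> (\1_`]a, +oo[ x : R).
Proof.
rewrite indicE; have [xa|ax] := leP x a.
  rewrite memNset; last by rewrite /= in_itv/= andbT ltNge xa.
  apply: (@cvg_trans _ ((0 : R) @[k --> \oo])); last exact: cvg_cst.
  apply: near_eq_cvg; apply: nearW => k.
  have u0 : k%:R * (x - a) <= 0 by rewrite mulr_ge0_le0// subr_le0.
  rewrite /ramp; move: (k%:R * (x - a)) u0 => u u0.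
  by rewrite (ler0_norm u0) ler0_norm; lra.
rewrite mem_set; last by rewrite /= in_itv/= ax.
apply: (@cvg_trans _ ((1 : R) @[k --> \oo])); last exact: cvg_cst.
apply: near_eq_cvg; near=> k.
have u1 : 1 <= k%:R * (x - a).
  by rewrite -ler_pdivrMr ?subr_gt0//; near: k; exact: nbhs_infty_ger.
rewrite /ramp; move: (k%:R * (x - a)) u1 => u u1.
by rewrite !ger0_norm; lra.
Unshelve. all: end_near. Qed.

Let eq_ray a : mean P (fun w => \1_`]a, +oo[ (X w)) = mean Q (fun w => \1_`]a, +oo[ (Y w)).
Proof.
have mr k : measurable_fun setT (ramp k a).
  by apply: continuous_measurable_fun; exact: continuous_ramp.
have l : mean P (fun w => ramp k a (X w)) @[k --> \oo] --> mean P (fun w => \1_`]a, +oo[ (X w)).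
  apply: (@mean_bounded_cvg _ _ _ _ _ _ 1).
  - by move=> k; exact: measurableT_comp (mr k) mX.
  - by move=> k w; exact: ramp01.
  - by move=> w; exact: ramp_cvg.
have r : mean Q (fun w => ramp k a (Y w)) @[k --> \oo] --> mean Q (fun w => \1_`]a, +oo[ (Y w)).
  apply: (@mean_bounded_cvg _ _ _ _ _ _ 1).
  - by move=> k; exact: measurableT_comp (mr k) mY.
  - by move=> k w; exact: ramp01.
  - by move=> w; exact: ramp_cvg.
move: l; under eq_fun do rewrite (eq_mean (@continuous_ramp _ a) (@ramp01 _ a)).
by move=> l; exact: (cvg_unique _ l r).
Qed.

Lemma eq_dist_of_char : eq_dist P X Q Y.
Proof.
pose X' : {RV P >-> measurableTypeR R} := @mfun_Sub _ _ _ (measurableTypeR R) X (mem_set mX).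
pose Y' : {RV Q >-> measurableTypeR R} := @mfun_Sub _ _ _ (measurableTypeR R) Y (mem_set mY).
pose m1 : probability (measurableTypeR R) R := distribution P X'.
pose m2 : probability (measurableTypeR R) R := distribution Q Y'.
move=> A mA; apply: (@probability_eq_rays R m1 m2 _ A mA) => a.
have mray : measurable (`]a, +oo[%classic : set R) by exact: measurable_itv.
have mXa : measurable (X @^-1` `]a, +oo[%classic).
  by rewrite -[Z in measurable Z]setTI; exact: mX.
have mYa : measurable (Y @^-1` `]a, +oo[%classic).
  by rewrite -[Z in measurable Z]setTI; exact: mY.
have e := eq_ray a.
rewrite -[LHS]/(P (X @^-1` `]a, +oo[%classic)) -[RHS]/(Q (Y @^-1` `]a, +oo[%classic)).
have fP : P (X @^-1` `]a, +oo[%classic) \is a fin_num by exact: fin_num_measure.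
have fQ : Q (Y @^-1` `]a, +oo[%classic) \is a fin_num by exact: fin_num_measure.
rewrite -(fineK fP) -(fineK fQ) -!mean_indic//; congr EFin; exact: e.
Qed.

End characteristic_function_uniqueness.

(** * Random sums *)

Section normal_mixture.
Context {R : realType} (kappa : R).
Hypothesis kappa_gt0 : 0 < kappa.
Hypothesis kappa_le1 : kappa <= 1.

Lemma mean_indep_pair d d1 d2 (T : measurableType d) (T1 : measurableType d1)
    (T2 : measurableType d2) (P : probability T R) (P1 : probability T1 R)
    (P2 : probability T2 R) (U : T -> T1) (Z : T -> T2) (f : T1 * T2 -> R) :
  measurable_fun setT U -> measurable_fun setT Z ->
  has_law P U P1 -> has_law P Z P2 -> indep P (sigma_rv U) (sigma_rv Z) -> bmeas f ->
  mean P (fun w => f (U w, Z w)) = mean P1 (fun u => mean P2 (fun z => f (u, z))).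
Proof.
move=> mU mZ PU PZ UZ bf.
have mUZ : measurable_fun setT (fun w => (U w, Z w)) by exact: measurable_fun_pair.
rewrite -mean_prod//; apply: (mean_comp mUZ) => // A mA.
pose UZrv : {RV P >-> (T1 * T2)%type} := @mfun_Sub _ _ _ _ _ (mem_set mUZ).
apply/esym; apply: (@product_measure_unique _ _ _ _ _ P1 P2 (distribution P UZrv)) => //.
move=> B C mB mC.
transitivity (P (U @^-1` B) * P (Z @^-1` C))%E; last first.
  by congr (_ * _)%E; [exact: PU|exact: PZ].
apply: UZ.
- by exists B => //; rewrite setTI.
- by exists C => //; rewrite setTI.
Qed.

Lemma bmeas_sqrtM (f : R -> R) : bmeas f ->
  bmeas (fun p : measurableTypeR R * measurableTypeR R => f (Num.sqrt (p.1 : R) * p.2)).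
Proof.
move=> bf; apply: bmeas_comp bf _; apply: measurable_funM => //.
have ms : measurable_fun setT (@Num.sqrt R).
  by apply: continuous_measurable_fun; exact: sqrt_continuous.
exact: (measurableT_comp ms measurable_fst).
Qed.

(** The square root is 0 on negative reals, which produces exactly the positive part of
    [ML_law_laplace]. *)
Let sqr_sqrt (u : R) : Num.sqrt u ^+ 2 = Num.max u 0.
Proof.
have [u0|u0] := leP 0 u; first by rewrite sqr_sqrtr// max_l.
by rewrite ltr0_sqrtr// expr0n.
Qed.

Context d (T : measurableType d) (P : probability T R) (U Z : T -> R).
Hypothesis mU : measurable_fun setT U.
Hypothesis mZ : measurable_fun setT Z.
Hypothesis PU : has_law P U (ML_law kappa).
Hypothesis PZ : has_law P Z (normal_prob 0 1).
Hypothesis UZ : indep P (sigma_rv U) (sigma_rv Z).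

Let mixture (f : R -> R) : bmeas f ->
  exists Q : probability (measurableTypeR R) R,
   (forall A, measurable A -> Q A = ML_law kappa A) /\
   mean P (fun w => f (Num.sqrt (U w) * Z w)) =
   mean Q (fun u => mean (normal_prob 0 1) (fun z => f (Num.sqrt u * z))).
Proof.
move=> bf; have [Q QE] := ML_law_exists kappa_gt0 kappa_le1.
exists Q; split => //.
pose F (p : measurableTypeR R * measurableTypeR R) := f (Num.sqrt (p.1 : R) * p.2).
have PU' : has_law (T' := measurableTypeR R) P U Q by move=> A mA; rewrite QE//; exact: PU.
exact: (@mean_indep_pair _ _ _ T (measurableTypeR R) (measurableTypeR R) P Q
  (normal_prob 0 1) U Z F mU mZ PU' PZ UZ (bmeas_sqrtM bf)).
Qed.

Lemma mean_cos_normal_mixture (s : R) :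
  mean P (fun w => cos (s * (Num.sqrt (U w) * Z w))) = mittag_leffler kappa (- (s ^+ 2 / 2)).
Proof.
have bc : bmeas (fun x : R => cos (s * x)) by exact: bmeas_cosM.
have [Q [QE ->]] := mixture bc.
have s2 : 0 <= s ^+ 2 / 2 by rewrite divr_ge0 ?sqr_ge0.
have QI : has_law Q (@id (measurableTypeR R)) (ML_law kappa) by exact: QE.
rewrite -(ML_law_laplace kappa_gt0 kappa_le1 _ QI s2)//.
congr mean; apply/funext => u.
under eq_fun do rewrite mulrA; rewrite gaussian_cos exprMn sqr_sqrt.
by congr expR; ring.
Qed.

Lemma mean_sin_normal_mixture (s : R) :
  mean P (fun w => sin (s * (Num.sqrt (U w) * Z w))) = 0.
Proof.
have bc : bmeas (fun x : R => sin (s * x)) by exact: bmeas_sinM.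
have [Q [QE ->]] := mixture bc.
rewrite -[RHS](mean_cst Q); congr mean; apply/funext => u.
by under eq_fun do rewrite mulrA; rewrite gaussian_sin.
Qed.

End normal_mixture.

Section charfun_mean.
Context {R : realType} d (T : measurableType d) (P : probability T R) (X : T -> R).
Hypothesis mX : measurable_fun setT X.

Lemma charfunE (s : R) : charfun P X s =
  Complex (mean P (fun w => cos (s * X w))) (mean P (fun w => sin (s * X w))).
Proof.
rewrite /charfun meanE; last exact: bmeas_cosM.
by rewrite meanE//; exact: bmeas_sinM.
Qed.

Lemma charfun_realP (phi : R -> R) : (forall s, charfun P X s = real_complex R (phi s)) <->
  (forall s, mean P (fun w => cos (s * X w)) = phi s) /\
  (forall s, mean P (fun w => sin (s * X w)) = 0).
Proof.
split=> [h|[hc hs] s]; last by rewrite charfunE hc hs.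
by split => s; have := h s; rewrite charfunE => -[].
Qed.

End charfun_mean.

Lemma normal_mixture_exists {R : realType} (kappa : R) : 0 < kappa -> kappa <= 1 ->
  exists (d : measure_display) (T : measurableType d) (P : probability T R) (U Z : {RV P >-> R}),
  [/\ has_law P U (ML_law kappa), has_law P Z (normal_prob 0 1)
    & indep P (sigma_rv U) (sigma_rv Z)].
Proof.
move=> kappa_gt0 kappa_le1; have [Q QE] := ML_law_exists kappa_gt0 kappa_le1.
pose G : probability (measurableTypeR R) R := normal_prob 0 1.
pose P : probability (measurableTypeR R * measurableTypeR R)%type R := (Q \x G)%E.
pose RR := (measurableTypeR R * measurableTypeR R)%type.
have m1 : @measurable_fun _ _ RR R setT fst by exact: measurable_fst.
have m2 : @measurable_fun _ _ RR R setT snd by exact: measurable_snd.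
pose U : {RV P >-> R} := @mfun_Sub _ _ RR R fst (mem_set m1).
pose Z : {RV P >-> R} := @mfun_Sub _ _ RR R snd (mem_set m2).
exists _, _, P, U, Z.
have PE A B : measurable A -> measurable B -> P (A `*` B) = (Q A * G B)%E.
  by move=> mA mB; exact: product_measure1E.
have E1 A : fst @^-1` A = A `*` (setT : set (measurableTypeR R)).
  by apply/seteqP; split => p //= [].
have E2 A : snd @^-1` A = (setT : set (measurableTypeR R)) `*` A.
  by apply/seteqP; split => p //= [].
have P1 A : measurable A -> P (fst @^-1` A) = Q A.
  by move=> mA; rewrite E1 PE// probability_setT mule1.
have P2 A : measurable A -> P (snd @^-1` A) = G A.
  by move=> mA; rewrite E2 PE// probability_setT mul1e.
split.
- by move=> A mA; rewrite -QE//; exact: P1.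
- by move=> A mA; exact: P2.
- move=> _ _ [A mA <-] [B mB <-]; rewrite !setTI.
  transitivity (P (A `*` B)); first by congr (P _).
  by rewrite PE// -P1// -P2.
Qed.

Section random_sum.
Context {R : realType} d (T : measurableType d) (P : probability T R).
Variables (W : nat -> {RV P >-> R}) (N : {RV P >-> nat}).

Let S n w := \sum_(i < n) W i w.

Let mS n : measurable_fun setT (S n).
Proof. exact: measurable_sum. Qed.

Let mN n : measurable (N @^-1` [set n]).
Proof. by rewrite -[X in measurable X]setTI; exact: measurable_funPT. Qed.

Lemma measurable_random_sum : measurable_fun setT (random_sum W N).
Proof.
move=> _ A mA; rewrite setTI.
rewrite (_ : _ @^-1` A = \bigcup_n (N @^-1` [set n] `&` S n @^-1` A)).
  apply: bigcupT_measurable => n; apply: measurableI => //.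
  by rewrite -[X in measurable X]setTI; exact: mS.
by apply/seteqP; split => [w Aw|w [n _ /= [<-]]//]; exists (N w).
Qed.

Hypothesis W_iid : iid P W.
Hypothesis NW : indep P (sigma_rv N) (sigma_rv_seq W).

(** S_n is measurable for the sigma-algebra generated by all the W_i, so its events fall under
    [NW]. *)
Let N_indep_S n : indep P (sigma_rv N) (sigma_rv (S n)).
Proof.
move=> A B hA [C mC <-]; apply: NW => //.
pose G := \bigcup_i sigma_rv (W i).
have mW i : @measurable_fun _ _ (g_sigma_algebraType G) R setT (W i).
  move=> _ D mD; apply: sub_sigma_algebra; exists i => //.
  by exists D.
have mSG : @measurable_fun _ _ (g_sigma_algebraType G) R setT (S n).
  exact: measurable_sum.
exact: mSG.
Qed.

Let bN n : bmeas (fun w => \1_[set n] (N w) : R).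
Proof. by apply: (bmeas_comp (X := N)) => //; exact: bmeas_indic. Qed.

Let sum_indic M w (F : nat -> R) :
  \sum_(n < M) \1_[set n : nat] (N w) * F n = if (N w < M)%N then F (N w) else 0.
Proof.
have e (n : nat) : \1_[set n] (N w) = (n == N w)%:R :> R.
  rewrite indicE; congr (_%:R); congr nat_of_bool.
  by apply/idP/eqP => [|->]; rewrite inE.
under eq_bigr do rewrite e.
case: ifPn => NM.
  rewrite (bigD1 (Ordinal NM))//= eqxx mul1r big1 ?addr0// => i iN.
  by rewrite (_ : (val i == N w) = false) ?mul0r//; apply: contraNF iN => /eqP iN;
    apply/eqP/val_inj.
rewrite big1// => i _; rewrite (_ : (val i == N w) = false) ?mul0r//.
by apply: contraNF NM => /eqP <-; exact: ltn_ord.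
Qed.

Let sum_probN_le1 M : \sum_(n < M) mean P (fun w => \1_[set n : nat] (N w)) <= 1.
Proof.
rewrite -mean_sum//; apply: mean_le_cst => [|w]; first exact: bmeas_sum.
have := sum_indic M w (fun=> 1); under eq_bigr do rewrite mulr1.
by move=> ->; case: ifP.
Qed.

(* Condition on the value of N, truncated at M. *)
Let random_sum_mean_le (f : R -> R) (e : nat -> R) (B : R) : bmeas f ->
  (forall n, 0 <= e n <= 1) -> (forall x, `|f x| <= 1) ->
  (forall n, `|mean P (fun w => f (S n w)) - e n| <= B) ->
  `|mean P (fun w => f (random_sum W N w)) - mean P (fun w => e (N w))| <= B.
Proof.
move=> bf e01 f1 fB.
have B0 : 0 <= B by exact: le_trans (fB 0%N).
have bfS n : bmeas (fun w => f (S n w)) by exact: bmeas_comp (mS n).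
have bfN : bmeas (fun w => f (random_sum W N w)) by exact: bmeas_comp measurable_random_sum.
have beN : bmeas (fun w => e (N w)).
  apply: (bmeas_comp (X := N)) => //; split => //; exists 1 => n.
  by have /andP[h0 h1] := e01 n; rewrite ger0_norm.
have bd n : bmeas (fun w => f (S n w) - e n) by apply: bmeasB => //; exact: bmeas_cst.
pose D M w := \sum_(n < M) \1_[set n : nat] (N w) * (f (S n w) - e n).
have lim : mean P (D M) @[M --> \oo] --> mean P (fun w => f (random_sum W N w) - e (N w)).
  apply: (@mean_bounded_cvg _ _ _ _ _ _ 2).
  - move=> M; have [] : bmeas (D M) by apply: bmeas_sum => n; exact: bmeasM.
    by [].
  - move=> M w; rewrite /D (sum_indic M w (fun n => f (S n w) - e n)).
    case: ifP => _; last by rewrite normr0.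
    rewrite (le_trans (ler_normB _ _))// -[2]/(1 + 1) lerD//.
    by have /andP[h0 h1] := e01 (N w); rewrite ger0_norm.
  - move=> w; apply: (@cvg_trans _ ((f (random_sum W N w) - e (N w)) @[M --> \oo])); last exact: cvg_cst.
    apply: near_eq_cvg; near=> M; rewrite /D (sum_indic M w (fun n => f (S n w) - e n)) ifT//.
    by near: M; exact: nbhs_infty_gt.
rewrite -meanB//; apply: (cvgr_to_le (cvg_norm lim)); apply: nearW => M.
rewrite /D mean_sum; last by move=> n; exact: bmeasM.
apply: (le_trans (ler_norm_sum _ _ _)).
apply: (@le_trans _ _ (\sum_(n < M) mean P (fun w => \1_[set n : nat] (N w)) * B)); last first.
  by rewrite -mulr_suml ler_piMl.
apply: ler_sum => n _.
have bi : bmeas (\1_[set val n] : nat -> R) by exact: bmeas_indic.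
have bfe : bmeas (fun x => f x - e n) by apply: bmeasB => //; exact: bmeas_cst.
rewrite (mean_indep (measurable_funPT N) (mS n) (@N_indep_S n) bi bfe).
rewrite normrM ger0_norm; last by apply: mean_ge0 => w; rewrite indicE.
rewrite ler_wpM2l//; first by apply: mean_ge0 => w; rewrite indicE.
by rewrite meanB ?mean_cst//; exact: bmeas_cst.
Unshelve. all: end_near. Qed.

Lemma random_sum_char_approx (t psi eta : R) : 0 <= psi < 1 ->
  `|mean P (fun w => cos (t * W 0%N w)) - psi| <= eta ->
  `|mean P (fun w => sin (t * W 0%N w))| <= eta ->
  `|mean P (fun w => cos (t * random_sum W N w)) - mean P (fun w => psi ^+ N w)| <=
    4 * eta / (1 - psi) /\
  `|mean P (fun w => sin (t * random_sum W N w))| <= 4 * eta / (1 - psi).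
Proof.
move=> psi01 hc hs; have /andP[p0 p1] := psi01.
have h n := char_sum_approx (fun i => measurable_funPT (W i)) W_iid n psi01 hc hs.
have bc : bmeas (fun x : R => cos (t * x)) by exact: bmeas_cosM.
have bs : bmeas (fun x : R => sin (t * x)) by exact: bmeas_sinM.
split.
  apply: (@random_sum_mean_le (fun x => cos (t * x)) (fun n => psi ^+ n)) => //.
  - by move=> n; rewrite exprn_ge0//= exprn_ile1// ltW.
  - by move=> x; exact: cos_max.
  - by move=> n; apply: le_trans (h n); rewrite lerDl.
have := @random_sum_mean_le (fun x => sin (t * x)) (fun=> 0) (4 * eta / (1 - psi)) bs.
rewrite mean_cst subr0; apply.
- by move=> n; rewrite lexx ler01.
- by move=> x; exact: sin_max.
- by move=> n; rewrite subr0; apply: le_trans (h n); rewrite lerDr.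
Qed.

End random_sum.

(** * Second-order expansion of the characteristic function, and convergence *)

Section second_order_expansion.
Context {R : realType} d (T : measurableType d) (P : probability T R).
Variable W : {RV P >-> R}.
Hypothesis W_mean : ('E_P[W] = 0)%E.
Hypothesis W_var : ('V_P[W] = 1)%E.

Let mW : measurable_fun setT W. Proof. exact: measurable_funPT. Qed.

Let int_W2 : (\int[P]_w ((W w) ^+ 2)%:E = 1)%E.
Proof.
have := W_var; rewrite /variance unlock W_mean /= => <-.
rewrite unlock; apply: eq_integral => w _ /=.
by congr EFin; rewrite -[RHS]/((W w - 0) * (W w - 0)) subr0 expr2.
Qed.

Let integrable_W2 : P.-integrable setT (EFin \o (fun w => W w ^+ 2)).
Proof.
apply/integrableP; split; first by apply/measurable_EFinP; exact: measurable_funX.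
under eq_integral do rewrite /= ger0_norm ?sqr_ge0//.
by rewrite int_W2 ltry.
Qed.

Let integrable_W : P.-integrable setT (EFin \o W).
Proof.
have i1 : P.-integrable setT (EFin \o (fun w => 1 + W w ^+ 2)).
  rewrite (_ : _ \o _ = (fun w => (1%:E + (W w ^+ 2)%:E)%E)); last first.
    by apply/funext => w /=; rewrite EFinD.
  by apply: integrableD => //; apply: bmeas_integrable; exact: bmeas_cst.
apply: (le_integrable _ _ _ i1) => //; first exact/measurable_EFinP.
move=> w _ /=; rewrite lee_fin [leRHS]ger0_norm; last by rewrite addr_ge0 ?sqr_ge0.
rewrite -(real_normK (num_real (W w))); move: `|W w| (normr_ge0 (W w)) => x x0.
by have := sqr_ge0 (x - 1); rewrite sqrrB1; have := sqr_ge0 x; rewrite -mulr_natr; lra.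
Qed.

Let mean_W : mean P W = 0.
Proof. by have := W_mean; rewrite unlock /mean /Rintegral => ->. Qed.

Let mean_W2 : mean P (fun w => W w ^+ 2) = 1.
Proof. by rewrite /mean /Rintegral int_W2. Qed.

Let sin_cubic (x : R) : `|sin x - x| <= `|x| ^+ 3.
Proof.
by apply: (le_trans (sin_sub_le x)); rewrite ler_pdivrMr// ler_peMr ?exprn_ge0//; lra.
Qed.

Let cos_nonneg (x : R) : 0 <= cos x - 1 + x ^+ 2 / 2.
Proof. by have := cos_ge x; lra. Qed.

Let cos_quadratic (x : R) : `|cos x - 1 + x ^+ 2 / 2| <= x ^+ 2.
Proof. by rewrite ger0_norm//; have := cos_le1 x; have := sqr_ge0 x; lra. Qed.

Let cos_cubic (x : R) : `|cos x - 1 + x ^+ 2 / 2| <= `|x| ^+ 3.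
Proof.
have [x1|x1] := leP 1 `|x|.
  apply: (le_trans (cos_quadratic x)); rewrite -(real_normK (num_real x)).
  by rewrite [leRHS]exprSr ler_peMr ?sqr_ge0.
(* The identities 1 - cos x = 2 sin^2 y and x^2 / 2 = 2 y^2 factor the remainder, and the bound on y
   - sin y gives the third order. *)
pose y := x / 2; have xE : x = y + y by rewrite /y -splitr.
have -> : cos x - 1 + x ^+ 2 / 2 = 2 * ((y - sin y) * (y + sin y)).
  rewrite xE cosD; have := cos2Dsin2 y; rewrite !expr2 => h.
  by rewrite (_ : cos y * cos y = 1 - sin y * sin y); [field|lra].
have s1 : `|y - sin y| <= `|y| ^+ 3 by rewrite distrC.
have s2 : `|y + sin y| <= 2 * `|y| + `|y| ^+ 3.
  rewrite (_ : y + sin y = 2 * y + (sin y - y)); last ring.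
  by rewrite (le_trans (ler_normD _ _))// normrM ger0_norm// lerD2l.
rewrite normrM ger0_norm// normrM.
have -> : `|x| = 2 * `|y|.
  by rewrite (_ : x = 2 * y); [rewrite normrM ger0_norm|rewrite /y; field].
have y1 : `|y| <= 1 / 2.
  by rewrite /y normrM [ `|_^-1|]ger0_norm// ler_wpM2r// ltW.
move: `|y| (normr_ge0 y) y1 s1 s2 => z z0 z1 s1 s2.
apply: (@le_trans _ _ (2 * (z ^+ 3 * (2 * z + z ^+ 3)))).
  by rewrite ler_pM2l// ler_pM.
rewrite exprMn (_ : 2 * (z ^+ 3 * (2 * z + z ^+ 3)) = z ^+ 3 * (2 * (2 * z + z ^+ 3))); last ring.
rewrite [leRHS]mulrC ler_wpM2l ?exprn_ge0//.
have : z ^+ 3 <= 1 by rewrite exprn_ile1//; lra.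
by rewrite -[2 ^+ 3]/(2 * (2 * 2)); lra.
Qed.

Let sin_quadratic (x : R) : `|sin x - x| <= x ^+ 2.
Proof.
(* At 6 the bound |x|^3 / 6 meets x^2; beyond it, 1 + |x| <= x^2 is enough. *)
rewrite -(real_normK (num_real x)); have [x6|x6] := leP `|x| 6.
  by apply: (le_trans (sin_sub_le x)); rewrite ler_pdivrMr// exprSr ler_wpM2l// sqr_ge0.
apply: (le_trans (ler_normB _ _)); apply: (@le_trans _ _ (1 + `|x|)).
  by rewrite lerD2r sin_max.
by rewrite expr2; nra.
Qed.

(** Two bounds on the remainder with two roles: the quadratic one gives the integrable dominating
    function W^2, the cubic one the pointwise limit 0. No third moment is involved. *)
Let scaled_cvg (F : R -> R) (t : nat -> R) (C : R) : continuous F ->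
  (forall n, t n != 0) -> t n @[n --> \oo] --> (0 : R) ->
  (forall x, `|F x| <= x ^+ 2) -> (forall x, `|F x| <= C * `|x| ^+ 3) ->
  mean P (fun w => F (t n * W w) / t n ^+ 2) @[n --> \oo] --> (0 : R).
Proof.
move=> cF t0 tl F2 F3.
have C0 : 0 <= C by have := F3 1; rewrite normr1 expr1n mulr1; exact: le_trans.
have mF n : measurable_fun setT (fun w => F (t n * W w) / t n ^+ 2).
  apply: measurable_funM => //; apply: measurableT_comp.
    exact: continuous_measurable_fun.
  exact: measurable_funM.
have [|||||_ _] := @dominated_convergence _ _ _ P setT measurableT
  (fun n => EFin \o (fun w => F (t n * W w) / t n ^+ 2)) (EFin \o (fun=> 0))
  (EFin \o (fun w => W w ^+ 2)).
- by move=> n; exact/measurable_EFinP.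
- by apply/measurable_EFinP.
- apply: aeW => w _; apply: cvg_EFin; first exact: nearW.
  apply/norm_cvg0P.
  apply: (@squeeze_cvgr _ _ _ _ (fun=> 0) (fun n => C * `|W w| ^+ 3 * `|t n|)).
  + apply: nearW => n; rewrite normr_ge0/= normrM.
    have T0 : 0 < `|t n| by rewrite normr_gt0.
    rewrite [ `|_^-1|]ger0_norm ?invr_ge0 ?sqr_ge0// ler_pdivrMr; last first.
      by rewrite exprn_even_gt0//= t0.
    apply: (le_trans (F3 _)); rewrite -(real_normK (num_real (t n))) normrM exprMn.
    by rewrite le_eqVlt; apply/orP; left; apply/eqP; ring.
  + exact: cvg_cst.
  + rewrite -[X in _ --> X](mulr0 (C * `|W w| ^+ 3)); apply: cvgMr.
    by rewrite -(normr0 R); exact: cvg_norm.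
- exact: integrable_W2.
- apply: aeW => w n _ /=; rewrite lee_fin normrM [ `|_^-1|]ger0_norm ?invr_ge0 ?sqr_ge0//.
  rewrite ler_pdivrMr; last by rewrite exprn_even_gt0//= t0.
  by apply: (le_trans (F2 _)); rewrite exprMn mulrC.
by rewrite integral0_eq// => h; exact: (fine_cvg h).
Qed.

Lemma mean_cos_expansion (t : nat -> R) : (forall n, t n != 0) -> t n @[n --> \oo] --> (0 : R) ->
  (mean P (fun w => cos (t n * W w)) - (1 - t n ^+ 2 / 2)) / t n ^+ 2 @[n --> \oo] --> (0 : R).
Proof.
move=> t0 tl.
have cF : continuous (fun x : R => cos x - 1 + x ^+ 2 / 2).
  move=> x; apply: cvgD; first by apply: cvgB; [exact: continuous_cos|exact: cvg_cst].
  by apply: cvgM; [exact: exprn_continuous|exact: cvg_cst].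
have := scaled_cvg (C := 1) cF t0 tl cos_quadratic.
move=> /(_ _)/wrap[]; first by move=> x; rewrite mul1r.
apply: cvg_trans; apply: near_eq_cvg; apply: nearW => n.
have bc : bmeas (fun w => cos (t n * W w)) by exact: bmeas_cosM.
transitivity (mean P (fun w => (t n ^+ 2)^-1 * (cos (t n * W w) - 1) + 2^-1 * W w ^+ 2)).
  by congr mean; apply/funext => w; field; exact: t0.
rewrite /mean RintegralD//; last 2 first.
- by apply: bmeas_integrable; apply: bmeasZ; apply: bmeasB => //; exact: bmeas_cst.
- exact: integrableZl integrable_W2.
rewrite -!/(mean P _) meanZ; last by apply: bmeasB => //; exact: bmeas_cst.
have -> : mean P (fun w => 2^-1 * W w ^+ 2) = 2^-1.
  by rewrite /mean RintegralZl// -/(mean P _) mean_W2 mulr1.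
by rewrite meanB ?mean_cst//; [field; exact: t0|exact: bmeas_cst].
Qed.

(** Centring removes the linear term of the sine, which would be of order 1 / t after division. *)
Lemma mean_sin_expansion (t : nat -> R) : (forall n, t n != 0) -> t n @[n --> \oo] --> (0 : R) ->
  mean P (fun w => sin (t n * W w)) / t n ^+ 2 @[n --> \oo] --> (0 : R).
Proof.
move=> t0 tl.
have cF : continuous (fun x : R => sin x - x).
  by move=> x; apply: cvgB; [exact: continuous_sin|exact: cvg_id].
have := scaled_cvg (C := 1) cF t0 tl sin_quadratic.
move=> /(_ _)/wrap[]; first by move=> x; rewrite mul1r.
apply: cvg_trans; apply: near_eq_cvg; apply: nearW => n.
have bc : bmeas (fun w => sin (t n * W w)) by exact: bmeas_sinM.
transitivity (mean P (fun w => (t n ^+ 2)^-1 * sin (t n * W w) + - (t n)^-1 * W w)).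
  by congr mean; apply/funext => w; field; exact: t0.
rewrite /mean RintegralD//; last 2 first.
- by apply: bmeas_integrable; exact: bmeasZ.
- exact: integrableZl integrable_W.
rewrite -!/(mean P _) meanZ//.
have -> : mean P (fun w => - (t n)^-1 * W w) = 0.
  by rewrite /mean RintegralZl// -/(mean P _) mean_W mulr0.
by rewrite addr0 mulrC.
Qed.

End second_order_expansion.

Section scaled_random_sum.
Context {R : realType} (kappa : R).
Hypothesis kappa_gt0 : 0 < kappa.
Hypothesis kappa_le1 : kappa <= 1.
Context d (T : measurableType d) (P : probability T R).
Variables (N : R -> {RV P >-> nat}) (W : nat -> {RV P >-> R}).
Hypothesis N_FP : forall nu, 0 < nu -> frac_poisson nu kappa P (N nu).
Hypothesis W_iid : iid P W.
Hypothesis NW_indep : forall nu, 0 < nu -> indep P (sigma_rv (N nu)) (sigma_rv_seq W).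
Hypothesis W_mean : ('E_P[W 0%N] = 0)%E.
Hypothesis W_var : ('V_P[W 0%N] = 1)%E.
Variable nu : nat -> R.
Hypothesis nu_gt0 : forall n, 0 < nu n.
Hypothesis nu_cvg : nu n @[n --> \oo] --> +oo.

Let X n w := (Num.sqrt (nu n))^-1 * random_sum W (N (nu n)) w.

Lemma scaled_random_sum_char (s : R) :
  mean P (fun w => cos (s * X n w)) @[n --> \oo] --> mittag_leffler kappa (- (s ^+ 2 / 2)) /\
  mean P (fun w => sin (s * X n w)) @[n --> \oo] --> (0 : R).
Proof.
(* The expansions divide by [t n], so s = 0 is treated apart. *)
have [->|s0] := eqVneq s 0.
  rewrite expr0n/= mul0r oppr0 mittag_leffler0//.
  split; under eq_fun do under eq_fun do rewrite mul0r ?cos0 ?sin0.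
    by rewrite mean_cst; exact: cvg_cst.
  by rewrite mean_cst; exact: cvg_cst.
pose t n := s * (Num.sqrt (nu n))^-1.
have sq0 n : 0 < Num.sqrt (nu n) by rewrite sqrtr_gt0.
have t0 n : t n != 0 by rewrite mulf_neq0// invr_neq0// gt_eqF.
have t2 n : t n ^+ 2 = s ^+ 2 / nu n by rewrite exprMn exprVn sqr_sqrtr// ltW.
have tl : t n @[n --> \oo] --> (0 : R).
  rewrite -[X in _ --> X](mulr0 s); apply: cvgMr.
  apply/gtr0_cvgV0; first exact: nearW.
  apply/cvgryPge => A; near=> n.
  rewrite (le_trans (ler_norm A))// -sqrtr_sqr ler_sqrt ?(ltW (nu_gt0 _))//.
  by near: n; move/cvgryPge : nu_cvg; exact.
pose psi n := 1 - t n ^+ 2 / 2.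
pose eta n := `|mean P (fun w => cos (t n * W 0%N w)) - psi n| +
              `|mean P (fun w => sin (t n * W 0%N w))|.
have e0 : 4 * eta n / (1 - psi n) @[n --> \oo] --> (0 : R).
  have c1 := cvg_norm (mean_cos_expansion W_mean W_var t0 tl).
  have c2 := cvg_norm (mean_sin_expansion W_mean W_var t0 tl).
  (* As 1 - psi is t^2 / 2, the factor 4 becomes 8 over t^2, and the two expansions apply. *)
  have : 8 * (`|(mean P (fun w => cos (t n * W 0%N w)) - psi n) / t n ^+ 2| +
      `|mean P (fun w => sin (t n * W 0%N w)) / t n ^+ 2|) @[n --> \oo] --> (0 : R).
    rewrite -[X in _ --> X](mulr0 8); apply: cvgMr.
    rewrite normr0 in c1 c2; rewrite -[X in _ --> X]addr0.
    by apply: cvgD; [exact: c1|exact: c2].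
  apply: cvg_trans; apply: near_eq_cvg; apply: nearW => n.
  have T0 : 0 < t n ^+ 2 by rewrite exprn_even_gt0//= t0.
  rewrite !normrM [ `|(_ ^+ 2)^-1|]gtr0_norm ?invr_gt0// /eta /psi.
  move: `|_| `|_| => a b; rewrite opprB addrCA subrr addr0.
  by field; exact: t0.
have psi01 : \forall n \near \oo, 0 <= psi n < 1.
  near=> n; apply/andP; split; last first.
    by rewrite ltrBlDr ltrDl divr_gt0// exprn_even_gt0//= t0.
  have t1 : `|t n| <= 1.
    by near: n; apply: cvgr0_norm_le.
  have : t n ^+ 2 <= 1 by rewrite -(real_normK (num_real _)) exprn_ile1.
  by rewrite /psi; lra.
have approx n : 0 <= psi n < 1 ->
    `|mean P (fun w => cos (s * X n w)) - mittag_leffler kappa (- (s ^+ 2 / 2))| <=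
      4 * eta n / (1 - psi n) /\
    `|mean P (fun w => sin (s * X n w))| <= 4 * eta n / (1 - psi n).
  move=> p01; have /andP[p0 p1] := p01.
  have rate0 : 0 < (1 - psi n) * nu n by rewrite mulr_gt0// subr_gt0.
  (* The hypothesis [N_FP] is used at two rates: nu n, and (1 - psi n) nu n for the auxiliary
     waiting time. The latter rate is s^2 / 2 for every n, so the limit is already the exact
     value. *)
  have pgf := frac_poisson_pgf kappa_gt0 kappa_le1 (nu_gt0 n) p01
    (measurable_funPT (N (nu n))) (N_FP (nu_gt0 n)) (N_FP rate0).
  have nuE : nu n * (1 - psi n) = s ^+ 2 / 2.
    by rewrite /psi t2; field; rewrite gt_eqF.
  rewrite nuE in pgf; rewrite -pgf.
  have [||hc hs] := @random_sum_char_approx _ _ _ P W (N (nu n)) W_iid (NW_indep (nu_gt0 n))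
    (t n) (psi n) (eta n) p01; [by rewrite lerDl|by rewrite lerDr|].
  have tE w : s * X n w = t n * random_sum W (N (nu n)) w by rewrite mulrA.
  split.
    by under eq_fun do rewrite tE; exact: hc.
  by under eq_fun do rewrite tE; exact: hs.
split.
  apply/cvgrPdist_le => e egt0; near=> n.
  have p01 : 0 <= psi n < 1 by near: n.
  rewrite distrC (le_trans (approx n p01).1)// (le_trans (ler_norm _))//.
  by near: n; exact: cvgr0_norm_le.
apply/cvgr0Pnorm_le => e egt0; near=> n.
have p01 : 0 <= psi n < 1 by near: n.
rewrite (le_trans (approx n p01).2)// (le_trans (ler_norm _))//.
by near: n; exact: cvgr0_norm_le.
Unshelve. all: end_near. Qed.

End scaled_random_sum.

Lemma random_sum_cvg_dist {R : realType} (kappa : R) : 0 < kappa -> kappa <= 1 ->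
  forall d (T : measurableType d) (P : probability T R)
    (N : R -> {RV P >-> nat}) (W : nat -> {RV P >-> R}),
  (forall nu, 0 < nu -> frac_poisson nu kappa P (N nu)) -> iid P W ->
  (forall nu, 0 < nu -> indep P (sigma_rv (N nu)) (sigma_rv_seq W)) ->
  ('E_P[W 0%N] = 0)%E -> ('V_P[W 0%N] = 1)%E ->
  forall d' (T' : measurableType d') (Q : probability T' R) (Y : T' -> R),
  measurable_fun setT Y ->
  (forall s, mean Q (fun w => cos (s * Y w)) = mittag_leffler kappa (- (s ^+ 2 / 2))) ->
  (forall s, mean Q (fun w => sin (s * Y w)) = 0) ->
  cvg_dist P (fun nu w => (Num.sqrt nu)^-1 * random_sum W (N nu) w) Q Y.
Proof.
move=> kappa_gt0 kappa_le1 d T P N W N_FP W_iid NW W_mean W_var d' T' Q Y mY Yc Ys f cf [M fM].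
have bf : bmeas f by split; [exact: continuous_measurable_fun|exists M].
have mX nu : measurable_fun setT (fun w => (Num.sqrt nu)^-1 * random_sum W (N nu) w).
  by apply: measurable_funM => //; exact: measurable_random_sum.
under eq_fun => nu do rewrite (meanE _ (bmeas_comp bf (mX nu))).
rewrite (meanE _ (bmeas_comp bf mY)).
apply/cvge_pinftyP => u u_cvg; apply: cvg_EFin; first exact: nearW.
(* An arbitrary sequence tending to +oo may start with nonpositive values, where N is not
   controlled; the maximum with 1 changes finitely many terms. *)
pose nu n := Num.max (u n) 1.
have nu0 n : 0 < nu n by rewrite lt_max ltr01 orbT.
have u_nu : \forall n \near \oo, nu n = u n.
  near=> n; rewrite /nu max_l//; near: n; move/cvgryPge : u_cvg; exact.
have nu_cvg : nu n @[n --> \oo] --> +oo.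
  by apply: cvg_trans u_cvg; apply: near_eq_cvg; near do apply/esym.
have char := scaled_random_sum_char kappa_gt0 kappa_le1 N_FP W_iid NW W_mean W_var nu0 nu_cvg.
have l := levy_continuity (fun n => mX (nu n)) mY _ _ cf fM.
apply: (@cvg_trans _ (mean P (fun w => f ((Num.sqrt (nu n))^-1 * random_sum W (N (nu n)) w))
  @[n --> \oo])).
  by apply: near_eq_cvg; near=> n; rewrite /= (near u_nu n).
apply: l => s; first by rewrite Yc; exact: (char s).1.
by rewrite Ys; exact: (char s).2.
Unshelve. all: end_near. Qed.

Theorem proposition2p1 (R : realType) (kappa : R)
    (kappa_gt0 : 0 < kappa) (kappa_le1 : kappa <= 1)
    (d : measure_display) (T : measurableType d) (P : probability T R)
    (N : R -> {RV P >-> nat}) (W : nat -> {RV P >-> R})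
    (N_FP : forall nu, 0 < nu -> frac_poisson nu kappa P (N nu))
    (W_iid : iid P W)
    (NW_indep : forall nu, 0 < nu ->
       indep P (sigma_rv (N nu)) (sigma_rv_seq W))
    (W_mean : ('E_P[W 0%N] = 0)%E)
    (W_var : ('V_P[W 0%N] = 1)%E) :
  (exists (d' : measure_display) (T' : measurableType d')
     (Q : probability T' R) (Y : {RV Q >-> R}),
     forall s : R,
       charfun Q Y s = real_complex R (mittag_leffler kappa (- (s ^+ 2 / 2)))) /\
  (forall (d' : measure_display) (T' : measurableType d')
     (Q : probability T' R) (Y : {RV Q >-> R}),
     (forall s : R,
       charfun Q Y s = real_complex R (mittag_leffler kappa (- (s ^+ 2 / 2)))) ->
     [/\ (* (i) *)
         cvg_dist P
           (fun nu w => (Num.sqrt nu)^-1 * random_sum W (N nu) w) Q Y,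
         (* (ii), existence of the representation *)
         exists (d1 : measure_display) (T1 : measurableType d1)
           (P1 : probability T1 R) (U Z : {RV P1 >-> R}),
           [/\ has_law P1 U (ML_law kappa),
               has_law P1 Z (normal_prob 0 1),
               indep P1 (sigma_rv U) (sigma_rv Z)
             & eq_dist Q Y P1 (fun w => Num.sqrt (U w) * Z w)]
       & (* (ii), for any such U and Z *)
         forall (d1 : measure_display) (T1 : measurableType d1)
           (P1 : probability T1 R) (U Z : {RV P1 >-> R}),
           has_law P1 U (ML_law kappa) ->
           has_law P1 Z (normal_prob 0 1) ->
           indep P1 (sigma_rv U) (sigma_rv Z) ->
           eq_dist Q Y P1 (fun w => Num.sqrt (U w) * Z w)]).
Proof.
(* One model of (U, Z) serves twice: it provides a Y with the prescribed characteristic function,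
   and the representation of any other such Y. *)
have [dm [Tm [Pm [Um [Zm [PU PZ UZ]]]]]] := normal_mixture_exists kappa_gt0 kappa_le1.
have mUZ d1 (T1 : measurableType d1) (P1 : probability T1 R) (U Z : {RV P1 >-> R}) :
    measurable_fun setT (fun w => Num.sqrt (U w) * Z w).
  apply: measurable_funM => //; apply: measurableT_comp => //.
  by apply: continuous_measurable_fun; exact: sqrt_continuous.
split.
  pose Y : {RV Pm >-> R} := @mfun_Sub _ _ _ _ _ (mem_set (mUZ _ _ _ Um Zm)).
  exists dm, Tm, Pm, Y; apply: (proj2 (charfun_realP Pm (measurable_funPT Y) _)).
  split => s; first exact: mean_cos_normal_mixture.
  exact: (mean_sin_normal_mixture kappa_gt0 kappa_le1 (measurable_funPT Um)
    (measurable_funPT Zm) PU PZ UZ).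
move=> d' T' Q Y charY.
have [Yc Ys] := (charfun_realP Q (measurable_funPT Y) _).1 charY.
have repr d1 (T1 : measurableType d1) (P1 : probability T1 R) (U Z : {RV P1 >-> R}) :
    has_law P1 U (ML_law kappa) -> has_law P1 Z (normal_prob 0 1) ->
    indep P1 (sigma_rv U) (sigma_rv Z) -> eq_dist Q Y P1 (fun w => Num.sqrt (U w) * Z w).
  move=> P1U P1Z U1Z; apply: eq_dist_of_char => // s.
    by rewrite Yc (mean_cos_normal_mixture kappa_gt0 kappa_le1).
  by rewrite Ys (mean_sin_normal_mixture kappa_gt0 kappa_le1 _ _ P1U P1Z U1Z).
split; [|by exists dm, Tm, Pm, Um, Zm; split => //; exact: repr|exact: repr].
exact: (random_sum_cvg_dist kappa_gt0 kappa_le1 N_FP W_iid NW_indep W_mean W_var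
  (measurable_funPT Y) Yc Ys).
Qed.
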